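(* Let $\{F_n:(\mathbb T^2,h_n)\to\mathbb C^2\}_{n\in\mathbb N}$ be a sequence of smooth branched conformal HSL immersions, where $h_n$ are model flat metrics on $\mathbb T^2$, with uniformly bounded areas and uniformly bounded Willmore energies. Assume that $0\in F_n(\mathbb T^2)$ for all $n\in\mathbb N$. Then either $\{F_n\}$ converges to a point, or a subsequence of $\{F_n\}$ converges smoothly to a smooth branched conformal HSL immersion $F_\infty:(\mathbb T^2,h_\infty)\to\mathbb C^2$ for some flat metric $h_\infty$ on $\mathbb T^2$, and the corresponding conformal structures of $h_n$ converge to the conformal structure of $h_\infty$.
   Context: $\mathbb C^2$ carries its standard flat Kähler structure $(\omega,J,\bar g)$ with $\omega(X,Y)=\bar g(JX,Y)$. **Model metrics.** $\mathbb T^2=\mathbb S^1\times\mathbb S^1=\mathbb R^2/\mathbb Z^2$, and a model metric is $$h=\begin{pmatrix}1&\tau_1\\0&\tau_2\end{pmatrix}^{t}\begin{pmatrix}1&\tau_1\\0&\tau_2\end{pmatrix},$$ where $-\frac12\le\tau_1\le\frac12$, $\tau_2>0$, $\tau_1^2+\tau_2^2\ge1$, and $\tau_1\ge0$ whenever $\tau_1^2+\tau_2^2=1$. Thus $(\mathbb T^2,h)$ is isometric to $\mathbb C/\operatorname{span}_{\mathbb Z}\{1,\tau_1+\sqrt{-1}\,\tau_2\}$. Every conformal structure on the torus is represented by such a metric. **Branched conformal HSL immersions.** Let $\Sigma$ be a surface with Riemannian metric $h$. A smooth map $F:\Sigma\to\mathbb C^2$ is a branched conformal immersion if $g:=F^*\bar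 g=\lambda h$ with $\lambda\ge0$ vanishing only at finitely many points (the branch set $\mathscr B$). $F$ is Lagrangian if $F^*\omega=0$. Away from $\mathscr B$ let $\vec H$ be the mean curvature vector (trace of the second fundamental form) and $\alpha(Y)=\omega(\vec H,F_*Y)$ the mean curvature 1-form. A Lagrangian branched conformal immersion is Hamiltonian stationary Lagrangian (HSL) if $d_g^*\alpha=0$ on $\Sigma\setminus\mathscr B$. **Area and Willmore energy.** $\operatorname{Area}(F)$ is the area of $\Sigma$ with respect to $g=F^*\bar g$, and $\mathcal W(F)=\frac14\int_\Sigma|\vec H|^2\,d\mu_g$. **Convergence.** ''$\{F_n\}$ converges to a point'' means that the images $F_n(\mathbb T^2)$ converge in Hausdorff distance to a single point. Smooth convergence means $C^k$ convergence on $\mathbb T^2$ for every $k$. *)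

(* Defs.v *)
From HB Require Import structures.
From mathcomp Require Export all_boot all_order all_algebra.
From mathcomp Require Export all_classical all_reals all_analysis.

Set Implicit Arguments.
Unset Strict Implicit.
Unset Printing Implicit Defensive.

Import Order.TTheory GRing.Theory Num.Theory.
Import numFieldNormedType.Exports.

Local Open Scope classical_set_scope.
Local Open Scope ring_scope.

Section Plane.
Context {R : realType}.

(* Functions on T^2 = R^2/Z^2 are represented by their Z^2-periodic lifts
   to the plane. *)
Definition periodic {V : Type} (f : R * R -> V) : Prop :=
  forall p, f (p + (1, 0)) = f p /\ f (p + (0, 1)) = f p.

Definition stdbasis (i : 'I_2) : R * R := if i == ord0 then (1, 0) else (0, 1).

Definition partial {V : normedModType R} (i : 'I_2) (f : R * R -> V)
  : R * R -> V := fun p => 'D_(stdbasis i) f p.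

Definition partials {V : normedModType R} (s : seq 'I_2) (f : R * R -> V)
  : R * R -> V := foldr partial f s.

Definition smooth {V : normedModType R} (f : R * R -> V) : Prop :=
  forall s : seq 'I_2,
    continuous (partials s f) /\
    forall i p, derivable (partials s f) p (stdbasis i).

(* For periodic maps, uniform convergence on the plane is uniform convergence
   on T^2. *)
Definition Ck_cvg {V : normedModType R} (k : nat)
    (f : nat -> R * R -> V) (g : R * R -> V) : Prop :=
  forall s : seq 'I_2, (size s <= k)%N -> forall e : R, 0 < e ->
    \forall n \near \oo, forall p, `|partials s (f n) p - partials s g p| < e.

Definition smooth_cvg {V : normedModType R}
    (f : nat -> R * R -> V) (g : R * R -> V) : Prop :=
  forall k, Ck_cvg k f g.

End Plane.

Section Metrics.
Context {R : realType}.

Definition riemannian_metric (h : R * R -> 'M[R]_2) : Prop :=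
  [/\ periodic h, smooth h, forall p, (h p)^T = h p &
      forall p (v : 'rV[R]_2), v != 0 -> 0 < (v *m h p *m v^T) ord0 ord0].

Definition frame_mx (t1 t2 : R) : 'M[R]_2 :=
  block_mx (1%:M : 'M[R]_1) (t1%:M : 'M[R]_1) (0 : 'M[R]_1) (t2%:M : 'M[R]_1).

Definition model_metric (h : R * R -> 'M[R]_2) : Prop :=
  exists t1 t2 : R,
    [/\ - (1 / 2) <= t1 <= 1 / 2, 0 < t2, 1 <= t1 ^+ 2 + t2 ^+ 2,
        t1 ^+ 2 + t2 ^+ 2 = 1 -> 0 <= t1 &
        forall p, h p = (frame_mx t1 t2)^T *m frame_mx t1 t2].

(* [christoffel h k i j] is Gamma^k_{ij}. *)
Definition christoffel (h : R * R -> 'M[R]_2) (k i j : 'I_2) : R * R -> R :=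
  fun p => 2^-1 * \sum_l invmx (h p) k l *
    (partial i (fun q => h q j l) p + partial j (fun q => h q i l) p
     - partial l (fun q => h q i j) p).

(* [riemann_curvature h l k i j] is R^l_{kij}, the l-component of
   R(e_i, e_j) e_k. *)
Definition riemann_curvature (h : R * R -> 'M[R]_2) (l k i j : 'I_2)
  : R * R -> R :=
  fun p => partial i (christoffel h l j k) p - partial j (christoffel h l i k) p
    + \sum_m (christoffel h l i m p * christoffel h m j k p
              - christoffel h l j m p * christoffel h m i k p).

Definition flat_metric (h : R * R -> 'M[R]_2) : Prop :=
  riemannian_metric h /\ forall l k i j p, riemann_curvature h l k i j p = 0.

(* A conformal structure on T^2 is a class of Riemannian metrics modulo
   multiplication by positive smooth functions.  The classes [h n] converge to
   the class of [g] in the quotient of the smooth topology iff suitable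
   representatives converge smoothly to [g], because the quotient map by this
   group action is open. *)
Definition conformal_structure_cvg
    (h : nat -> R * R -> 'M[R]_2) (g : R * R -> 'M[R]_2) : Prop :=
  exists u : nat -> R * R -> R,
    (forall n, [/\ periodic (u n), smooth (u n : R * R -> R^o) &
                   forall p, 0 < u n p]) /\
    smooth_cvg (fun n p => u n p *: h n p) g.

End Metrics.

(* The pair (x, y) stands for x + sqrt(-1) y in C^2. *)
Definition C2 (R : realType) : normedModType R := ('rV[R]_2 * 'rV[R]_2)%type.

Section Target.
Context {R : realType}.

Definition gbar (X Y : C2 R) : R :=
  \sum_(i < 2) X.1 ord0 i * Y.1 ord0 i + \sum_(i < 2) X.2 ord0 i * Y.2 ord0 i.

Definition Jstd (X : C2 R) : C2 R := (- X.2, X.1).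

Definition omega (X Y : C2 R) : R := gbar (Jstd X) Y.

Definition edist (X Y : C2 R) : R := Num.sqrt (gbar (X - Y) (X - Y)).

Definition hausdorff_dist (A B : set (C2 R)) : \bar R :=
  maxe
    (ereal_sup [set ereal_inf [set (edist a b)%:E | b in B] | a in A])
    (ereal_sup [set ereal_inf [set (edist a b)%:E | a in A] | b in B]).

Definition converges_to_point (F : nat -> R * R -> C2 R) : Prop :=
  exists z : C2 R,
    hausdorff_dist (range (F n)) [set z] @[n --> \oo] --> (0 : \bar R)%E.

End Target.

Section Immersions.
Context {R : realType}.
Implicit Types (F : R * R -> C2 R) (h : R * R -> 'M[R]_2).

Definition induced_metric F : R * R -> 'M[R]_2 :=
  fun p => \matrix_(i, j) gbar (partial i F p) (partial j F p).

Definition area_density F : R * R -> R :=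
  fun p => Num.sqrt (\det (induced_metric F p)).

(* The finiteness of the zero set on T^2 is tested on the fundamental domain
   [0, 1[ x [0, 1[. *)
Definition branched_conformal_immersion h F : Prop :=
  exists lambda : R * R -> R,
    [/\ forall p, 0 <= lambda p,
        forall p, induced_metric F p = lambda p *: h p &
        finite_set ([set p | lambda p = 0] `&` (`[0, 1[ `*` `[0, 1[))].

(* If g = lambda h with h positive definite, then g p = 0 iff lambda p = 0. *)
Definition branch_set F : set (R * R) := [set p | induced_metric F p = 0].

Definition lagrangian F : Prop :=
  forall p (i j : 'I_2), omega (partial i F p) (partial j F p) = 0.

(* Meaningful off the branch set, like the quantities below. *)
Definition normal_part F (p : R * R) (v : C2 R) : C2 R :=
  v - \sum_k \sum_l
        (invmx (induced_metric F p) k l * gbar v (partial k F p))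
          *: partial l F p.

Definition second_fundamental_form F (i j : 'I_2) : R * R -> C2 R :=
  fun p => normal_part F p (partial i (partial j F) p).

Definition mean_curvature F : R * R -> C2 R :=
  fun p => \sum_i \sum_j
    invmx (induced_metric F p) i j *: second_fundamental_form F i j p.

Definition mean_curvature_form F (i : 'I_2) : R * R -> R :=
  fun p => omega (mean_curvature F p) (partial i F p).

(* d_g^* a = - (det g)^(-1/2) d_i ((det g)^(1/2) g^{ij} a_j) for the induced
   metric g. *)
Definition codifferential F (a : 'I_2 -> R * R -> R) : R * R -> R :=
  fun p => - ((area_density F p)^-1 *
    \sum_i partial i (fun q => \sum_j area_density F q *
                         invmx (induced_metric F q) i j * a j q) p).

Definition hamiltonian_stationary F : Prop :=
  forall p, ~ branch_set F p -> codifferential F (mean_curvature_form F) p = 0.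

Definition branched_conformal_HSL h F : Prop :=
  [/\ periodic F, smooth F, branched_conformal_immersion h F, lagrangian F &
      hamiltonian_stationary F].

Definition torus_integral (f : R * R -> R) : \bar R :=
  (\int[(@lebesgue_measure R \x @lebesgue_measure R)%E]_(p in
     `[0%R, 1%R[ `*` `[0%R, 1%R[) (f p)%:E)%E.

Definition area F : \bar R := torus_integral (area_density F).

(* The area density vanishes on the branch set, so the values of
   [mean_curvature] there are irrelevant. *)
Definition willmore_density F : R * R -> R :=
  fun p => gbar (mean_curvature F p) (mean_curvature F p) * area_density F p.

Definition willmore F : \bar R :=
  ((4^-1)%R%:E * torus_integral (willmore_density F))%E.

End Immersions.

(* Main.v *)
From HB Require Import structures.
Require Import Defs.
Import Order.TTheory GRing.Theory Num.Theory.
Import numFieldNormedType.Exports.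
From mathcomp Require Import measurable_realfun ring lra zify.

Set Implicit Arguments.
Unset Strict Implicit.
Unset Printing Implicit Defensive.

Local Open Scope classical_set_scope.
Local Open Scope ring_scope.

(** Let F be a branched conformal Hamiltonian stationary Lagrangian immersion of
a torus with model metric h of parameters t1, t2, and let alpha be its mean
curvature form.  Off the finite branch set alpha is closed, because it is the
differential of the Lagrangian angle ([angle_formula]), and coclosed by
hypothesis, and the Willmore energy controls its L^2 norm, which is conformally
invariant.  In dimension two isolated points are removable for square integrable
harmonic forms ([weak_divergence]), so alpha has constant coefficients c
([alpha_const]).  Since the Laplacian of a conformal Lagrangian immersion is
normal and alpha is its pairing with the tangent vectors, F solves a linear
equation with constant coefficients on the whole torus ([hsl_equation]),

    Delta_h F = - J (c^# F),   c^# the vector field dual to c for h,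

in which |c|^2_h times the area of h is at most four times the Willmore energy.

On the Fourier mode of F of frequency k the equation reads
4 pi^2 |k|^2 = +/- 2 pi <c, k>, so only frequencies with 2 pi |k| <= |c| occur
([resonance_bound]).  This has two consequences.  First t2 is bounded: for
large t2 the surviving frequencies would be constant in the first
variable and F would be degenerate everywhere ([t2_le]); hence conformal
structures cannot degenerate.  Second, all frequencies lie in a box [-M, M]^2
where M depends on the Willmore bound only ([high_modes]).  The coefficients are
bounded by the area ([moment_bound]), and the constant one by the condition that
0 is in the image ([fourier_coef_bound]).

A bounded sequence of immersions is thus a bounded sequence in a
finite-dimensional space of trigonometric maps, together with the parameters t1,
t2, c; a subsequence converges, and convergence of coefficients is smooth
convergence.  Conformality, the Lagrangian condition and the linear equation pass
to the limit, and the equation gives back the Hamiltonian stationary condition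
([stationary_of_hsl]).  If the sequence does not shrink to 0, the subsequence
can be chosen so that the limit is not constant ([limit_nonconstant]).

It remains to see that a nonconstant limit has finitely many branch points.  The
gradient solves a Cauchy-Riemann system up to lower order terms, so at a point
the leading part of its Taylor expansion has the same size in all directions,
like that of a holomorphic function ([rotation_identity]).  If zeros of the
gradient accumulate at a point, then all derivatives vanish there
([accumulation_flat]), and since trigonometric maps are analytic, the map is
constant ([flat_everywhere]). *)

(** * Means over the torus *)
Notation plane R := (measurableTypeR R * measurableTypeR R)%type.
Notation leb2 R := (@lebesgue_measure R \x @lebesgue_measure R)%E.

Section TorusIntegral.
Context {R : realType}.
Implicit Types (f g : R * R -> R).

Definition square : set (R * R) := `[0, 1[ `*` `[0, 1[.

Definition summable f : Prop := (leb2 R).-integrable square (EFin \o f).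

Definition mean f : R := \int[(leb2 R)]_(p in square) f p.

(** The product sigma-algebra contains the balls, and an open set of the plane is
    the union of the countably many balls of rational centre and radius in it. *)
Lemma open_plane_measurable (U : set (plane R)) : open (U : set (R * R)) -> measurable U.
Proof.
move=> oU.
pose box (a : rat * rat * rat) : set (R * R) :=
  ball (ratr a.1.1 : R) (ratr a.2) `*` ball (ratr a.1.2 : R) (ratr a.2).
have -> : U = \bigcup_(a : rat * rat * rat)
    (if `[< box a `<=` U >] then box a else set0).
  apply/seteqP; split=> [[x y] Uxy|p [a _]]; last by case: asboolP => // aU /aU.
  have /nbhs_ballP[e /= e0 eU] := open_nbhs_nbhs (conj oU Uxy).
  have e8 : 0 < e / 8 by lra.
  have [q1 q1e] : exists q : rat, ratr q \in `]x - e / 8, x + e / 8[.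
    by apply: rat_in_itvoo; lra.
  have [q2 q2e] : exists q : rat, ratr q \in `]y - e / 8, y + e / 8[.
    by apply: rat_in_itvoo; lra.
  have [q3 q3e] : exists q : rat, ratr q \in `]e / 8, e / 4[.
    by apply: rat_in_itvoo; lra.
  move: q1e q2e q3e; rewrite !in_itv/= => /andP[a1 a2] /andP[b1 b2] /andP[c1 c2].
  exists (q1, q2, q3) => //; case: asboolP => [_|].
    by split; rewrite /= /ball/= ltr_norml; apply/andP; split; lra.
  case=> -[u v] [/= ]; rewrite /ball/= !ltr_norml => /andP[u1 u2] /andP[v1 v2].
  by apply: eU; split; rewrite /= /ball/= ltr_norml; apply/andP; split; lra.
apply: countable_bigcupT_measurable; first exact: countableP.
move=> a; case: asboolP => // _.
by apply: measurableX; apply: measurable_realfun.open_measurable; exact: ball_open.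
Qed.

Lemma continuous_plane_measurable f :
  continuous f -> measurable_fun [set: plane R] (f : _ -> measurableTypeR R).
Proof.
move=> /continuousP cf; apply: (measurability _ (measurable_realfun.RGenOpens.measurableE R)).
move=> _ [_ [a [b ->] <-]]; rewrite setTI.
by apply: open_plane_measurable; apply: cf; exact: interval_open.
Qed.

Lemma square_measurable : measurable (square : set (plane R)).
Proof. by apply: measurableX; exact: measurable_itv. Qed.

Lemma square_measure : (leb2 R) square = 1%E.
Proof.
rewrite /square product_measure1E; [|exact: measurable_itv|exact: measurable_itv].
by rewrite /= lebesgue_measure_itv/= lte_fin ltr01 oppr0 adde0 mule1.
Qed.

Lemma continuous_bounded_square f : continuous f ->
  exists M, forall p, square p -> `|f p| <= M.
Proof.
move=> cf; have cK : compact (`[0, 1] `*` `[0, 1] : set (R * R)).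
  by apply: compact_setX; exact: segment_compact.
have /(compact_bounded)[M [_ HM]] := continuous_compact (continuous_subspaceT cf) cK.
exists (M + 1) => p [p1 p2]; apply: (HM (M + 1)); first by rewrite ltrDl.
by exists p => //; split; [move: p1|move: p2]; rewrite /= !in_itv/= => /andP[-> /ltW].
Qed.

Lemma bounded_summable f (M : R) :
  measurable_fun (square : set (plane R)) (f : _ -> measurableTypeR R) ->
  (forall p, square p -> `|f p| <= M) -> summable f.
Proof.
move=> mf fM; apply: measurable_bounded_integrable => //.
- exact: square_measurable.
- by apply: le_lt_trans (ltry 1); rewrite -square_measure.
- exists M; split; first exact: num_real.
  by move=> y My p /fM /le_trans; apply; exact: ltW.
Qed.

Lemma continuous_summable f : continuous f -> summable f.
Proof.
move=> cf; have [M fM] := continuous_bounded_square cf.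
apply: (bounded_summable _ fM).
by apply: measurable_funTS; exact: continuous_plane_measurable.
Qed.

Lemma meanD f g : summable f -> summable g ->
  mean (fun p => f p + g p) = mean f + mean g.
Proof. by move=> sf sg; rewrite /mean (RintegralD _ sf sg)//; exact: square_measurable. Qed.

Lemma meanB f g : summable f -> summable g ->
  mean (fun p => f p - g p) = mean f - mean g.
Proof. by move=> sf sg; rewrite /mean (RintegralB _ sf sg)//; exact: square_measurable. Qed.

Lemma meanZ (a : R) f : summable f -> mean (fun p => a * f p) = a * mean f.
Proof. by move=> sf; rewrite /mean (RintegralZl _ _ sf)//; exact: square_measurable. Qed.

Lemma le_mean f g : summable f -> summable g ->
  (forall p, square p -> f p <= g p) -> mean f <= mean g.
Proof. by move=> sf sg fg; apply: le_Rintegral => //; exact: square_measurable. Qed.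

Lemma mean_cst (a : R) : mean (fun=> a) = a.
Proof.
rewrite /mean Rintegral_cst; last exact: square_measurable.
by rewrite [X in fine X](_ : _ = 1%E) ?mulr1//; exact: square_measure.
Qed.

Lemma summableD f g : summable f -> summable g -> summable (fun p => f p + g p).
Proof.
move=> sf sg; rewrite /summable (_ : EFin \o _ = ((EFin \o f) \+ (EFin \o g))%E)//.
by apply: integrableD => //; exact: square_measurable.
Qed.

Lemma summableZ (a : R) f : summable f -> summable (fun p => a * f p).
Proof.
move=> sf; rewrite /summable (_ : EFin \o _ = (fun p => a%:E * (EFin \o f) p)%E)//.
by apply: integrableZl => //; exact: square_measurable.
Qed.

Lemma summableB f g : summable f -> summable g -> summable (fun p => f p - g p).
Proof.
move=> sf sg.
have -> : (fun p => f p - g p) = (fun p => f p + (-1) * g p).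
  by apply/funext => p; rewrite mulN1r.
by apply: summableD => //; exact: summableZ.
Qed.

Lemma le_normr_mean f : summable f -> `|mean f| <= mean (fun p => `|f p|).
Proof. by move=> sf; apply: le_normr_Rintegral => //; exact: square_measurable. Qed.

Lemma derive_hslice f (x y : R) (l : R) :
  is_derive (x, y) (1, 0) f l -> is_derive x 1 (fun t => f (t, y)) l.
Proof.
have E : (fun h : R => h^-1 *: (((fun t => f (t, y)) \o shift x) (h *: 1) - f (x, y))) =
         (fun h : R => h^-1 *: ((f \o shift (x, y)) (h *: ((1, 0) : R * R)) - f (x, y))).
  apply/funext => h /=; congr (_ *: (f _ - _)).
  by rewrite /shift/=; congr pair; rewrite /= scaler0 add0r.
move=> [df fl]; split.
  by rewrite /derivable E.
by rewrite -fl /derive E.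
Qed.

Lemma derive_vslice f (x y : R) (l : R) :
  is_derive (x, y) (0, 1) f l -> is_derive y 1 (fun t => f (x, t)) l.
Proof.
have E : (fun h : R => h^-1 *: (((fun t => f (x, t)) \o shift y) (h *: 1) - f (x, y))) =
         (fun h : R => h^-1 *: ((f \o shift (x, y)) (h *: ((0, 1) : R * R)) - f (x, y))).
  apply/funext => h /=; congr (_ *: (f _ - _)).
  by rewrite /shift/=; congr pair; rewrite /= scaler0 add0r.
move=> [df fl]; split.
  by rewrite /derivable E.
by rewrite -fl /derive E.
Qed.

(** The fundamental theorem of calculus along one period. *)
Lemma integral_derivative_loop (F f : R -> R) :
  (forall x : R, is_derive x 1 F (f x)) -> continuous f -> F 0 = F 1 ->
  (\int[@lebesgue_measure R]_(x in `[0%R, 1%R[) (f x)%:E = 0)%E.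
Proof.
move=> dF cf F01.
have cF : continuous F.
  move=> x; apply: differentiable_continuous; apply/derivable1_diffP.
  by have [] := dF x.
rewrite integral_itv_bndo_bndc; last first.
  by apply/measurable_EFinP; apply: measurable_funTS; exact: continuous_measurable_fun.
rewrite (@continuous_FTC2 _ f F)//.
- by rewrite F01 subee.
- exact: continuous_subspaceT.
- split=> [x _||].
  + by have [] := dF x.
  + exact/cvg_at_right_filter/cF.
  + exact/cvg_at_left_filter/cF.
- by move=> x _; rewrite derive1E; have [_ ->] := dF x.
Qed.

Lemma continuous_hslice f (y : R) : continuous f -> continuous (fun t => f (t, y)).
Proof.
move=> cf t; apply: (@continuous_comp _ _ _ (fun t : R => (t, y)) f); last exact: cf.
move=> A /nbhs_ballP[e /= e0 eA]; apply/nbhs_ballP; exists e => // t' tt'.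
by apply: eA; split => //; exact: ballxx.
Qed.

Lemma continuous_vslice f (x : R) : continuous f -> continuous (fun t => f (x, t)).
Proof.
move=> cf t; apply: (@continuous_comp _ _ _ (fun t : R => (x, t)) f); last exact: cf.
move=> A /nbhs_ballP[e /= e0 eA]; apply/nbhs_ballP; exists e => // t' tt'.
by apply: eA; split => //; exact: ballxx.
Qed.

Lemma summable_restrict f : summable f ->
  (leb2 R).-integrable [set: _] (EFin \o (f \_ square)).
Proof.
by rewrite -restrict_EFin; exact: (iffLR (integrable_mkcond _ square_measurable)).
Qed.

Lemma mean_restrict f : mean f = fine (\int[(leb2 R)]_p (EFin \o (f \_ square)) p)%E.
Proof. by rewrite /mean /Rintegral integral_mkcond -restrict_EFin. Qed.

Lemma mean_hderivative f g : (forall p : R * R, is_derive p (1, 0) f (g p)) ->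
  continuous g -> (forall y, f (0, y) = f (1, y)) -> mean g = 0.
Proof.
move=> df cg f01; have sg := continuous_summable cg.
rewrite mean_restrict -(integral21_prod_meas1 (summable_restrict sg)).
rewrite [X in fine X](_ : _ = 0%E)//; apply: integral0_eq => y _.
rewrite /fubini_G.
have [y01|y01] := boolP (y \in `[0%R, 1%R[).
  rewrite -[RHS](integral_derivative_loop (fun x => derive_hslice (df (x, y))) (continuous_hslice cg) (f01 y)).
  rewrite [RHS]integral_mkcond; apply: eq_integral => x _.
  rewrite /= !patchE /square in_setX /= !mem_setE y01 andbT.
  by case: ifP.
apply: integral0_eq => x _; rewrite /= patchE /square in_setX /= !mem_setE.
by rewrite (negbTE y01) andbF.
Qed.

Lemma mean_vderivative f g : (forall p : R * R, is_derive p (0, 1) f (g p)) ->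
  continuous g -> (forall x, f (x, 0) = f (x, 1)) -> mean g = 0.
Proof.
move=> df cg f01; have sg := continuous_summable cg.
rewrite mean_restrict -(integral12_prod_meas1 (summable_restrict sg)).
rewrite [X in fine X](_ : _ = 0%E)//; apply: integral0_eq => x _.
rewrite /fubini_F.
have [x01|x01] := boolP (x \in `[0%R, 1%R[).
  rewrite -[RHS](integral_derivative_loop (fun y => derive_vslice (df (x, y))) (continuous_vslice cg) (f01 x)).
  rewrite [RHS]integral_mkcond; apply: eq_integral => y _.
  rewrite /= !patchE /square in_setX /= !mem_setE x01 /=.
  by case: ifP.
apply: integral0_eq => y _; rewrite /= patchE /square in_setX /= !mem_setE.
by rewrite (negbTE x01).
Qed.

(** The torus has no boundary: integrating first along direction i, Fubini leaves
    the difference of f at the two ends of a period, which is 0.  All integrations by parts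
    come from this. *)
Lemma mean_partial i f g : periodic f ->
  (forall p, is_derive p (stdbasis i) f (g p)) -> continuous g -> mean g = 0.
Proof.
move=> pf; rewrite /stdbasis; case: eqP => _ df cg.
  apply: (mean_hderivative df cg) => y.
  by have [<- _] := pf (0, y); congr f; congr pair; rewrite /= ?add0r ?addr0.
apply: (mean_vderivative df cg) => x.
by have [_ <-] := pf (x, 0); congr f; congr pair; rewrite /= ?add0r ?addr0.
Qed.

End TorusIntegral.

(** * Waves, and recovering a value from Fourier coefficients *)
Section Lines.
Context {R : realType} {V W : normedModType R}.
Implicit Types (f : V -> W) (p v : V).

Lemma is_derive_lineP f p v l :
  is_derive p v f l <-> is_derive (0 : R) 1 (fun t => f (t *: v + p)) l.
Proof.
have E : (fun h : R => h^-1 *: (((fun t => f (t *: v + p)) \o shift 0) (h *: 1) - f (0 *: v + p))) =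
         (fun h : R => h^-1 *: ((f \o shift p) (h *: v) - f p)).
  by apply/funext => h /=; rewrite addr0 scale0r add0r [h *: 1]mulr1.
by split=> -[df fl]; split; rewrite -?fl /derivable /derive ?E//; move: df; rewrite /derivable E.
Qed.

End Lines.

Section LinesComp.
Context {R : realType} {V : normedModType R}.

Lemma is_derive_compR (g : R -> R) (f : V -> R) p v (l m : R) :
  is_derive p v f l -> is_derive (f p) 1 g m ->
  is_derive p v (fun q => g (f q)) (m * l).
Proof.
move=> /is_derive_lineP df dg; apply/is_derive_lineP.
apply: (@is_derive1_comp _ g (fun t => f (t *: v + p))).
by rewrite scale0r add0r.
Qed.

Lemma is_derive_ext (W : normedModType R) (f g : V -> W) p v l :
  (forall q, f q = g q) -> is_derive p v f l -> is_derive p v g l.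
Proof. by move=> fg; rewrite (_ : f = g)//; apply/funext. Qed.

End LinesComp.

Section Waves.
Context {R : realType}.
Implicit Types (k l : int * int) (t : R) (p : R * R).

Definition freq (i : 'I_2) k : R := if i == ord0 then k.1%:~R else k.2%:~R.

(** The real form of the character of frequency k.  With phases 0 and - pi / 2 it is
    a cosine and a sine, and a derivative adds pi / 2 to the phase, so that one
    family is stable under all operations. *)
Definition wave k t p : R := cos (2 * pi * (k.1%:~R * p.1 + k.2%:~R * p.2) + t).

Lemma cosD2piz (x : R) (m : int) : cos (x + 2 * pi * m%:~R) = cos x.
Proof.
have P n y : cos (y + 2 * pi * n%:R) = cos y :> R.
  rewrite (_ : 2 * pi * n%:R = (pi *+ 2) *+ n) ?(periodicn (@cosD2pi R))//.
  by rewrite -[RHS]mulr_natr -[pi *+ 2]mulr_natl.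
case: m => n; first exact: P.
rewrite NegzE mulrNz -[LHS](P n.+1); congr cos.
by rewrite -addrA mulrN addNr addr0.
Qed.

Lemma wave_periodic k t : periodic (wave k t).
Proof.
move=> p; rewrite /wave /=; split.
  rewrite -[RHS](cosD2piz _ k.1); congr cos; ring.
rewrite -[RHS](cosD2piz _ k.2); congr cos; ring.
Qed.

Lemma is_derive_wave k t i p :
  is_derive p (stdbasis i) (wave k t) (2 * pi * freq i k * wave k (t + pi / 2) p).
Proof.
pose ph (q : R * R) := 2 * pi * (k.1%:~R * q.1 + k.2%:~R * q.2) + t.
have dph : is_derive p (stdbasis i) ph (2 * pi * freq i k).
  apply/is_derive_lineP.
  apply: (@is_derive_ext _ _ _ (fun s : R => s * (2 * pi * freq i k) + ph p)).
    move=> s; rewrite /ph /freq /stdbasis; case: ifP => _ /=; rewrite /GRing.scale/=; ring.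
  apply: is_derive_eq.
  by rewrite addr0 /GRing.scale/= mulr1 mulr0 ?add0r.
have := is_derive_compR dph (is_derive_cos (ph p)).
by rewrite /wave [_ + (t + pi / 2)]addrA -/(ph p) cosDpihalf mulrC.
Qed.

Lemma continuous_phase (a b c : R) : continuous (fun p : R * R => a * p.1 + b * p.2 + c).
Proof.
move=> p; apply: cvgD; last exact: cvg_cst.
apply: cvgD; apply: cvgM; try exact: cvg_cst.
  exact: cvg_fst.
exact: cvg_snd.
Qed.

Lemma wave_continuous k t : continuous (wave k t).
Proof.
move=> p; rewrite /wave.
apply: (@continuous_comp _ _ _ (fun p : R * R => 2 * pi * (k.1%:~R * p.1 + k.2%:~R * p.2) + t) cos); last exact: continuous_cos.
rewrite (_ : (fun _ => _) = (fun p : R * R => (2 * pi * k.1%:~R) * p.1 + (2 * pi * k.2%:~R) * p.2 + t)); last first.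
  by apply/funext => q; ring.
exact: continuous_phase.
Qed.

Lemma wave_norm k t p : `|wave k t p| <= 1.
Proof. exact: cos_max. Qed.

Lemma waveM k l (t s : R) p : wave k t p * wave l s p =
  2^-1 * wave (k.1 + l.1, k.2 + l.2) (t + s) p + 2^-1 * wave (k.1 - l.1, k.2 - l.2) (t - s) p.
Proof.
rewrite /wave; set x := 2 * pi * _ + t; set y := 2 * pi * _ + s.
rewrite (_ : 2 * pi * _ + (t + s) = x + y); last by rewrite /= !intrD /x/y; ring.
rewrite (_ : 2 * pi * _ + (t - s) = x - y); last by rewrite /= !intrD !mulrNz /x/y; ring.
by clearbody x y; rewrite cosB cosD; field.
Qed.

Lemma wave0 t p : wave (0, 0) t p = cos t.
Proof. by rewrite /wave /= !mul0r addr0 mulr0 add0r. Qed.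

Lemma mean_wave k t : mean (wave k t) = if k == (0, 0) then cos t else 0.
Proof.
case: eqP => [->|k0].
  rewrite (_ : wave _ _ = fun=> cos t) ?mean_cst//.
  by apply/funext => p; rewrite wave0.
have [i ki] : exists i, freq i k != 0.
  case: k k0 => k1 k2 k0; have [k10|k10] := eqVneq k1 0; last first.
    by exists ord0; rewrite /freq eqxx/= intr_eq0.
  exists ord_max; rewrite /freq/= intr_eq0; apply/eqP => k20; apply: k0.
  by rewrite k10 k20.
have : mean (fun p => 2 * pi * freq i k * wave k t p) = 0.
  apply: (@mean_partial _ i (wave k (t - pi / 2))).
  - exact: wave_periodic.
  - by move=> p; have := is_derive_wave k (t - pi / 2) i p; rewrite subrK.
  - by move=> p; apply: cvgM; [exact: cvg_cst|exact: wave_continuous].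
rewrite meanZ; last by apply: continuous_summable; exact: wave_continuous.
move=> /eqP; rewrite mulf_eq0 => /orP[|/eqP//].
by rewrite !mulf_eq0 (negbTE ki) (gt_eqF (pi_gt0 R)) pnatr_eq0.
Qed.

Inductive trigpoly : (R * R -> R) -> Prop :=
| trigpoly_wave k t : trigpoly (wave k t)
| trigpolyD f g : trigpoly f -> trigpoly g -> trigpoly (fun p => f p + g p)
| trigpolyZ a f : trigpoly f -> trigpoly (fun p => a * f p).

Lemma trigpoly_ext f g : (forall p, f p = g p) -> trigpoly f -> trigpoly g.
Proof. by move=> fg; rewrite (_ : f = g)//; apply/funext. Qed.

Lemma trigpolyM f g : trigpoly f -> trigpoly g -> trigpoly (fun p => f p * g p).
Proof.
move=> tf tg; elim: tf => [k t|f1 f2 _ IH1 _ IH2|a f1 _ IH].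
- elim: tg => [l s|f1 f2 _ IH1 _ IH2|a f1 _ IH].
  + apply: (@trigpoly_ext (fun p => 2^-1 * wave (k.1 + l.1, k.2 + l.2) (t + s) p +
       2^-1 * wave (k.1 - l.1, k.2 - l.2) (t - s) p)); first by move=> p; rewrite waveM.
    by apply: trigpolyD; apply: trigpolyZ; exact: trigpoly_wave.
  + by apply: (trigpoly_ext _ (trigpolyD IH1 IH2)) => p; rewrite mulrDr.
  + by apply: (trigpoly_ext _ (trigpolyZ a IH)) => p; rewrite mulrCA.
- by apply: (trigpoly_ext _ (trigpolyD IH1 IH2)) => p; rewrite mulrDl.
- by apply: (trigpoly_ext _ (trigpolyZ a IH)) => p; rewrite mulrA.
Qed.

Lemma trigpoly_cst (a : R) : trigpoly (fun=> a).
Proof.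
apply: (trigpoly_ext _ (trigpolyZ a (trigpoly_wave (0, 0) 0))) => p.
by rewrite wave0 cos0 mulr1.
Qed.

Lemma trigpolyX f n : trigpoly f -> trigpoly (fun p => f p ^+ n).
Proof.
move=> tf; elim: n => [|n IH]; first exact: trigpoly_cst.
by apply: (trigpoly_ext _ (trigpolyM tf IH)) => p; rewrite exprS.
Qed.

Lemma trigpoly_continuous f : trigpoly f -> continuous f.
Proof.
elim=> [k t|f1 f2 _ IH1 _ IH2|a f1 _ IH]; first exact: wave_continuous.
  by move=> p; apply: cvgD; [exact: IH1|exact: IH2].
by move=> p; apply: cvgM; [exact: cvg_cst|exact: IH].
Qed.

End Waves.

Section KernelEvaluation.
Context {R : realType}.
Implicit Types (a f g : R * R -> R) (q : R * R).

Lemma summable_measurable a : summable a ->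
  measurable_fun (square : set (plane R)) (a : _ -> measurableTypeR R).
Proof. by move=> /measurable_int/measurable_EFinP. Qed.

Lemma continuous_square_measurable f : continuous f ->
  measurable_fun (square : set (plane R)) (f : _ -> measurableTypeR R).
Proof. by move=> cf; apply: measurable_funTS; exact: continuous_plane_measurable. Qed.

Lemma summableM a g : summable a -> continuous g -> summable (fun p => a p * g p).
Proof.
move=> sa cg; have [M gM] := continuous_bounded_square cg.
rewrite /summable (_ : EFin \o _ = ((EFin \o a) \* (EFin \o g))%E)//.
apply: integrableMl => //; first exact: square_measurable.
  exact: continuous_square_measurable.
exists M; split; first exact: num_real.
by move=> y My p /gM /le_trans; apply; exact: ltW.
Qed.

Lemma summable_norm a : summable a -> summable (fun p => `|a p|).
Proof.
move=> sa; rewrite /summable (_ : EFin \o _ = (abse \o (EFin \o a)))//.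
by apply: integrable_abse; exact: sa.
Qed.

Lemma le_summable f g : measurable_fun (square : set (plane R)) (f : _ -> measurableTypeR R) ->
  (forall p, square p -> `|f p| <= g p) -> summable g -> summable f.
Proof.
move=> mf fg sg; apply: (le_integrable _ _ _ sg); first exact: square_measurable.
  exact/measurable_EFinP.
move=> p sp /=; rewrite lee_fin (le_trans (fg p sp))//; exact: ler_norm.
Qed.

Definition modes_vanish a := forall k t, k != (0, 0) -> mean (fun p => a p * wave k t p) = 0.

(** Only the constant term of f meets a. *)
Lemma mean_trigpoly a f : summable a -> modes_vanish a ->
  trigpoly f -> mean (fun p => a p * f p) = mean a * mean f.
Proof.
move=> sa av; elim=> [k t|f1 f2 t1 IH1 t2 IH2|b f1 t1 IH].
- rewrite mean_wave; case: eqP => [->|/eqP k0]; last by rewrite av// mulr0.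
  rewrite mulrC -meanZ//; congr mean; apply/funext => p.
  by rewrite wave0 mulrC.
- have c1 := trigpoly_continuous t1; have c2 := trigpoly_continuous t2.
  rewrite meanD; [|exact: continuous_summable..].
  rewrite mulrDr -IH1 -IH2 -meanD; [|exact: summableM..].
  by congr mean; apply/funext => p; rewrite mulrDr.
- have c1 := trigpoly_continuous t1.
  rewrite meanZ; last exact: continuous_summable.
  rewrite mulrCA -IH -meanZ; last exact: summableM.
  by congr mean; apply/funext => p; rewrite mulrCA.
Qed.

Definition box q (e : R) : set (R * R) := `]q.1 - e, q.1 + e[ `*` `]q.2 - e, q.2 + e[.

Lemma box_measurable q e : measurable (box q e : set (plane R)).
Proof. by apply: measurableX; exact: measurable_itv. Qed.

Lemma box_measure q e : 0 < e -> (leb2 R) (box q e) = ((2 * e) ^+ 2)%:E.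
Proof.
move=> e0; rewrite /box product_measure1E; [|exact: measurable_itv..].
rewrite /= !lebesgue_measure_itv/= !lte_fin !ltrD2l (_ : - e < e) /=; last by lra.
by rewrite -!EFinD -EFinM expr2; congr (_ * _)%:E; lra.
Qed.

Lemma mean_indic_box q e : 0 < e -> box q e `<=` square ->
  mean \1_(box q e) = (2 * e) ^+ 2.
Proof.
move=> e0 qe; rewrite /mean /Rintegral integral_indic; last 2 first.
  exact: square_measurable. exact: box_measurable.
rewrite [X in fine X](_ : _ = ((2 * e) ^+ 2)%:E)//.
by rewrite (setIidl qe); exact: box_measure.
Qed.

Lemma summable_indic_box q e : summable (\1_(box q e)).
Proof.
apply: (@bounded_summable _ _ 1).
  apply: measurable_indic; exact: box_measurable.
by move=> p _; rewrite indicE; case: (p \in _); rewrite /= ?normr1 ?normr0.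
Qed.

(** A trigonometric polynomial equal to 1 at q and smaller elsewhere on the torus:
    its powers concentrate at q, like the Fejer kernel. *)
Definition bump q p : R :=
  (1 + wave (1, 0) (- (2 * pi * q.1)) p) / 2 * ((1 + wave (0, 1) (- (2 * pi * q.2)) p) / 2).

Lemma bumpE q p : bump q p =
  (1 + cos (2 * pi * (p.1 - q.1))) / 2 * ((1 + cos (2 * pi * (p.2 - q.2))) / 2).
Proof. by rewrite /bump /wave /= !mul1r !mul0r addr0 add0r !mulrBr. Qed.

Lemma trigpoly_bump q : trigpoly (bump q).
Proof.
have T k t : trigpoly (fun p => (1 + wave k t p) / 2 : R).
  apply: (trigpoly_ext _ (trigpolyZ 2^-1 (trigpolyD (trigpoly_cst 1) (trigpoly_wave k t)))) => p.
  by rewrite mulrC.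
by apply: trigpolyM; exact: T.
Qed.

Lemma cos_far (d x : R) : 0 < d < 1 / 2 -> d <= `|x| <= 1 - d -> cos (2 * pi * x) <= cos (2 * pi * d).
Proof.
move=> /andP[d0 d1] /andP[dx xd]; have p0 := pi_gt0 R.
have -> : cos (2 * pi * x) = cos (2 * pi * `|x|).
  by case: (ger0P x) => // _; rewrite mulrN cosN.
move: `|x| dx xd => {}x dx xd.
have H y : d <= y -> y <= 1 / 2 -> cos (2 * pi * y) <= cos (2 * pi * d).
  move=> dy y1; case: (ltrP d y) => [ly|yd]; last by rewrite (_ : y = d)//; lra.
  apply: ltW; rewrite ltr_cos ?in_itv/=; first by nra.
    by apply/andP; split; nra.
  by apply/andP; split; nra.
case: (lerP x (1 / 2)) => x2; first exact: H.
rewrite -cosN -(cosD2piz (- _) 1) (_ : _ + _ = 2 * pi * (1 - x)); last by rewrite -mulrN; ring.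
by apply: H; lra.
Qed.

Lemma bump_ge0 q p : 0 <= bump q p.
Proof.
rewrite bumpE mulr_ge0// divr_ge0//; rewrite -lerBlDl sub0r; exact: cos_geN1.
Qed.

Lemma bump_far q p d : 0 < d < 1 / 2 -> box q d `<=` square -> square p ->
  ~ box q d p -> bump q p <= (1 + cos (2 * pi * d)) / 2.
Proof.
move=> d01 qd sp qp.
have [d0 d1] := andP d01.
have H (x : R) : 0 <= (1 + cos x) / 2 <= 1.
  have := cos_geN1 x; have := cos_le1 x; lra.
have C (x y : R) : 0 <= x < 1 -> 0 + d <= y <= 1 - d -> ~~ (y - d < x < y + d) -> d <= `|x - y| <= 1 - d.
  move=> /andP[x0 x1] /andP[y0 y1]; rewrite negb_and -!leNgt => /orP[h|h].
    by rewrite ler0_norm; lra.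
  by rewrite ger0_norm; lra.
have [q1 q2] : (0 + d <= q.1 <= 1 - d) /\ (0 + d <= q.2 <= 1 - d).
  have A (x : R) : (forall y, x - d < y < x + d -> 0 <= y < 1) -> 0 + d <= x <= 1 - d.
    move=> h; apply/andP; split; rewrite leNgt; apply/negP => hx.
      have [xd|xd] := lerP (x + d) 0; first by have := h x; lra.
      by have := h ((x - d) / 2); lra.
    have [xd|xd] := lerP 1 (x - d); first by have := h x; lra.
    by have := h ((x + d + 1) / 2); lra.
  split; apply: A => y yq.
    have [] := qd (y, q.2); last by rewrite /= in_itv.
    by split; rewrite /= in_itv/= ?yq//; lra.
  have [] := qd (q.1, y); last by rewrite /= in_itv.
  by split; rewrite /= in_itv/= ?yq//; lra.
move: sp => [/=]; rewrite !in_itv/= => p1 p2.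
have : ~~ (q.1 - d < p.1 < q.1 + d) \/ ~~ (q.2 - d < p.2 < q.2 + d).
  apply/orP; rewrite -negb_and; apply/negP => /andP[h1 h2]; apply: qp.
  by split; rewrite /= in_itv.
have h1 := H (2 * pi * (p.1 - q.1)); have h2 := H (2 * pi * (p.2 - q.2)).
rewrite bumpE => -[h|h].
  have := cos_far d01 (C _ _ p1 q1 h).
  move: h1 h2; move: (cos _) (cos _) (cos _) => a b c; nra.
have := cos_far d01 (C _ _ p2 q2 h).
move: h1 h2; move: (cos _) (cos _) (cos _) => a b c; nra.
Qed.

Lemma bump_center q : bump q q = 1.
Proof. rewrite bumpE !subrr mulr0 cos0; lra. Qed.

Lemma box_near q (P : R * R -> Prop) : (\forall p \near q, P p) ->
  exists2 e, 0 < e & forall e', 0 < e' -> e' <= e -> forall p, box q e' p -> P p.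
Proof.
move=> /nbhs_ballP[e /= e0 eP]; exists e => // e' e'0 e'e p [].
rewrite /= !in_itv/= => /andP[a1 a2] /andP[b1 b2]; apply: eP.
by split; rewrite /= /ball/= ltr_norml; apply/andP; split; lra.
Qed.

(** The means of a * bump q ^+ N all vanish.  If a q were positive, the contribution
    of a small box around q would be of order s ^ N at least, that of the
    complement of a larger box at most r ^ N with r < s, and in between the
    integrand is positive: a contradiction for large N.  Only continuity at q
    enters, so that the argument applies to functions that are singular
    elsewhere. *)
Lemma mean_eval_pos a q : summable a -> modes_vanish a -> {for q, continuous a} ->
  0 < q.1 < 1 -> 0 < q.2 < 1 -> mean a = 0 -> a q <= 0.
Proof.
move=> sa av ca /andP[q10 q11] /andP[q20 q21] ma0; rewrite leNgt; apply/negP => aq0.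
have [d1 d10 ad1] : exists2 e, 0 < e & forall e', 0 < e' -> e' <= e ->
    forall p, box q e' p -> a q / 2 < a p.
  apply: box_near; have : a q / 2 < a q by lra.
  exact: (cvgr_gt _ ca).
pose d := Num.min d1 (Num.min (1 / 4) (Num.min (Num.min q.1 (1 - q.1)) (Num.min q.2 (1 - q.2)))).
have d0 : 0 < d by rewrite /d !lt_min; repeat (apply/andP; split); lra.
have : d <= d by []; rewrite {2}/d !le_min => /andP[dd1 /andP[d4 /andP[/andP[dq1 dq2] /andP[dq3 dq4]]]].
have dsq : box q d `<=` square.
  move=> p []; rewrite /= !in_itv/= => /andP[h1 h2] /andP[h3 h4].
  by split; rewrite /= in_itv/=; apply/andP; split; lra.
(* bump q <= r outside box q d, and bump q > s > r in box q e *)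
pose r : R := (1 + cos (2 * pi * d)) / 2.
have p0 := pi_gt0 R.
have r0 : 0 <= r by rewrite /r; have := cos_geN1 (2 * pi * d); lra.
have r1 : r < 1.
  suff : cos (2 * pi * d) < cos 0 by rewrite cos0 /r; lra.
  by rewrite ltr_cos ?in_itv/=; [nra|apply/andP; split; nra|apply/andP; split; nra].
pose s : R := (1 + r) / 2.
have s0 : 0 < s by rewrite /s; lra.
have rs : r < s by rewrite /s; lra.
have s1 : s < 1 by rewrite /s; lra.
have [e0 e00 he] : exists2 e, 0 < e & forall e', 0 < e' -> e' <= e ->
    forall p, box q e' p -> s < bump q p.
  apply: box_near; have : s < bump q q by rewrite bump_center.
  exact: (cvgr_gt _ (trigpoly_continuous (trigpoly_bump q) (x:=q))).
pose e := Num.min e0 d.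
have ep : 0 < e by rewrite /e lt_min e00.
have ee0 : e <= e0 by rewrite /e ge_min lexx.
have ed : e <= d by rewrite /e ge_min lexx orbT.
have boxed : box q e `<=` box q d.
  move=> p []; rewrite /= !in_itv/= => /andP[h1 h2] /andP[h3 h4].
  by split; rewrite /= in_itv/=; apply/andP; split; lra.
pose c := a q / 2; have c0 : 0 < c by rewrite /c; lra.
have main N : c * s ^+ N * (2 * e) ^+ 2 <= r ^+ N * mean (fun p => `|a p|).
  have tN := trigpolyX N (trigpoly_bump q).
  rewrite -subr_le0 -(mean_indic_box ep (subset_trans boxed dsq)).
  rewrite -(meanZ _ (summable_indic_box _ _)) -(meanZ _ (summable_norm sa)).
  rewrite -meanB; last 2 first.
    by apply: summableZ; exact: summable_indic_box.
    by apply: summableZ; exact: summable_norm.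
  have <- : mean (fun p => a p * bump q p ^+ N) = 0.
    by rewrite (mean_trigpoly sa av tN) ma0 mul0r.
  apply: le_mean.
  - apply: summableB; apply: summableZ; [exact: summable_indic_box|exact: summable_norm].
  - by apply: summableM => //; exact: trigpoly_continuous.
  - move=> p sp; have b0 : 0 <= bump q p ^+ N by rewrite exprn_ge0// bump_ge0.
    have rN : 0 <= r ^+ N by rewrite exprn_ge0.
    have n0 := normr_ge0 (a p).
    rewrite indicE; case: (pselect (box q d p)) => pd; last first.
      rewrite memNset ?mulr0 ?sub0r; last by move=> /boxed.
      have br : bump q p ^+ N <= r ^+ N.
        rewrite lerXn2r ?nnegrE ?bump_ge0//; apply: bump_far => //.
        by apply/andP; split => //; lra.
      have := ler_norm (- a p); rewrite normrN => h; nra.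
    have ap : c < a p by apply: (ad1 d).
    rewrite ger0_norm; last by lra.
    case: (pselect (box q e p)) => pe.
      rewrite mem_set// mulr1.
      have : s ^+ N <= bump q p ^+ N.
        by rewrite lerXn2r ?nnegrE ?bump_ge0 ?(ltW s0)// ltW//; exact: (he e).
      nra.
    rewrite memNset// mulr0 sub0r; nra.
have K0 : 0 < c * (2 * e) ^+ 2 by rewrite mulr_gt0// exprn_gt0// mulr_gt0.
have lim : geometric (mean (fun p => `|a p|)) (r / s) x @[x --> \oo] --> 0.
  have q0 : 0 <= r / s by rewrite divr_ge0 ?(ltW s0).
  by apply: cvg_geometric; rewrite (ger0_norm q0) ltr_pdivrMr ?mul1r.
have [N _ hN] := cvgr_lt _ lim _ K0.
have := hN N (leqnn N); rewrite /= /geometric/= expr_div_n mulrA ltr_pdivrMr ?exprn_gt0//.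
have := main N; move: (mean _) => m; lra.
Unshelve. all: by end_near.
Qed.

(** For the mean curvature form this plays the role of elliptic regularity: it is equal
    to its mean wherever it is continuous. *)
Lemma mean_eval a q : summable a -> modes_vanish a -> {for q, continuous a} ->
  0 < q.1 < 1 -> 0 < q.2 < 1 -> a q = mean a.
Proof.
have P (b : R * R -> R) : summable b -> modes_vanish b -> {for q, continuous b} ->
    0 < q.1 < 1 -> 0 < q.2 < 1 -> b q <= mean b.
  move=> sb bv cb q1 q2; have scst : summable (fun=> mean b).
    by apply: continuous_summable => p; exact: cvg_cst.
  rewrite -subr_le0; apply: (@mean_eval_pos (fun p => b p - mean b) q) => //.
  - exact: summableB.
  - move=> k t k0; have wc : continuous (wave k t : R * R -> R) by exact: wave_continuous.
    rewrite (_ : (fun p => _) = (fun p => b p * wave k t p - mean b * wave k t p)).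
      rewrite meanB; [|exact: summableM|by apply: summableZ; exact: continuous_summable].
      rewrite bv// meanZ; last exact: continuous_summable.
      by rewrite mean_wave (negbTE k0) mulr0 subrr.
    by apply/funext => p; rewrite mulrBl.
  - by apply: cvgB => //; exact: cvg_cst.
  - by rewrite meanB// mean_cst subrr.
move=> sa av ca q1 q2; apply/eqP; rewrite eq_le P//=.
have : (fun p => (-1) * a p) q <= mean (fun p => (-1) * a p).
  apply: P => //; first exact: summableZ.
    move=> k t k0; rewrite -[RHS](mulr0 (-1)) -(av k t k0) -meanZ; last first.
      by apply: summableM => //; exact: wave_continuous.
    by congr mean; apply/funext => p; rewrite mulrA.
  by apply: cvgM => //; exact: cvg_cst.
by rewrite meanZ//; lra.
Qed.

End KernelEvaluation.

(** * Fourier series of periodic functions of the plane *)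
Section ProductRules.
Context {R : realType} {V : normedModType R}.
Implicit Types (f g : V -> R).

Lemma is_deriveMf f g p v (a b : R) : is_derive p v f a -> is_derive p v g b ->
  is_derive p v (fun q => f q * g q) (a * g p + f p * b).
Proof.
move=> df dg; apply: (@is_derive_eq _ _ _ (f * g)).
by rewrite /GRing.scale/= addrC mulrC.
Qed.

Lemma is_deriveDf {W : normedModType R} (f g : V -> W) p v a b : is_derive p v f a -> is_derive p v g b ->
  is_derive p v (fun q => f q + g q) (a + b).
Proof. by move=> df dg; exact: (@is_deriveD _ _ _ f g). Qed.

Lemma is_deriveBf {W : normedModType R} (f g : V -> W) p v a b : is_derive p v f a -> is_derive p v g b ->
  is_derive p v (fun q => f q - g q) (a - b).
Proof. by move=> df dg; exact: (@is_deriveB _ _ _ f g). Qed.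

Lemma is_deriveZf f (c : R) p v a : is_derive p v f a ->
  is_derive p v (fun q => c * f q) (c * a).
Proof. by move=> df; exact: (@is_deriveZ _ _ _ f). Qed.

Lemma is_deriveVf f p v a : f p != 0 -> is_derive p v f a ->
  is_derive p v (fun q => (f q)^-1) (- (f p) ^- 2 * a).
Proof.
move=> f0 df; split; first exact: derivableV.
by rewrite deriveV//; have [_ ->] := df.
Qed.

End ProductRules.

Section Periodic.
Context {R : realType}.
Implicit Types (f g : R * R -> R).

Lemma periodic_int {V : Type} (f : R * R -> V) (m n : int) p :
  periodic f -> f (p + (m%:~R, n%:~R)) = f p.
Proof.
move=> pf.
have N1 (k : nat) q : f (q + (k%:R, 0)) = f q.
  elim: k q => [|k IH] q; first by rewrite [(_, _)](_ : _ = 0)// addr0.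
  rewrite -[RHS]IH -(pf (q + (k%:R, 0))).1; congr f; rewrite -addrA; congr (_ + _).
  by congr pair; rewrite /= ?addr0// -natr1.
have N2 (k : nat) q : f (q + (0, k%:R)) = f q.
  elim: k q => [|k IH] q; first by rewrite [(_, _)](_ : _ = 0)// addr0.
  rewrite -[RHS]IH -(pf (q + (0, k%:R))).2; congr f; rewrite -addrA; congr (_ + _).
  by congr pair; rewrite /= ?addr0// -natr1.
have Z1 (k : int) q : f (q + (k%:~R, 0)) = f q.
  case: k => k; first exact: N1.
  rewrite NegzE -[LHS](N1 k.+1); congr f; rewrite -addrA [X in _ + X](_ : _ = 0) ?addr0//.
  by congr pair; rewrite /= ?addr0// mulrNz addNr.
have Z2 (k : int) q : f (q + (0, k%:~R)) = f q.
  case: k => k; first exact: N2.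
  rewrite NegzE -[LHS](N2 k.+1); congr f; rewrite -addrA [X in _ + X](_ : _ = 0) ?addr0//.
  by congr pair; rewrite /= ?addr0// mulrNz addNr.
rewrite (_ : (m%:~R, n%:~R) = (m%:~R, 0) + (0, n%:~R)); last first.
  by congr pair; rewrite /= ?addr0 ?add0r.
by rewrite addrA Z2 Z1.
Qed.

Lemma periodic_square {V : Type} (f : R * R -> V) p : periodic f ->
  exists q, square q /\ f q = f p.
Proof.
move=> pf; exists (p + ((- Num.floor p.1)%:~R, (- Num.floor p.2)%:~R)); split; last exact: periodic_int.
have F (x : R) : 0 <= x + (- Num.floor x)%:~R < 1.
  rewrite mulrNz subr_ge0 ltrBlDl floor_le_tmp/= -[X in _ < _ + X]/(1%:~R) -intrD.
  exact: floorD1_gt.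
by split; rewrite /= in_itv/= F.
Qed.

(** The boundary points of the square are limits of interior ones. *)
Lemma periodic_vanish f : periodic f -> continuous f ->
  (forall q, 0 < q.1 < 1 -> 0 < q.2 < 1 -> f q = 0) -> forall p, f p = 0.
Proof.
move=> pf cf f0 p; have [q [[/= q1 q2] <-]] := periodic_square p pf.
move: q1 q2; rewrite !in_itv/= => /andP[a1 a2] /andP[b1 b2].
apply/eqP; apply: contraT => fq; exfalso.
have fq0 : 0 < `|f q| by rewrite normr_gt0.
have cn : (fun p => `|f p|) @ q --> `|f q| by apply: cvg_norm; exact: cf.
have [e /= e0 he] := (nbhs_ballP _ _).1 (cvgr_gt _ cn _ fq0).
pose d := Num.min (e / 2) (Num.min ((1 - q.1) / 2) ((1 - q.2) / 2)).
have d0 : 0 < d by rewrite /d !lt_min; repeat (apply/andP; split); lra.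
have : d <= d by []; rewrite {2}/d !le_min => /andP[d1 /andP[d2 d3]].
have := he (q.1 + d, q.2 + d).
rewrite f0 /=; [|lra|lra].
rewrite normr0 ltxx => h; suff // : false by [].
by apply: h; split; rewrite /ball/= opprD addrA subrr sub0r normrN gtr0_norm//; lra.
Qed.

Lemma fourier_cst f : periodic f -> continuous f -> modes_vanish f ->
  forall p, f p = mean f.
Proof.
move=> pf cf fv p; apply/eqP; rewrite -subr_eq0; apply/eqP; move: p.
apply: periodic_vanish.
- by move=> p; have [-> ->] := pf p.
- by move=> p; apply: cvgB; [exact: cf|exact: cvg_cst].
- by move=> q q1 q2; rewrite (mean_eval _ fv _ q1 q2) ?subrr//; [exact: continuous_summable|exact: cf].
Qed.

Lemma fourier_unique f : periodic f -> continuous f ->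
  (forall k t, mean (fun p => f p * wave k t p) = 0) -> forall p, f p = 0.
Proof.
move=> pf cf f0 p; rewrite fourier_cst//.
rewrite -(f0 (0, 0) 0); congr mean; apply/funext => q.
by rewrite wave0 cos0 mulr1.
Qed.

(** Differentiation acts on Fourier coefficients as multiplication by the frequency
    together with a quarter turn of the phase. *)
Lemma mean_by_parts i f g k t : periodic f -> continuous f -> continuous g ->
  (forall p, is_derive p (stdbasis i) f (g p)) ->
  mean (fun p => g p * wave k t p) =
  - (2 * pi * freq i k) * mean (fun p => f p * wave k (t + pi / 2) p).
Proof.
move=> pf cf cg df.
have cw s : continuous (wave k s : R * R -> R) by exact: wave_continuous.
have cM (a b : R * R -> R) : continuous a -> continuous b -> continuous (fun p => a p * b p).
  by move=> ca cb p; apply: cvgM; [exact: ca|exact: cb].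
have : mean (fun p => g p * wave k t p + (2 * pi * freq i k) * (f p * wave k (t + pi / 2) p)) = 0.
  apply: (@mean_partial _ i (fun p => f p * wave k t p)).
  - by move=> p; have [-> ->] := pf p; have [-> ->] := wave_periodic k t p.
  - move=> p; apply: is_derive_eq (is_deriveMf (df p) (is_derive_wave k t i p)) _; ring.
  - move=> p; apply: cvgD; first exact: cM.
    by apply: cvgM; [exact: cvg_cst|exact: cM].
rewrite meanD; last 2 first.
  by apply: continuous_summable; exact: cM.
  by apply: summableZ; apply: continuous_summable; exact: cM.
rewrite meanZ; last by apply: continuous_summable; exact: cM.
by move=> /eqP; rewrite addr_eq0 mulNr => /eqP.
Qed.

End Periodic.

Section SmoothPlane.
Context {R : realType} {V : normedModType R}.
Implicit Types (F : R * R -> V).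

Lemma partials_cat (s s' : seq 'I_2) F : partials (s ++ s') F = partials s (partials s' F).
Proof. by rewrite /partials foldr_cat. Qed.

Lemma smooth_partials s F : smooth F -> smooth (partials s F).
Proof. by move=> sF s'; rewrite -partials_cat; exact: sF. Qed.

Lemma smooth_continuous F : smooth F -> continuous F.
Proof. by move=> /(_ [::])[]. Qed.

Lemma smooth_is_derive i F p : smooth F -> is_derive p (stdbasis i) F (partial i F p).
Proof. by move=> /(_ [::])[_ /(_ i p)]; exact: derivableP. Qed.

Lemma derive_translate F (v w p : R * R) : 'D_v (fun q => F (q + w)) p = 'D_v F (p + w).
Proof.
have E : (fun h : R => h^-1 *: (((fun q => F (q + w)) \o shift p) (h *: v) - F (p + w))) =
         (fun h : R => h^-1 *: ((F \o shift (p + w)) (h *: v) - F (p + w))).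
  by apply/funext => h; rewrite /= addrA.
by rewrite /derive E.
Qed.

Lemma periodic_partial i F : periodic F -> periodic (partial i F).
Proof.
move=> pF p; rewrite /partial -!derive_translate.
have -> : (fun q => F (q + (1, 0))) = F by apply/funext => q; have [] := pF q.
by have -> : (fun q => F (q + (0, 1))) = F by apply/funext => q; have [] := pF q.
Qed.

Lemma periodic_partials s F : periodic F -> periodic (partials s F).
Proof. by move=> pF; elim: s => //= i s; exact: periodic_partial. Qed.

End SmoothPlane.

Section Schwarz.
Context {R : realType}.
Implicit Types (f : R * R -> R).

(** Schwarz's theorem: the two mixed derivatives have the same Fourier
    coefficients. *)
Lemma partialC i j f : periodic f -> smooth (f : R * R -> R^o) ->
  partial i (partial j f) = partial j (partial i f).
Proof.
move=> pf sf; apply/funext => p; apply/eqP; rewrite -subr_eq0; apply/eqP; move: p.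
have sp l := smooth_partials [:: l] sf.
have spp l m := smooth_partials [:: l; m] sf.
have pp l : periodic (partial l f) := periodic_partials [:: l] pf.
have ppp l m : periodic (partial l (partial m f)) := periodic_partials [:: l; m] pf.
apply: fourier_unique => [p||k t].
- by have [-> ->] := ppp i j p; have [-> ->] := ppp j i p.
- by move=> p; apply: cvgB; apply: smooth_continuous; [exact: (spp i j)|exact: (spp j i)].
have P l m : mean (fun p => partial l (partial m f) p * wave k t p) =
   (2 * pi * freq l k) * (2 * pi * freq m k) * mean (fun p => f p * wave k (t + pi / 2 + pi / 2) p).
  have h1 := @mean_by_parts _ l (partial m f) (partial l (partial m f)) k t (pp m)
    (smooth_continuous (sp m)) (smooth_continuous (spp l m)) (fun p => smooth_is_derive l p (sp m)).
  have h2 := @mean_by_parts _ m f (partial m f) k (t + pi / 2) pf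
    (smooth_continuous sf) (smooth_continuous (sp m)) (fun p => smooth_is_derive m p sf).
  by rewrite h1 h2; ring.
rewrite (_ : (fun p => _) = (fun p => partial i (partial j f) p * wave k t p - partial j (partial i f) p * wave k t p)).
  rewrite meanB; last 2 first.
    by apply: summableM; [apply: continuous_summable; exact: smooth_continuous (spp i j)|exact: wave_continuous].
    by apply: summableM; [apply: continuous_summable; exact: smooth_continuous (spp j i)|exact: wave_continuous].
  rewrite [X in X - _](P i j) [X in _ - X](P j i); ring.
by apply/funext => p; rewrite mulrBl.
Qed.

End Schwarz.

Section FourierSum.
Context {R : realType}.
Implicit Types (f g : R * R -> R) (k l : int * int).

Lemma continuous_mul f g : continuous f -> continuous g -> continuous (fun p => f p * g p).
Proof. by move=> cf cg p; apply: cvgM; [exact: cf|exact: cg]. Qed.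

Lemma mean_sum_continuous (I : finType) (f : I -> R * R -> R) :
  (forall i, continuous (f i)) ->
  mean (fun p => \sum_i f i p) = \sum_i mean (f i) /\ continuous (fun p => \sum_i f i p).
Proof.
move=> cf; elim: (index_enum I) => [|i r [IH c]].
  have E : (fun p : R * R => \sum_(i <- [::]) f i p) = fun=> 0.
    by apply/funext => p; rewrite big_nil.
  by rewrite E mean_cst big_nil; split => // p; exact: cvg_cst.
have E : (fun p => \sum_(j <- i :: r) f j p) = (fun p => f i p + \sum_(j <- r) f j p).
  by apply/funext => p; rewrite big_cons.
rewrite E; split; last by move=> p; apply: cvgD; [exact: cf|exact: c].
by rewrite meanD ?IH ?big_cons//; exact: continuous_summable.
Qed.

Lemma continuous_sum (I : finType) (f : I -> R * R -> R) :
  (forall i, continuous (f i)) -> continuous (fun p => \sum_i f i p).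
Proof. by move=> /mean_sum_continuous[]. Qed.

Lemma mean_sum (I : finType) (f : I -> R * R -> R) :
  (forall i, continuous (f i)) -> mean (fun p => \sum_i f i p) = \sum_i mean (f i).
Proof. by move=> /mean_sum_continuous[]. Qed.

(** The frequencies of the box [-M, M]^2, indexed by a finite type. *)
Definition mode (M : nat) (a : 'I_(2 * M).+1 * 'I_(2 * M).+1) : int * int :=
  (a.1%:Z - M%:Z, a.2%:Z - M%:Z).

Definition low_mode (M : nat) k : bool := (`|k.1| <= M%:Z) && (`|k.2| <= M%:Z).

Lemma sum_mode (M : nat) (X : int * int -> R) l :
  \sum_a (if mode (M:=M) a == l then X (mode a) else 0) = if low_mode M l then X l else 0 :> R.
Proof.
case: ifP => [/andP[l1 l2]|nl].
  have h1 : (absz (l.1 + M%:Z)%R < (2 * M).+1)%N by lia.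
  have h2 : (absz (l.2 + M%:Z)%R < (2 * M).+1)%N by lia.
  have E : mode (Ordinal h1, Ordinal h2) = l.
    by case: l l1 l2 h1 h2 => l1 l2 /= *; congr pair; rewrite /=; lia.
  rewrite (bigD1 (Ordinal h1, Ordinal h2))//= E eqxx big1 ?addr0// => a aN.
  case: eqP => // al; case/negP: aN; apply/eqP.
  have {al} : mode a = mode (Ordinal h1, Ordinal h2) by rewrite E.
  move: (Ordinal h1) (Ordinal h2) => b1 b2; case: a => a1 a2; rewrite /mode /= => -[e1 e2].
  by congr pair; apply: val_inj; rewrite /=; lia.
apply: big1 => a _; case: eqP => // al; move: nl; rewrite -al /low_mode /mode.
case: a al => -[a1 u] [a2 v] /= al; lia.
Qed.

Lemma mean_waveM k l (t s : R) : mean (fun p => wave k t p * wave l s p) =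
  (if k == (- l.1, - l.2) then 2^-1 * cos (t + s) else 0) +
  (if k == l then 2^-1 * cos (t - s) else 0).
Proof.
have cw m u : continuous (wave m u : R * R -> R) by exact: wave_continuous.
rewrite (_ : (fun _ => _) = (fun p => 2^-1 * wave (k.1 + l.1, k.2 + l.2) (t + s) p + 2^-1 * wave (k.1 - l.1, k.2 - l.2) (t - s) p)); last first.
  by apply/funext => p; exact: waveM.
rewrite meanD; [|by apply: summableZ; exact: continuous_summable..].
rewrite !meanZ; [|exact: continuous_summable..].
rewrite !mean_wave; case: k l => k1 k2 [l1 l2] /=.
congr (_ + _).
  rewrite (_ : ((k1 + l1, k2 + l2) == (0, 0)) = ((k1, k2) == (- l1, - l2))); first by case: ifP => // _; rewrite mulr0.
  by rewrite !xpair_eqE !addr_eq0.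
rewrite (_ : ((k1 - l1, k2 - l2) == (0, 0)) = ((k1, k2) == (l1, l2))); first by case: ifP => // _; rewrite mulr0.
by rewrite !xpair_eqE !subr_eq0.
Qed.

Definition cosmode f k := mean (fun p => f p * wave k 0 p).
Definition sinmode f k := mean (fun p => f p * wave k (- (pi / 2)) p).

Lemma cosmodeN f k : cosmode f (- k.1, - k.2) = cosmode f k.
Proof.
rewrite /cosmode; congr mean; apply/funext => p; congr (_ * _).
by rewrite /wave /= -cosN; congr cos; rewrite !mulrNz; ring.
Qed.

Lemma wave_sin k p : wave k (- (pi / 2)) p = sin (2 * pi * (k.1%:~R * p.1 + k.2%:~R * p.2) : R).
Proof. by rewrite /wave cosBpihalf. Qed.

Lemma sinmodeN f k : continuous f -> sinmode f (- k.1, - k.2) = - sinmode f k.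
Proof.
move=> cf; rewrite /sinmode -[RHS]mulN1r -meanZ; last first.
  by apply: summableM; [exact: continuous_summable|exact: wave_continuous].
congr mean; apply/funext => p; rewrite !wave_sin /= mulrCA; congr (_ * _).
by rewrite mulN1r -sinN; congr sin; rewrite !mulrNz; ring.
Qed.

Lemma wave_phase k t p : wave k t p = cos t * wave k 0 p + (- sin t) * wave k (- (pi / 2)) p :> R.
Proof. by rewrite wave_sin /wave addr0 cosD; ring. Qed.

Lemma modes_vanish_phase f k : continuous f -> cosmode f k = 0 -> sinmode f k = 0 ->
  forall t, mean (fun p => f p * wave k t p) = 0.
Proof.
move=> cf c0 s0 t.
have cw m u : continuous (wave m u : R * R -> R) by exact: wave_continuous.
rewrite (_ : (fun _ => _) = (fun p => cos t * (f p * wave k 0 p) + (- sin t) * (f p * wave k (- (pi / 2)) p))).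
  rewrite meanD; [|by apply: summableZ; apply: continuous_summable; exact: continuous_mul..].
  rewrite !meanZ; [|by apply: continuous_summable; exact: continuous_mul..].
  by rewrite -/(cosmode f k) -/(sinmode f k) c0 s0 !mulr0 addr0.
by apply/funext => p; rewrite (wave_phase k t); ring.
Qed.

Definition fourier_sum (M : nat) f p : R :=
  \sum_a (cosmode f (mode (M:=M) a) * wave (mode a) 0 p + sinmode f (mode a) * wave (mode a) (- (pi / 2)) p).

Lemma fourier_sum_term_continuous M f (a : 'I_(2 * M).+1 * 'I_(2 * M).+1) :
  continuous (fun p => cosmode f (mode a) * wave (mode a) 0 p + sinmode f (mode a) * wave (mode a) (- (pi / 2)) p).
Proof.
by move=> p; apply: cvgD; (apply: cvgM; [exact: cvg_cst|exact: wave_continuous]).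
Qed.

Lemma mean_fourier_sum M f l s : mean (fun p => fourier_sum M f p * wave l s p) =
  \sum_a (cosmode f (mode (M:=M) a) * mean (fun p => wave (mode a) 0 p * wave l s p) +
    sinmode f (mode a) * mean (fun p => wave (mode a) (- (pi / 2)) p * wave l s p)).
Proof.
have cw m u : continuous (wave m u : R * R -> R) by exact: wave_continuous.
rewrite (_ : (fun _ => _) = (fun p => \sum_a (cosmode f (mode (M:=M) a) * (wave (mode a) 0 p * wave l s p) +
    sinmode f (mode a) * (wave (mode a) (- (pi / 2)) p * wave l s p)))); last first.
  apply/funext => p; rewrite /fourier_sum mulr_suml; apply: eq_bigr => a _; ring.
rewrite mean_sum; last first.
  by move=> a p; apply: cvgD; (apply: cvgM; [exact: cvg_cst|exact: continuous_mul]).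
apply: eq_bigr => a _; rewrite meanD; [|by apply: summableZ; apply: continuous_summable; exact: continuous_mul..].
by rewrite !meanZ//; apply: continuous_summable; exact: continuous_mul.
Qed.

(** Both sides have the same Fourier coefficients.  The frequencies k and - k
    carry the same waves; this produces the two halves that add up in the
    computation. *)
Lemma fourier_representation M f : periodic f -> continuous f ->
  (forall k, ~~ low_mode M k -> cosmode f k = 0 /\ sinmode f k = 0) ->
  forall p, f p = fourier_sum M f p.
Proof.
move=> pf cf fM p; apply/eqP; rewrite -subr_eq0; apply/eqP; move: p.
have cw m u : continuous (wave m u : R * R -> R) by exact: wave_continuous.
have cs : continuous (fourier_sum M f) by apply: continuous_sum; exact: fourier_sum_term_continuous.
have c2 : cos (- (pi / 2)) = 0 :> R by rewrite cosN cos_pihalf.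
have cosmode_sum l : cosmode (fourier_sum M f) l = cosmode f l.
  rewrite /cosmode mean_fourier_sum.
  rewrite (eq_bigr (fun a => (if mode a == (- l.1, - l.2) then 2^-1 * cosmode f (mode (M:=M) a) else 0) +
     (if mode a == l then 2^-1 * cosmode f (mode a) else 0))); last first.
    move=> a _; rewrite !mean_waveM subr0 addr0 cos0 subr0 addr0 c2.
    by do 2 case: ifP => _; rewrite /cosmode; lra.
  rewrite big_split/= !(sum_mode _ (fun k => 2^-1 * cosmode f k)) cosmodeN.
  rewrite /low_mode /= !normrN; case: ifP => [_|/negbT/fM[]]; first by rewrite /cosmode; lra.
  by rewrite /cosmode => -> _; rewrite addr0.
have sinmode_sum l : sinmode (fourier_sum M f) l = sinmode f l.
  rewrite /sinmode mean_fourier_sum.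
  rewrite (eq_bigr (fun a => (if mode a == (- l.1, - l.2) then - 2^-1 * sinmode f (mode (M:=M) a) else 0) +
     (if mode a == l then 2^-1 * sinmode f (mode a) else 0))); last first.
    move=> a _; rewrite !mean_waveM sub0r add0r opprK cos_pihalf c2 addNr cos0.
    rewrite (_ : - (pi / 2) + - (pi / 2) = - pi); last by lra.
    rewrite cosN cospi.
    by do 2 case: ifP => _; rewrite /sinmode; lra.
  rewrite big_split/= (sum_mode _ (fun k => - 2^-1 * sinmode f k)) (sum_mode _ (fun k => 2^-1 * sinmode f k)) sinmodeN//.
  rewrite /low_mode /= !normrN; case: ifP => [_|/negbT/fM[_]]; first by rewrite /sinmode; lra.
  by rewrite /sinmode => ->; rewrite addr0.
have cd : continuous (fun p => f p - fourier_sum M f p).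
  by move=> p; apply: cvgB; [exact: cf|exact: cs].
apply: fourier_unique => //.
  move=> p; rewrite /fourier_sum; have [-> ->] := pf p.
  split; congr (_ - _); apply: eq_bigr => a _.
    by have [-> _] := wave_periodic (mode a) 0 p; have [-> _] := wave_periodic (mode a) (- (pi / 2)) p.
  by have [_ ->] := wave_periodic (mode a) 0 p; have [_ ->] := wave_periodic (mode a) (- (pi / 2)) p.
have D k u : mean (fun p => (f p - fourier_sum M f p) * wave k u p) =
    mean (fun p => f p * wave k u p) - mean (fun p => fourier_sum M f p * wave k u p).
  rewrite -meanB; [|by apply: continuous_summable; exact: continuous_mul..].
  by congr mean; apply/funext => p; rewrite mulrBl.
move=> k t; apply: modes_vanish_phase => //.
  by rewrite /cosmode D -/(cosmode f k) -/(cosmode (fourier_sum M f) k) cosmode_sum subrr.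
by rewrite /sinmode D -/(sinmode f k) -/(sinmode (fourier_sum M f) k) sinmode_sum subrr.
Qed.

End FourierSum.

(** * Removable point singularities of divergence-free fields *)
Lemma is_derive_val {R : realType} {V W : normedModType R} (f : V -> W) p v a b :
  is_derive p v f a -> a = b -> is_derive p v f b.
Proof. by move=> df <-. Qed.

Section Step.
Context {R : realType}.
Implicit Types (t x : R).

Definition pos t : R := Num.max 0 t.

Lemma is_derive_pos2 t : is_derive t 1 (fun u => pos u * pos u) (2 * pos t).
Proof.
have [t0|t0|<-] := ltgtP 0 t.
- have N : \forall u \near t, u * u = pos u * pos u.
    near=> u; rewrite /pos max_r//; apply: ltW; near: u; exact: lt_nbhsr.
  apply: (near_eq_is_derive N).
  apply: is_derive_eq (is_deriveMf (is_derive_id t 1) (is_derive_id t 1)) _.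
  by rewrite /pos max_r ?(ltW t0)//; ring.
- have N : \forall u \near t, 0 = pos u * pos u.
    near=> u; rewrite /pos max_l ?mulr0//; apply: ltW; near: u; exact: lt_nbhsl.
  apply: (near_eq_is_derive N).
  by rewrite /pos max_l ?(ltW t0)// mulr0; exact: is_derive_cst.
- have L : h^-1 *: (((fun u => pos u * pos u) \o shift 0) (h *: 1) - pos 0 * pos 0) @[h --> 0^'] --> (0 : R).
    apply/cvgr0Pnorm_lt => e e0; near=> h.
    have h0 : h != 0 by near: h; exact: nbhs_dnbhs_neq.
    rewrite /= addr0 [h *: 1]mulr1 /pos maxxx mul0r subr0 /GRing.scale/=.
    have hh : h^-1 * h = 1 by rewrite mulVf.
    have he : `|h| < e by near: h; apply: dnbhs0_lt.
    have [h1|h1] := lerP h 0; first by rewrite ?max_l// !mulr0 normr0.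
    by rewrite ?max_r ?(ltW h1)// mulrA hh mul1r.
  rewrite /pos maxxx mulr0; apply: DeriveDef.
    by apply/cvg_ex; exists 0.
  by apply/cvg_lim.
Unshelve. all: by end_near.
Qed.

Lemma continuous_pos : continuous pos.
Proof. by move=> t; apply: continuous_max; [exact: cvg_cst|exact: cvg_id]. Qed.

(** A C^1 step: 0 on the left of 1 and 1 on the right of 4. *)
Definition step t : R :=
  pos (t - 1) * pos (t - 1) / (pos (t - 1) * pos (t - 1) + pos (4 - t) * pos (4 - t)).

Definition step' t : R :=
  (2 * pos (t - 1) * (pos (4 - t) * pos (4 - t)) + 2 * pos (4 - t) * (pos (t - 1) * pos (t - 1)))
  / (pos (t - 1) * pos (t - 1) + pos (4 - t) * pos (4 - t)) ^+ 2.

Lemma pos_ge0 t : 0 <= pos t.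
Proof. by rewrite /pos le_max lexx. Qed.

Lemma step_den t : 1 <= pos (t - 1) * pos (t - 1) + pos (4 - t) * pos (4 - t).
Proof.
have [t0|t0] := lerP t 2.
  have := pos_ge0 (t - 1); rewrite [pos (4 - t)]max_r; last by lra.
  move: (pos _) => u; nra.
have := pos_ge0 (4 - t); rewrite [pos (t - 1)]max_r; last by lra.
move: (pos _) => u; nra.
Qed.

Lemma is_derive_step t : is_derive t 1 step (step' t).
Proof.
have D := step_den t.
have D0 : pos (t - 1) * pos (t - 1) + pos (4 - t) * pos (4 - t) != 0 by apply/eqP => h; lra.
have d1 : is_derive t 1 (fun u => pos (u - 1) * pos (u - 1)) (2 * pos (t - 1)).
  apply: is_derive_eq (@is_derive_compR _ _ (fun u => pos u * pos u) (fun u : R => u - 1) t 1 1 _ _ (is_derive_pos2 _)) _; last by rewrite mulr1.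
  by apply: is_derive_eq; rewrite subr0.
have d2 : is_derive t 1 (fun u => pos (4 - u) * pos (4 - u)) (- (2 * pos (4 - t))).
  apply: is_derive_eq (@is_derive_compR _ _ (fun u => pos u * pos u) (fun u : R => 4 - u) t 1 (-1) _ _ (is_derive_pos2 _)) _; last by rewrite mulrN1.
  by have := is_deriveBf (is_derive_cst (4 : R) t 1) (is_derive_id t (1 : R)); rewrite sub0r.
have d3 := is_deriveVf (f := fun u : R => pos (u - 1) * pos (u - 1) + pos (4 - u) * pos (4 - u)) D0 (is_deriveDf d1 d2).
have H : is_derive t 1 step _ := is_deriveMf d1 d3.
apply: (is_derive_val H).
rewrite /step'; move: (pos (t - 1)) (pos (4 - t)) D0 => u v D0.
by field.
Qed.

Lemma continuous_pos_comp (T : topologicalType) (f : T -> R) : continuous f -> continuous (fun x : T => pos (f x)).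
Proof. by move=> cf x; apply: (@continuous_comp _ _ _ f pos); [exact: cf|exact: continuous_pos]. Qed.

Lemma continuous_step' : continuous step'.
Proof.
have c1 : continuous (fun t => pos (t - 1)).
  apply: continuous_pos_comp => t; apply: cvgB; [exact: cvg_id|exact: cvg_cst].
have c2 : continuous (fun t => pos (4 - t)).
  apply: continuous_pos_comp => t; apply: cvgB; [exact: cvg_cst|exact: cvg_id].
have M (f g : R -> R) : continuous f -> continuous g -> continuous (fun t => f t * g t).
  by move=> cf cg t; apply: cvgM; [exact: cf|exact: cg].
have A (f g : R -> R) : continuous f -> continuous g -> continuous (fun t => f t + g t).
  by move=> cf cg t; apply: cvgD; [exact: cf|exact: cg].
have C (a : R) : continuous (fun _ : R => a) by move=> t; exact: cvg_cst.
move=> t; apply: cvgM.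
  have cn : continuous (fun t => 2 * pos (t - 1) * (pos (4 - t) * pos (4 - t)) +
      2 * pos (4 - t) * (pos (t - 1) * pos (t - 1))).
    have c0 := C 2.
    by apply: (A); apply: (M); [exact: (M)|exact: (M)|exact: (M)|exact: (M)].
  exact: cn.
have D := step_den t.
apply: cvgV; first by rewrite expf_neq0//; apply/eqP => h; lra.
have cc : continuous (fun t => (pos (t - 1) * pos (t - 1) + pos (4 - t) * pos (4 - t)) * (pos (t - 1) * pos (t - 1) + pos (4 - t) * pos (4 - t))).
  by apply: (M); apply: (A); apply: (M).
exact: cc.
Qed.

Lemma step01 t : 0 <= step t <= 1.
Proof.
have := step_den t; rewrite /step; have := pos_ge0 (t - 1); have := pos_ge0 (4 - t).
move: (pos _) (pos _) => u v u0 v0 D.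
by rewrite divr_ge0 ?ler_pdivrMr//; nra.
Qed.

Lemma step_left t : t <= 1 -> step t = 0 /\ step' t = 0.
Proof.
by move=> t1; rewrite /step /step' [pos (t - 1)]max_l ?subr_le0// ?(mulr0, mul0r, addr0).
Qed.

Lemma step_right t : 4 <= t -> step t = 1 /\ step' t = 0.
Proof.
move=> t4; have := step_den t; rewrite /step /step' [pos (4 - t)]max_l ?subr_le0//.
rewrite ?(mulr0, mul0r, addr0) => D; split => //.
by rewrite divff//; apply/eqP => h; lra.
Qed.

Lemma step'_bound t : `|step' t| <= 108.
Proof.
have [/step_left[_ ->]|t1] := lerP t 1; first by rewrite normr0; lra.
have [/step_right[_ ->]|t4] := lerP 4 t; first by rewrite normr0; lra.
have := step_den t; rewrite /step' [pos (t - 1)]max_r ?[pos (4 - t)]max_r; [|lra|lra].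
move=> D; have D2 : 1 <= ((t - 1) * (t - 1) + (4 - t) * (4 - t)) ^+ 2 by rewrite expr_ge1//; lra.
rewrite ger0_norm; last by apply: divr_ge0; [nra|lra].
rewrite ler_pdivrMr; last by lra.
have : 2 * (t - 1) * ((4 - t) * (4 - t)) + 2 * (4 - t) * ((t - 1) * (t - 1)) <= 108.
  have a1 : 0 <= t - 1 <= 3 by lra.
  have a2 : 0 <= 4 - t <= 3 by lra.
  move: (t - 1) (4 - t) a1 a2 => u v /andP[u0 u3] /andP[v0 v3].
  have : v * v <= 9 by nra.
  have : u * u <= 9 by nra.
  move: (u * u) (v * v) (mulr_ge0 u0 u0) (mulr_ge0 v0 v0) => a b a0 b0 a9 b9.
  have : u * b <= 27 by nra.
  have : v * a <= 27 by nra.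
  lra.
lra.
Qed.

(** The half-angle formula sin (pi x) = 2 sin (pi x / 2) cos (pi x / 2) and the mean
    value theorem on half of the interval suffice here. *)
Lemma sin_pi_lower t : `|t| <= 1 / 2 -> `|t| <= `|sin (pi * t)|.
Proof.
have P x : 0 <= x <= 1 / 2 -> x <= sin (pi * x).
  move=> /andP[x0 x1]; have p2 := pi_ge2 R.
  have [->|xp] := eqVneq x 0; first by rewrite mulr0 sin0.
  have {xp} xp : 0 < x by rewrite lt_neqAle eq_sym xp.
  pose y := pi * x / 2.
  have y0 : 0 < y by rewrite /y; nra.
  have [c /[!in_itv]/= /andP[c0 cy]] := @MVT R sin cos 0 y y0
    (fun z _ => is_derive_sin z) (continuous_subspaceT (@continuous_sin R)).
  rewrite sin0 !subr0 => Es.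
  have yp : y <= pi / 4 by rewrite /y; nra.
  have cc : cos y <= cos c.
    by apply: ltW; rewrite ltr_cos// ?in_itv/=; apply/andP; split; lra.
  have E2 : cos (pi * x) = 2 * cos y ^+ 2 - 1.
    rewrite (_ : pi * x = y *+ 2) ?cos_mulr2n ?mulr2n; first by lra.
    by rewrite /y; lra.
  have c2 : 0 <= cos (pi * x).
    apply: cos_ge0_pihalf; apply/andP; split; nra.
  have cy0 : 0 <= cos y by apply: cos_ge0_pihalf; apply/andP; split; lra.
  rewrite (_ : pi * x = y *+ 2); last by rewrite /y mulr2n; lra.
  rewrite sin_mulr2n Es mulr2n.
  have : x <= y by rewrite /y; nra.
  rewrite expr2 in E2.
  have : cos y * cos y <= cos y * cos c by rewrite ler_wpM2l.
  nra.
move=> t1; have [t0|t0] := lerP 0 t.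
  by rewrite ger0_norm// in t1 *; apply: le_trans (ler_norm _); apply: P; rewrite t0.
rewrite ltr0_norm// in t1 *.
rewrite -[X in _ <= X]normrN -sinN -mulrN; apply: le_trans (ler_norm _).
by apply: P; lra.
Qed.

Lemma sin_pi_near t (e : R) : -1 < t < 1 -> `|sin (pi * t)| < e ->
  exists2 i : 'I_3, true & `|t - (i%:R - 1)| < e.
Proof.
move=> /andP[t1 t2] te.
have [h|h] := lerP `|t| (1 / 2).
  exists (inord 1) => //; rewrite inordK// subrr subr0.
  exact: le_lt_trans (sin_pi_lower h) te.
have [t0|t0] := lerP 0 t.
  exists (inord 2) => //; rewrite inordK// (_ : 2%:R - 1 = 1); last by lra.
  rewrite ger0_norm// in h.
  apply: le_lt_trans te; have -> : sin (pi * t) = - sin (pi * (t - 1)).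
    rewrite -[in LHS](subrK 1 t) mulrDr mulr1 sinD cospi sinpi; lra.
  rewrite normrN; apply: sin_pi_lower; rewrite ler_norml; apply/andP; split; lra.
exists (inord 0) => //; rewrite inordK// sub0r opprK.
rewrite ltr0_norm// in h.
apply: le_lt_trans te; have -> : sin (pi * t) = - sin (pi * (t + 1)).
  rewrite mulrDr mulr1 sinD cospi sinpi; lra.
rewrite normrN; apply: sin_pi_lower; rewrite ler_norml; apply/andP; split; lra.
Qed.

End Step.

Section Cutoffs.
Context {R : realType}.
Implicit Types (p b : R * R) (B : set (R * R)).

(** Functions eta n that vanish near B and tend to 1 off B.  The bound on the
    Dirichlet energies, uniform in n, is the reason why points are removable in
    dimension two. *)
Definition cutoffs B (eta : nat -> R * R -> R) (deta : 'I_2 -> nat -> R * R -> R) : Prop :=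
  [/\ (forall n, periodic (eta n) /\ continuous (eta n)) /\ (forall i n, continuous (deta i n)),
      forall i n p, is_derive p (stdbasis i) (eta n) (deta i n p),
      forall n p, 0 <= eta n p <= 1,
      (forall n p, B p -> \forall q \near p, eta n q = 0 /\ forall i, deta i n q = 0) /\
      (forall p, ~ B p -> exists N, forall n, (N <= n)%N -> eta n p = 1 /\ forall i, deta i n p = 0)
    & exists C, forall i n, mean (fun p => deta i n p * deta i n p) <= C].

Definition lattice_orbit b : set (R * R) :=
  [set p | exists m n : int, p = b + (m%:~R, n%:~R)].

(** A periodic and smooth function comparable with the squared distance to the orbit
    of b under the lattice. *)
Definition dist_sin b p : R :=
  sin (pi * (p.1 - b.1)) * sin (pi * (p.1 - b.1)) + sin (pi * (p.2 - b.2)) * sin (pi * (p.2 - b.2)).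

Definition coord (i : 'I_2) p : R := if i == ord0 then p.1 else p.2.

Definition ddist_sin (i : 'I_2) b p : R :=
  2 * pi * (sin (pi * (coord i p - coord i b)) * cos (pi * (coord i p - coord i b))).

Lemma sin_pi_eq0 (x : R) : sin (pi * x) = 0 -> exists m : int, x = m%:~R.
Proof.
move=> sx; exists (Num.floor x).
have p0 := pi_gt0 R.
pose r := x - (Num.floor x)%:~R.
have r0 : 0 <= r by rewrite /r subr_ge0 floor_le_tmp.
have r1 : r < 1 by rewrite /r ltrBlDl -[X in _ < _ + X]/(1%:~R) -intrD; exact: floorD1_gt.
have sr : sin (pi * r) * sin (pi * r) = 0.
  have : cos (2 * (pi * x)) = cos (2 * (pi * r)).
    rewrite -(cosD2piz (2 * (pi * r)) (Num.floor x)); congr cos; rewrite /r; ring.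
  have D y : cos (2 * y) = 1 - 2 * (sin y * sin y) :> R.
    have := cos2Dsin2 y; rewrite [2 * y]mulr_natl cos_mulr2n mulr2n !expr2; lra.
  rewrite !D sx; lra.
have {}r0 : r = 0.
  apply/eqP; apply: contraT => rn; exfalso.
  have rp : 0 < r by rewrite lt_neqAle eq_sym rn.
  have := @sin_gt0_pi R (pi * r); have : 0 < pi * r < pi by apply/andP; split; nra.
  move=> h /(_ h); nra.
by move: r0; rewrite /r => /eqP; rewrite subr_eq0 => /eqP.
Qed.

Lemma dist_sin_ge0 b p : 0 <= dist_sin b p.
Proof. by rewrite /dist_sin addr_ge0// -expr2 sqr_ge0. Qed.

Lemma dist_sin_eq0 b p : dist_sin b p = 0 -> lattice_orbit b p.
Proof.
rewrite /dist_sin -!expr2 => /eqP; rewrite paddr_eq0 ?sqr_ge0// !sqrf_eq0.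
move=> /andP[/eqP/sin_pi_eq0[m pm] /eqP/sin_pi_eq0[n pn]]; exists m, n.
case: p pm pn => x y /= <- <-; case: b => u v /=.
by congr pair; rewrite /= addrC subrK.
Qed.

Lemma dist_sin_periodic b : periodic (dist_sin b).
Proof.
have S x : sin (pi * (x + 1)) = - sin (pi * x) :> R.
  by rewrite mulrDr mulr1 sinD cospi sinpi mulrN1 mulr0 addr0.
move=> p; rewrite /dist_sin /=; split.
  by rewrite [p.1 + 1 - _]addrAC S mulrNN addr0.
by rewrite [p.2 + 1 - _]addrAC S mulrNN addr0.
Qed.

Lemma dist_sin_orbit b p : lattice_orbit b p -> dist_sin b p = 0.
Proof.
move=> [m [n ->]]; rewrite (periodic_int _ _ _ (dist_sin_periodic b)).
by rewrite /dist_sin !subrr mulr0 sin0 mulr0 addr0.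
Qed.

Lemma is_derive_coord i p : is_derive p (stdbasis i) (coord i) 1.
Proof.
apply/is_derive_lineP.
apply: (@is_derive_ext _ _ _ (fun t : R => t + coord i p)).
  by move=> t; rewrite /coord /stdbasis; case: ifP => _; rewrite /= /GRing.scale/= mulr1.
apply: (is_derive_val (is_deriveDf (is_derive_id _ _) (is_derive_cst _ _ _))).
exact: addr0.
Qed.

Lemma is_derive_ocoord i j p : i != j -> is_derive p (stdbasis i) (coord j) 0.
Proof.
move=> ij; apply/is_derive_lineP.
apply: (@is_derive_ext _ _ _ (fun t : R => coord j p)).
move=> t; rewrite /coord /stdbasis; move: i j ij => [[|[|i]] hi] [[|[|j]] hj] //= _;
  by rewrite /GRing.scale/= mulr0 add0r.
Qed.

Lemma is_derive_sin2 i j b p : is_derive p (stdbasis i)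
  (fun q => sin (pi * (coord j q - coord j b)) * sin (pi * (coord j q - coord j b)))
  (if i == j then ddist_sin j b p else 0).
Proof.
have d : is_derive p (stdbasis i) (fun q => pi * (coord j q - coord j b)) (if i == j then pi else 0).
  have d0 : is_derive p (stdbasis i) (coord j) (if i == j then 1 else 0).
    by case: eqP => [->|/eqP ij]; [exact: is_derive_coord|exact: is_derive_ocoord].
  apply: (is_derive_val (is_deriveZf pi (is_deriveBf d0 (is_derive_cst (coord j b) p (stdbasis i))))).
  by rewrite subr0; case: ifP => _; rewrite ?mulr1 ?mulr0.
have ds := is_derive_compR d (is_derive_sin _).
apply: (is_derive_val (is_deriveMf ds ds)).
by case: ifP => _; rewrite /ddist_sin ?mulr0 ?mul0r ?addr0//; ring.
Qed.

Lemma is_derive_dist_sin i b p : is_derive p (stdbasis i) (dist_sin b) (ddist_sin i b p).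
Proof.
have d0 := is_derive_sin2 i ord0 b p; have d1 := is_derive_sin2 i ord_max b p.
apply: (is_derive_val (is_deriveDf d0 d1)).
by case: (i =P ord0) => [->|]; rewrite ?addr0// => /eqP; case: i {d0 d1} => [[|[|i]] hi]//= _; rewrite add0r.
Qed.

Lemma continuous_coord i : continuous (coord i).
Proof.
move=> p; rewrite /coord; case: (i == ord0); first exact: cvg_fst.
exact: cvg_snd.
Qed.

Lemma continuous_sin_coord i b : continuous (fun p => sin (pi * (coord i p - coord i b))).
Proof.
move=> p; apply: (@continuous_comp _ _ _ (fun p => pi * (coord i p - coord i b)) sin); last exact: continuous_sin.
apply: cvgM; first exact: cvg_cst.
by apply: cvgB; [exact: continuous_coord|exact: cvg_cst].
Qed.

Lemma continuous_ddist_sin i b : continuous (ddist_sin i b).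
Proof.
move=> p; apply: cvgM; first exact: cvg_cst.
apply: cvgM; first exact: continuous_sin_coord.
apply: (@continuous_comp _ _ _ (fun p => pi * (coord i p - coord i b)) cos); last exact: continuous_cos.
apply: cvgM; first exact: cvg_cst.
by apply: cvgB; [exact: continuous_coord|exact: cvg_cst].
Qed.

Lemma continuous_dist_sin b : continuous (dist_sin b).
Proof.
have c0 := @continuous_sin_coord ord0 b; have c1 := @continuous_sin_coord ord_max b.
by move=> p; apply: cvgD; (apply: cvgM; [exact: c0 || exact: c1|exact: c0 || exact: c1]).
Qed.

Definition eta1 b (n : nat) p : R := step (n.+1%:R ^+ 2 * dist_sin b p).

Definition deta1 b (i : 'I_2) (n : nat) p : R :=
  step' (n.+1%:R ^+ 2 * dist_sin b p) * (n.+1%:R ^+ 2 * ddist_sin i b p).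

Lemma mean_indic_box_le (q : R * R) (e : R) : 0 < e -> mean \1_(box q e) <= (2 * e) ^+ 2.
Proof.
move=> e0; rewrite /mean /Rintegral integral_indic; last 2 first.
  exact: square_measurable. exact: box_measurable.
have le : ((leb2 R) (box q e `&` square) <= ((2 * e) ^+ 2)%:E)%E.
  rewrite -(box_measure q e0); apply: le_measure; rewrite ?inE.
  - by apply: measurableI; [exact: box_measurable|exact: square_measurable].
  - exact: box_measurable.
  - by move=> x [].
rewrite -[X in _ <= X]/(fine ((2 * e) ^+ 2)%:E); apply: fine_le => //.
by rewrite ge0_fin_numE// (le_lt_trans le)// ltry.
Qed.

(** Where the gradient is not zero, dist_sin is at most 4 / (n + 1)^2, so the point is in a
    box of size 2 / (n + 1) about one of the nine translates of b next to the
    square; there the gradient is of order n. *)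
Lemma deta1_bound b i n p : square b -> square p ->
  deta1 b i n p * deta1 b i n p <=
  (432 * pi * n.+1%:R) ^+ 2 * \sum_(a : 'I_3 * 'I_3) \1_(box (b.1 + (a.1%:R - 1), b.2 + (a.2%:R - 1)) (2 / n.+1%:R)) p.
Proof.
move=> [/= b1 b2] [/= p1 p2]; move: b1 b2 p1 p2; rewrite !in_itv/=.
move=> /andP[b10 b11] /andP[b20 b21] /andP[p10 p11] /andP[p20 p21].
rewrite /deta1; set N : R := n.+1%:R; have N0 : 0 < N by rewrite /N ltr0n.
clearbody N.
have pi0 := pi_gt0 R.
have S0 : 0 <= \sum_(a : 'I_3 * 'I_3) \1_(box (b.1 + (a.1%:R - 1), b.2 + (a.2%:R - 1)) (2 / N)) p :> R.
  by apply: sumr_ge0 => a _; rewrite indicE ler0n.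
have [h|h] := lerP 4 (N ^+ 2 * dist_sin b p).
  by have [_ ->] := step_right h; rewrite !mul0r mulr_ge0// sqr_ge0.
have M (x : R) : x * x <= dist_sin b p -> `|x| < 2 / N.
  move=> xd; rewrite ltr_pdivlMr// -(@ltr_pXn2r _ 2)// ?nnegrE ?mulr_ge0// ?(ltW N0)//.
  by rewrite exprMn real_normK ?num_real// !expr2; rewrite expr2 in h; nra.
have s1 : `|sin (pi * (p.1 - b.1))| < 2 / N.
  by apply: M; rewrite /dist_sin lerDl -expr2 sqr_ge0.
have s2 : `|sin (pi * (p.2 - b.2))| < 2 / N.
  by apply: M; rewrite /dist_sin lerDr -expr2 sqr_ge0.
have h1 : -1 < p.1 - b.1 < 1 by lra.
have h2 : -1 < p.2 - b.2 < 1 by lra.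
have [a1 _ ha1] := sin_pi_near h1 s1.
have [a2 _ ha2] := sin_pi_near h2 s2.
have S1 : 1 <= \sum_(a : 'I_3 * 'I_3) \1_(box (b.1 + (a.1%:R - 1), b.2 + (a.2%:R - 1)) (2 / N)) p :> R.
  rewrite (bigD1 (a1, a2))//= indicE mem_set.
    by rewrite lerDl; apply: sumr_ge0 => a _; rewrite indicE ler0n.
  move: ha1 ha2; rewrite !ltr_norml => /andP[u1 u2] /andP[v1 v2].
  by split; rewrite /= in_itv/=; apply/andP; split; lra.
have B1 := step'_bound (N ^+ 2 * dist_sin b p).
have B2 : `|N ^+ 2 * ddist_sin i b p| <= 4 * pi * N.
  rewrite normrM ger0_norm ?sqr_ge0// /ddist_sin !normrM (ger0_norm (ltW pi0)) [`|2|]ger0_norm//.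
  have c1 := cos_max (pi * (coord i p - coord i b)).
  have s3 : `|sin (pi * (coord i p - coord i b))| < 2 / N by rewrite /coord; case: ifP.
  have sN : N * `|sin (pi * (coord i p - coord i b))| <= 2.
    by rewrite mulrC -ler_pdivlMr// ltW.
  move: c1 sN (normr_ge0 (cos (pi * (coord i p - coord i b)))) (normr_ge0 (sin (pi * (coord i p - coord i b)))).
  move: `|cos _| `|sin _| => c s c1 sN c0 s0.
  rewrite (_ : N ^+ 2 * (2 * pi * (s * c)) = 2 * pi * N * (N * s * c)); last by ring.
  rewrite (_ : 4 * pi * N = 2 * pi * N * 2); last by ring.
  rewrite ler_wpM2l//; first by rewrite !mulr_ge0// ltW.
  by nra.
have B : `|step' (N ^+ 2 * dist_sin b p) * (N ^+ 2 * ddist_sin i b p)| <= 432 * pi * N.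
  rewrite normrM (_ : 432 * pi * N = 108 * (4 * pi * N)); last by ring.
  by rewrite ler_pM.
rewrite -expr2 -real_normK ?num_real//.
have : `|step' (N ^+ 2 * dist_sin b p) * (N ^+ 2 * ddist_sin i b p)| ^+ 2 <= (432 * pi * N) ^+ 2.
  by rewrite lerXn2r ?nnegrE// !mulr_ge0// ltW.
move=> /le_trans; apply; by rewrite -[X in X <= _]mulr1 ler_wpM2l// sqr_ge0.
Qed.

(** The squared gradient is of order n^2 on a set of area of order 1 / n^2. *)
Lemma cutoffs_orbit b : square b -> cutoffs (lattice_orbit b) (eta1 b) (deta1 b).
Proof.
move=> sb.
have cd i n : continuous (deta1 b i n).
  move=> p; apply: cvgM.
    apply: (@continuous_comp _ _ _ (fun p => n.+1%:R ^+ 2 * dist_sin b p) step'); last exact: continuous_step'.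
    by apply: cvgM; [exact: cvg_cst|exact: continuous_dist_sin].
  by apply: cvgM; [exact: cvg_cst|exact: continuous_ddist_sin].
split.
- split=> // n; split=> p; rewrite /eta1; first by have [-> ->] := dist_sin_periodic b p.
  apply: (@continuous_comp _ _ _ (fun p => n.+1%:R ^+ 2 * dist_sin b p) step).
    by apply: cvgM; [exact: cvg_cst|exact: continuous_dist_sin].
  apply: differentiable_continuous; apply/derivable1_diffP.
  by have [] := is_derive_step (n.+1%:R ^+ 2 * dist_sin b p).
- move=> i n p; apply: (@is_derive_compR _ _ step); last exact: is_derive_step.
  exact: is_deriveZf (is_derive_dist_sin _ _ _).
- by move=> n p; exact: step01.
- split=> [n p Bp|p Bp].
    have : \forall q \near p, n.+1%:R ^+ 2 * dist_sin b q < 1.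
      have c : continuous (fun q => n.+1%:R ^+ 2 * dist_sin b q).
        by move=> q; apply: cvgM; [exact: cvg_cst|exact: continuous_dist_sin].
      by apply: (cvgr_lt _ (c p)); rewrite dist_sin_orbit// mulr0.
    apply: filterS => q /ltW/step_left[e0 e1].
    by rewrite /eta1 /deta1 e0 e1; split => // i; rewrite mul0r.
  have d0 : 0 < dist_sin b p.
    rewrite lt_neqAle dist_sin_ge0 andbT; apply/eqP => /esym/dist_sin_eq0; exact: Bp.
  pose N := Num.bound (4 / dist_sin b p).
  exists N => n Nn.
  have : 4 <= n.+1%:R ^+ 2 * dist_sin b p.
    rewrite -ler_pdivrMr//.
    have : 4 / dist_sin b p < N%:R.
      by apply: le_lt_trans (archi_boundP _); rewrite ?divr_ge0 ?(ltW d0).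
    have : N%:R <= n.+1%:R :> R by rewrite ler_nat (leq_trans Nn).
    have : 1 <= n.+1%:R :> R by rewrite ler1n.
    rewrite expr2; nra.
  by move=> /step_right[e0 e1]; rewrite /eta1 /deta1 e0 e1; split => // i; rewrite mul0r.
- exists ((1728 * pi) ^+ 2 * 9) => i n.
  have N0 : 0 < n.+1%:R :> R by rewrite ltr0n.
  have e0 : 0 < 2 / n.+1%:R :> R by rewrite divr_gt0.
  pose S (p : R * R) := \sum_(a : 'I_3 * 'I_3) \1_(box (b.1 + (a.1%:R - 1), b.2 + (a.2%:R - 1)) (2 / n.+1%:R)) p : R.
  have [sS mS] : summable S /\ mean S <= 9 * (4 / n.+1%:R) ^+ 2.
    have E : 9 * (4 / n.+1%:R) ^+ 2 = \sum_(a : 'I_3 * 'I_3) (4 / n.+1%:R) ^+ 2 :> R.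
      by rewrite sumr_const card_prod card_ord mulr_natl.
    rewrite E /S; elim: (index_enum _) => [|a r [IH1 IH2]].
      rewrite (_ : (fun p => _) = fun=> 0); last by apply/funext => p; rewrite big_nil.
      by rewrite mean_cst big_nil; split => //; apply: continuous_summable => p; exact: cvg_cst.
    rewrite (_ : (fun p => _) = fun p => \1_(box (b.1 + (a.1%:R - 1), b.2 + (a.2%:R - 1)) (2 / n.+1%:R)) p +
      \sum_(a <- r) \1_(box (b.1 + (a.1%:R - 1), b.2 + (a.2%:R - 1)) (2 / n.+1%:R)) p); last first.
      by apply/funext => p; rewrite big_cons.
    split; first by apply: summableD => //; exact: summable_indic_box.
    rewrite meanD//; last exact: summable_indic_box.
    rewrite big_cons lerD//; apply: le_trans (mean_indic_box_le _ e0) _.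
    by rewrite (_ : 2 * (2 / n.+1%:R) = 4 / n.+1%:R)// mulrA; congr (_ / _); lra.
  have : mean (fun p => deta1 b i n p * deta1 b i n p) <= mean (fun p => (432 * pi * n.+1%:R) ^+ 2 * S p).
    apply: le_mean; last by move=> p sp; exact: deta1_bound.
      by apply: continuous_summable; exact: continuous_mul.
    exact: summableZ.
  move=> /le_trans; apply; rewrite meanZ//.
  have -> : (1728 * pi) ^+ 2 * 9 = (432 * pi * n.+1%:R) ^+ 2 * (9 * (4 / n.+1%:R) ^+ 2) :> R.
    by field; rewrite gt_eqF.
  by rewrite ler_wpM2l// sqr_ge0.
Qed.

(** A product of cutoffs; both factors are at most 1, so the Dirichlet energies add
    up. *)
Lemma cutoffsU B B' eta deta eta' deta' : cutoffs B eta deta -> cutoffs B' eta' deta' ->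
  cutoffs (B `|` B') (fun n p => eta n p * eta' n p)
    (fun i n p => deta i n p * eta' n p + eta n p * deta' i n p).
Proof.
move=> [[p1 c1] d1 b1 [n1 f1] [C1 e1]] [[p2 c2] d2 b2 [n2 f2] [C2 e2]].
split.
- have c1' n : continuous (eta n) by have [] := p1 n.
  have c2' n : continuous (eta' n) by have [] := p2 n.
  split=> [n|i n p]; last by apply: cvgD; apply: cvgM; [exact: c1|exact: c2'|exact: c1'|exact: c2].
  split; last exact: continuous_mul.
  by move=> p; have [-> ->] := (p1 n).1 p; have [-> ->] := (p2 n).1 p.
- by move=> i n p; exact: is_deriveMf.
- move=> n p; have := b1 n p; have := b2 n p; move: (eta n p) (eta' n p) => u v; nra.
- split=> [n p [Bp|Bp]|p nBp].
  + apply: filterS (n1 n p Bp) => q [-> h]; split; first by rewrite mul0r.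
    by move=> i; rewrite h !mul0r addr0.
  + apply: filterS (n2 n p Bp) => q [-> h]; split; first by rewrite mulr0.
    by move=> i; rewrite h !mulr0 addr0.
  + have [|N1 h1] := f1 p; first by move=> ?; apply: nBp; left.
    have [|N2 h2] := f2 p; first by move=> ?; apply: nBp; right.
    exists (maxn N1 N2) => n; rewrite geq_max => /andP[/h1[-> g1] /h2[-> g2]].
    by split; [rewrite mulr1|move=> i; rewrite g1 g2 mul0r mulr0 addr0].
- exists (2 * C1 + 2 * C2) => i n.
  have c1' : continuous (eta n) by have [] := p1 n.
  have c2' : continuous (eta' n) by have [] := p2 n.
  have s1 : summable (fun p => deta i n p * deta i n p) by apply: continuous_summable; exact: continuous_mul.
  have s2 : summable (fun p => deta' i n p * deta' i n p) by apply: continuous_summable; exact: continuous_mul.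
  have cc : continuous (fun p => deta i n p * eta' n p + eta n p * deta' i n p).
    by move=> p; apply: cvgD; apply: cvgM; [exact: c1|exact: c2'|exact: c1'|exact: c2].
  have : mean (fun p => (deta i n p * eta' n p + eta n p * deta' i n p) * (deta i n p * eta' n p + eta n p * deta' i n p)) <=
      mean (fun p => 2 * (deta i n p * deta i n p) + 2 * (deta' i n p * deta' i n p)).
    apply: le_mean.
    - by apply: continuous_summable; exact: continuous_mul.
    - by apply: summableD; exact: summableZ.
    - move=> p _; have /andP[u0 u1] := b1 n p; have /andP[v0 v1] := b2 n p.
      move: (deta i n p) (deta' i n p) (eta n p) (eta' n p) u0 u1 v0 v1 => a b u v u0 u1 v0 v1.
      have K x w : 0 <= w -> w <= 1 -> (x * w) * (x * w) <= x * x :> R.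
        by move=> w0 w1; rewrite mulrACA ler_piMr ?mulr_ile1// -expr2 sqr_ge0.
      have h1 := K a v v0 v1; have h2 := K b u u0 u1.
      have := sqr_ge0 (a * v - u * b); rewrite expr2; nra.
  rewrite meanD; [|exact: summableZ|exact: summableZ].
  rewrite !meanZ// => /le_trans; apply.
  by have := e1 i n; have := e2 i n; lra.
Qed.

Lemma cutoffs_exist (l : seq (R * R)) : (forall b, b \in l -> square b) ->
  exists eta deta, cutoffs [set p | exists2 b, b \in l & lattice_orbit b p] eta deta.
Proof.
elim: l => [|b l IH] sl.
  exists (fun _ _ => 1), (fun _ _ _ => 0); split.
  - by split => [n|i n p]; [split => // p|]; exact: cvg_cst.
  - by move=> i n p; exact: is_derive_cst.
  - by move=> n p; rewrite ler01 lexx.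
  - split; first by move=> n p [].
    by move=> p _; exists 0%N.
  - by exists 0 => i n; rewrite mulr0 mean_cst.
have [eta [deta h]] := IH (fun c cl => sl c (mem_behead (s := b :: l) cl)).
have h1 := cutoffs_orbit (sl b (mem_head _ _)).
exists (fun n p => eta1 b n p * eta n p), (fun i n p => deta1 b i n p * eta n p + eta1 b n p * deta i n p).
have -> : [set p | exists2 c, c \in b :: l & lattice_orbit c p] =
    lattice_orbit b `|` [set p | exists2 b, b \in l & lattice_orbit b p].
  apply/seteqP; split => [p [c]|p [bp|[c cl cp]]].
  - by rewrite inE => /orP[/eqP->|cl cp]; [left|right; exists c].
  - by exists b => //; exact: mem_head.
  - by exists c => //; rewrite inE cl orbT.
exact: cutoffsU.
Qed.

End Cutoffs.

Section RemovableSingularities.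
Context {R : realType}.
Implicit Types (p : R * R) (B : set (R * R)).

Lemma mean_dominated (f : nat -> R * R -> R) (g : R * R -> R) :
  (forall n, measurable_fun (square : set (plane R)) (f n : _ -> measurableTypeR R)) ->
  (forall n p, square p -> `|f n p| <= g p) -> summable g ->
  (forall p, square p -> exists N, forall n, (N <= n)%N -> f n p = 0) ->
  mean (f n) @[n --> \oo] --> (0 : R).
Proof.
move=> mf fg sg f0.
have := @dominated_cvg _ _ _ (leb2 R) square
  square_measurable (fun n => EFin \o f n) (fun=> 0%E) (EFin \o g).
move=> H; have {}H := H (fun n => (measurable_EFinP _ _).2 (mf n)).
have {}H := H _ (fun _ _ => isT) sg.
rewrite /mean /Rintegral; apply: (fine_cvg).
rewrite (_ : 0%:E = \int[(leb2 R)]_(x in square) (fun=> 0%E) x)%E; last by rewrite integral0.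
apply: H => [p sp|n p sp]; last by rewrite /= lee_fin; exact: fg.
apply: cvg_near_cst; have [N hN] := f0 p sp.
by exists N => // n /= Nn; rewrite hN.
Qed.

(** Young's inequality, with a parameter that will be chosen small. *)
Lemma bounded_by_square_sum (x y d : R) : 0 < d -> `|x * y| <= d^-1 * (x * x) + d * (y * y).
Proof.
move=> d0; have := sqr_ge0 (`|x| - d * `|y|); rewrite expr2 normrM.
have -> : x * x = `|x| * `|x| by rewrite -expr2 -real_normK ?num_real.
have -> : y * y = `|y| * `|y| by rewrite -expr2 -real_normK ?num_real.
move: `|x| `|y| (normr_ge0 x) (normr_ge0 y) => {}x {}y x0 y0 h.
rewrite -(ler_pM2l d0) mulrDr mulVKf ?gt_eqF//.
nra.
Qed.

Variables (B : set (R * R)) (a d : 'I_2 -> R * R -> R).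
Hypotheses (B_per : forall m n : int, forall p, B (p + (m%:~R, n%:~R)) -> B p)
  (B_per' : forall m n : int, forall p, B p -> B (p + (m%:~R, n%:~R)))
  (B_fin : finite_set (B `&` square))
  (a_per : forall i, periodic (a i))
  (a_meas : forall i, measurable_fun (square : set (plane R)) (a i : _ -> measurableTypeR R))
  (a_sq : forall i, summable (fun p => a i p * a i p))
  (a_B : forall i p, B p -> a i p = 0)
  (a_cont : forall i p, ~ B p -> {for p, continuous (a i)})
  (d_cont : forall i p, ~ B p -> {for p, continuous (d i)})
  (a_der : forall i p, ~ B p -> is_derive p (stdbasis i) (a i) (d i p))
  (div0 : forall p, ~ B p -> d ord0 p + d ord_max p = 0).

Lemma summable_of_square i : summable (a i).
Proof.
apply: (le_summable (g := fun p => 1 + a i p * a i p)) => //.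
  move=> p _; have := bounded_by_square_sum (a i p) 1 ltr01.
  rewrite invr1 !mulr1 mul1r; lra.
by apply: summableD => //; apply: continuous_summable => p; exact: cvg_cst.
Qed.

Lemma singular_cutoffs : exists eta deta, cutoffs B eta deta.
Proof.
have /finite_seqP[l Bl] := B_fin.
have ls b : b \in l -> square b.
  by move=> bl; have : [set` l] b by []; rewrite -Bl => -[].
have [eta [deta h]] := cutoffs_exist ls.
exists eta, deta; rewrite (_ : B = [set p | exists2 b, b \in l & lattice_orbit b p])//.
apply/seteqP; split=> [p Bp|p [b bl [m [n ->]]]].
  have [q [sq pq]] : exists q, square q /\ exists m n : int, p = q + (m%:~R, n%:~R).
    exists (p + ((- Num.floor p.1)%:~R, (- Num.floor p.2)%:~R)); split.
      have F (x : R) : 0 <= x + (- Num.floor x)%:~R < 1.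
        rewrite mulrNz subr_ge0 ltrBlDl floor_le_tmp/= -[X in _ < _ + X]/(1%:~R) -intrD.
        exact: floorD1_gt.
      by split; rewrite /= in_itv/= F.
    exists (Num.floor p.1), (Num.floor p.2); rewrite -addrA [X in p + X](_ : _ = 0) ?addr0//.
    by congr pair; rewrite /= mulrNz addNr.
  exists q => //; have : (B `&` square) q.
    by split => //; move: pq Bp => [m [n ->]]; exact: B_per.
  by rewrite Bl.
apply: B_per'; have : [set` l] b by [].
by rewrite -Bl => -[].
Qed.

Variables (k : int * int) (t : R).

Let phi := wave k t.
Let dphi i p := 2 * pi * freq i k * wave k (t + pi / 2) p.

Lemma mean_cutoff_product eta deta : cutoffs B eta deta -> forall n,
  mean (fun p => eta n p * (a ord0 p * dphi ord0 p + a ord_max p * dphi ord_max p) +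
    phi p * (a ord0 p * deta ord0 n p + a ord_max p * deta ord_max n p)) = 0.
Proof.
move=> [[eta_pc cdeta] eta_der eta01 [etaB eta_far] _] n.
have cphi : continuous phi by exact: wave_continuous.
have cdphi i : continuous (dphi i).
  by move=> p; apply: cvgM; [exact: cvg_cst|exact: wave_continuous].
have ceta : continuous (eta n) by have [] := eta_pc n.
pose g i p := (d i p * eta n p + a i p * deta i n p) * phi p + a i p * eta n p * dphi i p.
have gder i p : is_derive p (stdbasis i) (fun q => a i q * eta n q * phi q) (g i p).
  have [Bp|Bp] := pselect (B p); last first.
    exact: is_deriveMf (is_deriveMf (a_der _ Bp) (eta_der i n p)) (is_derive_wave k t i p).
  have N := etaB n p Bp.
  have N0 : \forall q \near p, (fun=> 0 : R) q = a i q * eta n q * phi q.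
    by apply: filterS N => q [-> _]; rewrite mulr0 mul0r.
  apply: (near_eq_is_derive N0).
  have [e0 e1] := nbhs_singleton N.
  by rewrite /g e0 e1 ?(mulr0, mul0r, addr0); exact: is_derive_cst.
have gcont i : continuous (g i).
  move=> p; have [Bp|Bp] := pselect (B p).
    have N := etaB n p Bp.
    have N0 : \forall q \near p, 0 = g i q.
      apply: filterS N => q [e0 e1].
      by rewrite /g e0 e1 ?(mulr0, mul0r, addr0).
    have g0 := nbhs_singleton N0.
    rewrite /continuous_at -g0; apply: cvg_near_cst; by apply: filterS N0 => q <-.
  have ca := @a_cont i p Bp; have cd := @d_cont i p Bp.
  apply: cvgD; apply: cvgM.
  - by apply: cvgD; apply: cvgM => //; [exact: ceta|exact: cdeta].
  - exact: cphi.
  - by apply: cvgM => //; exact: ceta.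
  - exact: cdphi.
have gmean i : mean (g i) = 0.
  apply: (@mean_partial _ i (fun q => a i q * eta n q * phi q)) => // p.
  have [-> ->] := a_per i p; have [-> ->] := (eta_pc n).1 p.
  by rewrite /phi; have [-> ->] := wave_periodic k t p.
have sg i : summable (g i) by exact: continuous_summable.
have : mean (fun p => g ord0 p + g ord_max p) = 0 by rewrite meanD// !gmean addr0.
move=> <-; congr mean; apply/funext => p; rewrite /g.
have [Bp|Bp] := pselect (B p).
  have [e0 e1] := nbhs_singleton (etaB n p Bp).
  by rewrite e0 !e1 ?(mulr0, mul0r, addr0).
have dd : d ord_max p = - d ord0 p by have := div0 Bp; lra.
rewrite dd; ring.
Qed.

(** Test the equation div a = 0 with eta n * phi, where eta n are cutoffs near B.  The
    error is the mean of phi * <a, grad (eta n)>.  By Young's inequality it is at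
    most dl^-1 times the energy of a on the support of grad (eta n), which tends
    to 0 with n, plus dl times the bounded Dirichlet energy of eta n, and dl is
    arbitrary. *)
Lemma weak_divergence : mean (fun p => a ord0 p * dphi ord0 p + a ord_max p * dphi ord_max p) = 0.
Proof.
have [eta [deta h]] := singular_cutoffs.
have E := mean_cutoff_product h.
case: h => -[eta_pc cdeta] eta_der eta01 [etaB eta_far] [C eC].
pose f p := a ord0 p * dphi ord0 p + a ord_max p * dphi ord_max p.
have cphi : continuous phi by exact: wave_continuous.
have cdphi i : continuous (dphi i).
  by move=> p; apply: cvgM; [exact: cvg_cst|exact: wave_continuous].
have ceta n : continuous (eta n) by have [] := eta_pc n.
have sa := summable_of_square.
have sf : summable f by apply: summableD; exact: summableM.
have fB p : B p -> f p = 0 by move=> Bp; rewrite /f !a_B// !mul0r addr0.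
have L1 : mean (fun p => f p * (1 - eta n p)) @[n --> \oo] --> (0 : R).
  apply: (@mean_dominated _ (fun p => `|f p|)).
  - move=> n; apply: summable_measurable; apply: summableM => // p.
    by apply: cvgB; [exact: cvg_cst|exact: ceta].
  - move=> n p _; rewrite normrM ler_piMr// ger0_norm; have := eta01 n p; lra.
  - exact: summable_norm.
  - move=> p _; have [Bp|/eta_far[N hN]] := pselect (B p).
      by exists 0%N => n _; rewrite fB// mul0r.
    by exists N => n /hN[-> _]; rewrite subrr mulr0.
pose U i n : set (R * R) := [set p | deta i n p != 0].
have mU i n : measurable (U i n : set (plane R)).
  apply: open_plane_measurable.
  have -> : U i n = deta i n @^-1` [set x | x != 0] by [].
  by apply: open_comp; [move=> p _; exact: cdeta|exact: open_neq].
have mUa i n : measurable_fun (square : set (plane R))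
    ((fun p => a i p * a i p * \1_(U i n) p) : _ -> measurableTypeR R).
  apply: measurable_funM; first exact: summable_measurable (a_sq i).
  by apply: measurable_indic; exact: mU.
have Ub i n p : `|a i p * a i p * \1_(U i n) p| <= a i p * a i p.
  rewrite normrM ger0_norm; last by rewrite -expr2 sqr_ge0.
  rewrite ler_piMr//; first by rewrite -expr2 sqr_ge0.
  by rewrite indicE; case: (_ \in _); rewrite /= ?normr1 ?normr0.
have sU i n : summable (fun p => a i p * a i p * \1_(U i n) p).
  by apply: (le_summable _ (fun p _ => Ub i n p)).
have L2 i : mean (fun p => a i p * a i p * \1_(U i n) p) @[n --> \oo] --> (0 : R).
  apply: (@mean_dominated _ (fun p => a i p * a i p)) => //.
  move=> p _; have [Bp|/eta_far[N hN]] := pselect (B p).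
    by exists 0%N => n _; rewrite a_B// !mul0r.
  exists N => n /hN[_ h]; rewrite indicE memNset ?mulr0// /U /= h eqxx.
  by [].
have main n (dl : R) : 0 < dl -> `|mean f| <= `|mean (fun p => f p * (1 - eta n p))| +
    (dl^-1 * mean (fun p => a ord0 p * a ord0 p * \1_(U ord0 n) p) + dl * C) +
    (dl^-1 * mean (fun p => a ord_max p * a ord_max p * \1_(U ord_max n) p) + dl * C).
  move=> dl0.
  pose w i p := phi p * (a i p * deta i n p).
  have sw i : summable (w i).
    rewrite (_ : w i = fun p => a i p * (deta i n p * phi p)).
      by apply: summableM => //; exact: continuous_mul.
    by apply/funext => p; rewrite /w; ring.
  have sfe : summable (fun p => f p * (1 - eta n p)).
    by apply: summableM => // p; apply: cvgB; [exact: cvg_cst|exact: ceta].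
  have E1 : mean f = mean (fun p => f p * (1 - eta n p)) - (mean (w ord0) + mean (w ord_max)).
    rewrite -[LHS]subr0 -(E n) -meanD// -!meanB//; last first.
    - by apply: summableD.
    - rewrite (_ : (fun p => _) = (fun p => f p * eta n p + (w ord0 p + w ord_max p))).
        by apply: summableD; [exact: summableM|exact: summableD].
      by apply/funext => p; rewrite /f/w; ring.
    by congr mean; apply/funext => p; rewrite /f/w; ring.
  have Wb i : `|mean (w i)| <= dl^-1 * mean (fun p => a i p * a i p * \1_(U i n) p) + dl * C.
    apply: le_trans (le_normr_mean (sw i)) _.
    have sd : summable (fun p => deta i n p * deta i n p) by apply: continuous_summable; exact: continuous_mul.
    apply: (@le_trans _ _ (mean (fun p => dl^-1 * (a i p * a i p * \1_(U i n) p) + dl * (deta i n p * deta i n p)))).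
      apply: le_mean; first exact: summable_norm.
        by apply: summableD; exact: summableZ.
      move=> p _; rewrite /w normrM.
      apply: (@le_trans _ _ `|a i p * deta i n p|).
        by rewrite ler_piMl// wave_norm.
      rewrite indicE; have [d0|d0] := eqVneq (deta i n p) 0.
        rewrite memNset /U/= ?d0 ?eqxx//.
        by rewrite !mulr0 normr0 addr0.
      rewrite mem_set// mulr1; exact: bounded_by_square_sum.
    rewrite meanD; [|exact: summableZ|exact: summableZ].
    rewrite !meanZ// lerD2l ler_wpM2l ?(ltW dl0)//.
  rewrite E1; apply: le_trans (ler_normB _ _) _; rewrite -addrA lerD2l.
  by apply: le_trans (ler_normD _ _) _; apply: lerD; exact: Wb.
have C0 : 0 <= C.
  by apply: le_trans (eC ord0 0%N); apply: Rintegral_ge0 => p _; rewrite -expr2 sqr_ge0.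
apply/eqP; rewrite -normr_le0; apply/ler_addgt0Pr => e e0; rewrite add0r.
pose dl := e / (8 * (C + 1)).
have dl0 : 0 < dl by rewrite divr_gt0// mulr_gt0//; lra.
have dlC : dl * C <= e / 8.
  rewrite /dl mulrAC ler_pdivrMr; last by rewrite mulr_gt0//; lra.
  nra.
have e4 : 0 < e / 8 by lra.
have e5 : 0 < dl * (e / 8) by rewrite mulr_gt0.
near \oo => n.
apply: le_trans (main n dl dl0) _.
have l1 : `|mean (fun p => f p * (1 - eta n p))| < e / 8.
  by near: n; apply: (cvgr0_norm_lt _ L1).
have l2 : mean (fun p => a ord0 p * a ord0 p * \1_(U ord0 n) p) < dl * (e / 8).
  by apply: le_lt_trans (ler_norm _) _; near: n; exact: (cvgr0_norm_lt _ (L2 ord0)).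
have l3 : mean (fun p => a ord_max p * a ord_max p * \1_(U ord_max n) p) < dl * (e / 8).
  by apply: le_lt_trans (ler_norm _) _; near: n; exact: (cvgr0_norm_lt _ (L2 ord_max)).
rewrite -(ltr_pdivrMl _ _ dl0) in l2; rewrite -(ltr_pdivrMl _ _ dl0) in l3.
lra.
Unshelve. all: by end_near.
Qed.

End RemovableSingularities.

(** * Coordinates of C^2 and Lagrangian frames *)
Section LinearDerivative.
Context {R : realType} {V W W' : normedModType R}.

Lemma is_derive_linear (l : {linear W -> W'}) (f : V -> W) p v a :
  continuous l -> is_derive p v f a -> is_derive p v (fun q => l (f q)) (l a).
Proof.
move=> cl [df fa].
have H : (fun h : R => h^-1 *: (((fun q => l (f q)) \o shift p) (h *: v) - l (f p))) @ 0^' --> l a.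
  rewrite (_ : (fun h : R => _) = l \o (fun h : R => h^-1 *: ((f \o shift p) (h *: v) - f p))); last first.
    by apply/funext => h /=; rewrite linearZ_LR [l (_ - _)]linearB.
  apply: continuous_cvg; first exact: cl.
  by rewrite -fa; exact: df.
apply: DeriveDef; first by apply/cvg_ex; exists (l a).
by apply/cvg_lim.
Qed.

End LinearDerivative.

Section Coordinates.
Context {R : realType}.
Implicit Types (X Y Z : C2 R).

(** The four real coordinates of C^2: the boolean tells the imaginary part from the
    real one. *)
Definition cc (i : 'I_2 * bool) X : R := (if i.2 then X.2 else X.1) ord0 i.1.

Lemma cc_is_linear i : linear (cc i : C2 R -> R).
Proof. by move=> a X Y; rewrite /cc; case: i => i []; rewrite /= !mxE. Qed.

HB.instance Definition _ i := GRing.isLinear.Build R (C2 R) R _ (cc i) (cc_is_linear i).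

Lemma cc_continuous i : continuous (cc i).
Proof.
move=> X; rewrite /cc; case: i => i [] /=.
  apply: (@continuous_comp _ _ _ (fun X : C2 R => X.2) (fun M : 'rV[R]_2 => M ord0 i)); first exact: cvg_snd.
  exact: coord_continuous.
apply: (@continuous_comp _ _ _ (fun X : C2 R => X.1) (fun M : 'rV[R]_2 => M ord0 i)); first exact: cvg_fst.
exact: coord_continuous.
Qed.

Definition c1 X := cc (ord0, false) X.
Definition c2 X := cc (ord_max, false) X.
Definition c3 X := cc (ord0, true) X.
Definition c4 X := cc (ord_max, true) X.

Lemma ord2_lift : lift ord0 ord0 = ord_max :> 'I_2.
Proof. exact: val_inj. Qed.

Lemma sum2 (f : 'I_2 -> R) : \sum_i f i = f ord0 + f ord_max.
Proof. by rewrite !big_ord_recl big_ord0 addr0 ord2_lift. Qed.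

Lemma C2_eq X Y : c1 X = c1 Y -> c2 X = c2 Y -> c3 X = c3 Y -> c4 X = c4 Y -> X = Y.
Proof.
have E (A B : 'rV[R]_2) : A ord0 ord0 = B ord0 ord0 -> A ord0 ord_max = B ord0 ord_max -> A = B.
  move=> h0 h1; apply/rowP => i.
  by case: (unliftP ord0 i) => [j ->|->//]; rewrite ord1 ord2_lift.
case: X Y => [X1 X2] [Y1 Y2]; rewrite /c1 /c2 /c3 /c4 /cc /= => *.
by congr pair; exact: E.
Qed.

Lemma gbarE X Y : gbar X Y = c1 X * c1 Y + c2 X * c2 Y + c3 X * c3 Y + c4 X * c4 Y.
Proof. by rewrite /gbar !sum2 addrA. Qed.

Lemma c1J X : c1 (Jstd X) = - c3 X. Proof. by rewrite /c1 /cc /= mxE. Qed.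
Lemma c2J X : c2 (Jstd X) = - c4 X. Proof. by rewrite /c2 /cc /= mxE. Qed.
Lemma c3J X : c3 (Jstd X) = c1 X. Proof. by []. Qed.
Lemma c4J X : c4 (Jstd X) = c2 X. Proof. by []. Qed.

Lemma omegaE X Y : omega X Y = c1 X * c3 Y + c2 X * c4 Y - c3 X * c1 Y - c4 X * c2 Y.
Proof. by rewrite /omega gbarE c1J c2J c3J c4J; ring. Qed.

Lemma c1D X Y : c1 (X + Y) = c1 X + c1 Y. Proof. by rewrite /c1 linearD. Qed.
Lemma c2D X Y : c2 (X + Y) = c2 X + c2 Y. Proof. by rewrite /c2 linearD. Qed.
Lemma c3D X Y : c3 (X + Y) = c3 X + c3 Y. Proof. by rewrite /c3 linearD. Qed.
Lemma c4D X Y : c4 (X + Y) = c4 X + c4 Y. Proof. by rewrite /c4 linearD. Qed.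
Lemma c1N X : c1 (- X) = - c1 X. Proof. by rewrite /c1 linearN. Qed.
Lemma c2N X : c2 (- X) = - c2 X. Proof. by rewrite /c2 linearN. Qed.
Lemma c3N X : c3 (- X) = - c3 X. Proof. by rewrite /c3 linearN. Qed.
Lemma c4N X : c4 (- X) = - c4 X. Proof. by rewrite /c4 linearN. Qed.
Lemma c1Z (a : R) X : c1 (a *: X) = a * c1 X. Proof. by rewrite /c1 linearZ. Qed.
Lemma c2Z (a : R) X : c2 (a *: X) = a * c2 X. Proof. by rewrite /c2 linearZ. Qed.
Lemma c3Z (a : R) X : c3 (a *: X) = a * c3 X. Proof. by rewrite /c3 linearZ. Qed.
Lemma c4Z (a : R) X : c4 (a *: X) = a * c4 X. Proof. by rewrite /c4 linearZ. Qed.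

(** Expands the coordinates of an expression, after which identities between vectors
    become polynomial identities. *)
Definition cE := (c1J, c2J, c3J, c4J, c1D, c2D, c3D, c4D, c1N, c2N, c3N, c4N, c1Z, c2Z, c3Z, c4Z).

(** The real part, and below the imaginary part, of the complex determinant of X, Y.  Its
    argument along a Lagrangian frame is the Lagrangian angle. *)
Definition detre X Y := c1 X * c2 Y - c3 X * c4 Y - c2 X * c1 Y + c4 X * c3 Y.
Definition detim X Y := c1 X * c4 Y + c3 X * c2 Y - c2 X * c3 Y - c4 X * c1 Y.

Lemma is_derive_cc i (f : R * R -> C2 R) (p v : R * R) (df : C2 R) :
  is_derive p v f df -> is_derive p v (fun q => cc i (f q)) (cc i df).
Proof.
move=> hf; apply: (@is_derive_linear R _ (C2 R) R (cc i) f p v df) => //.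
exact: cc_continuous.
Qed.

Lemma is_derive_ccM i j (f g : R * R -> C2 R) (p v : R * R) (df dg : C2 R) :
  is_derive p v f df -> is_derive p v g dg ->
  is_derive p v (fun q => cc i (f q) * cc j (g q)) (cc i df * cc j (g p) + cc i (f p) * cc j dg).
Proof. by move=> hf hg; exact: is_deriveMf (is_derive_cc i hf) (is_derive_cc j hg). Qed.

Lemma is_derive_gbar (f g : R * R -> C2 R) (p v : R * R) (df dg : C2 R) :
  is_derive p v f df -> is_derive p v g dg ->
  is_derive p v (fun q => gbar (f q) (g q)) (gbar df (g p) + gbar (f p) dg).
Proof.
move=> hf hg; have M i j := is_derive_ccM i j hf hg.
have H := is_deriveDf (is_deriveDf (is_deriveDf (M (ord0, false) (ord0, false)) (M (ord_max, false) (ord_max, false))) (M (ord0, true) (ord0, true))) (M (ord_max, true) (ord_max, true)).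
rewrite (_ : (fun q => gbar _ _) = fun q => c1 (f q) * c1 (g q) + c2 (f q) * c2 (g q) + c3 (f q) * c3 (g q) + c4 (f q) * c4 (g q)).
  by apply: (is_derive_val H); rewrite !gbarE /c1 /c2 /c3 /c4; ring.
by apply/funext => q; rewrite gbarE.
Qed.

Lemma is_derive_omega (f g : R * R -> C2 R) (p v : R * R) (df dg : C2 R) :
  is_derive p v f df -> is_derive p v g dg ->
  is_derive p v (fun q => omega (f q) (g q)) (omega df (g p) + omega (f p) dg).
Proof.
move=> hf hg; have M i j := is_derive_ccM i j hf hg.
have H := is_deriveBf (is_deriveBf (is_deriveDf (M (ord0, false) (ord0, true)) (M (ord_max, false) (ord_max, true))) (M (ord0, true) (ord0, false))) (M (ord_max, true) (ord_max, false)).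
rewrite (_ : (fun q => omega _ _) = fun q => c1 (f q) * c3 (g q) + c2 (f q) * c4 (g q) - c3 (f q) * c1 (g q) - c4 (f q) * c2 (g q)).
  by apply: (is_derive_val H); rewrite !omegaE /c1 /c2 /c3 /c4; ring.
by apply/funext => q; rewrite omegaE.
Qed.

Lemma is_derive_detre (f g : R * R -> C2 R) (p v : R * R) (df dg : C2 R) :
  is_derive p v f df -> is_derive p v g dg ->
  is_derive p v (fun q => detre (f q) (g q)) (detre df (g p) + detre (f p) dg).
Proof.
move=> hf hg; have M i j := is_derive_ccM i j hf hg.
have H := is_deriveDf (is_deriveBf (is_deriveBf (M (ord0, false) (ord_max, false)) (M (ord0, true) (ord_max, true))) (M (ord_max, false) (ord0, false))) (M (ord_max, true) (ord0, true)).
by apply: (is_derive_val H); rewrite /detre /c1 /c2 /c3 /c4; ring.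
Qed.

Lemma is_derive_detim (f g : R * R -> C2 R) (p v : R * R) (df dg : C2 R) :
  is_derive p v f df -> is_derive p v g dg ->
  is_derive p v (fun q => detim (f q) (g q)) (detim df (g p) + detim (f p) dg).
Proof.
move=> hf hg; have M i j := is_derive_ccM i j hf hg.
have H := is_deriveBf (is_deriveBf (is_deriveDf (M (ord0, false) (ord_max, true)) (M (ord0, true) (ord_max, false))) (M (ord_max, false) (ord0, true))) (M (ord_max, true) (ord0, false)).
by apply: (is_derive_val H); rewrite /detim /c1 /c2 /c3 /c4; ring.
Qed.

Lemma continuous_cc i (f : R * R -> C2 R) : continuous f -> continuous (fun q => cc i (f q)).
Proof. by move=> cf q; apply: (@continuous_comp _ _ _ f (cc i)); [exact: cf|exact: cc_continuous]. Qed.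

Lemma continuous_ccM i j (f g : R * R -> C2 R) : continuous f -> continuous g ->
  continuous (fun q => cc i (f q) * cc j (g q)).
Proof. by move=> cf cg; apply: continuous_mul; exact: continuous_cc. Qed.

Lemma continuous_gbar (f g : R * R -> C2 R) : continuous f -> continuous g ->
  continuous (fun q => gbar (f q) (g q)).
Proof.
move=> cf cg; have M i j := @continuous_ccM i j f g cf cg.
rewrite (_ : (fun q => gbar _ _) = fun q => c1 (f q) * c1 (g q) + c2 (f q) * c2 (g q) + c3 (f q) * c3 (g q) + c4 (f q) * c4 (g q)).
  by move=> q; repeat apply: cvgD; exact: M.
by apply/funext => q; rewrite gbarE.
Qed.

Lemma continuous_omega (f g : R * R -> C2 R) : continuous f -> continuous g ->
  continuous (fun q => omega (f q) (g q)).
Proof.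
move=> cf cg; have M i j := @continuous_ccM i j f g cf cg.
rewrite (_ : (fun q => omega _ _) = fun q => c1 (f q) * c3 (g q) + c2 (f q) * c4 (g q) - c3 (f q) * c1 (g q) - c4 (f q) * c2 (g q)).
  by move=> q; do 2 (apply: cvgB; last exact: M); apply: cvgD; exact: M.
by apply/funext => q; rewrite omegaE.
Qed.

Lemma continuous_detre (f g : R * R -> C2 R) : continuous f -> continuous g ->
  continuous (fun q => detre (f q) (g q)).
Proof.
move=> cf cg; have M i j := @continuous_ccM i j f g cf cg.
by move=> q; apply: cvgD; last exact: M; do 2 (apply: cvgB; last exact: M); exact: M.
Qed.

Lemma continuous_detim (f g : R * R -> C2 R) : continuous f -> continuous g ->
  continuous (fun q => detim (f q) (g q)).
Proof.
move=> cf cg; have M i j := @continuous_ccM i j f g cf cg.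
by move=> q; do 2 (apply: cvgB; last exact: M); apply: cvgD; exact: M.
Qed.

(** By hypothesis the Hermitian product of x and y is 0, and the Hermitian complement
    of the complex line of x = (x1 + i x3, x2 + i x4) is spanned by
    (- x2 + i x4, x1 - i x3); the coefficient of lam y on that vector is s + i t. *)
Lemma frame_coefficients (x1 x2 x3 x4 y1 y2 y3 y4 lam kap : R) :
  x1 * x1 + x2 * x2 + x3 * x3 + x4 * x4 = lam ->
  y1 * y1 + y2 * y2 + y3 * y3 + y4 * y4 = lam * kap ->
  x1 * y1 + x2 * y2 + x3 * y3 + x4 * y4 = 0 ->
  x1 * y3 + x2 * y4 - x3 * y1 - x4 * y2 = 0 -> lam != 0 ->
  exists s t, [/\ lam * y1 = - s * x2 - t * x4, lam * y2 = s * x1 + t * x3,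
    lam * y3 = s * x4 - t * x2, lam * y4 = - s * x3 + t * x1 & lam * lam * kap = s * s + t * t].
Proof.
move=> XX YY XY oXY l0.
pose s := - y1 * x2 + y2 * x1 + y3 * x4 - y4 * x3.
pose t := - y1 * x4 + y2 * x3 - y3 * x2 + y4 * x1.
have h1 : lam * y1 = - s * x2 - t * x4.
  transitivity (- s * x2 - t * x4 + (x1 * y1 + x2 * y2 + x3 * y3 + x4 * y4) * x1 + (x1 * y3 + x2 * y4 - x3 * y1 - x4 * y2) * - x3).
    by rewrite -XX /s /t; ring.
  by rewrite XY oXY !mul0r !addr0.
have h2 : lam * y2 = s * x1 + t * x3.
  transitivity (s * x1 + t * x3 + (x1 * y1 + x2 * y2 + x3 * y3 + x4 * y4) * x2 + (x1 * y3 + x2 * y4 - x3 * y1 - x4 * y2) * - x4).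
    by rewrite -XX /s /t; ring.
  by rewrite XY oXY !mul0r !addr0.
have h3 : lam * y3 = s * x4 - t * x2.
  transitivity (s * x4 - t * x2 + (x1 * y1 + x2 * y2 + x3 * y3 + x4 * y4) * x3 + (x1 * y3 + x2 * y4 - x3 * y1 - x4 * y2) * x1).
    by rewrite -XX /s /t; ring.
  by rewrite XY oXY !mul0r !addr0.
have h4 : lam * y4 = - s * x3 + t * x1.
  transitivity (- s * x3 + t * x1 + (x1 * y1 + x2 * y2 + x3 * y3 + x4 * y4) * x4 + (x1 * y3 + x2 * y4 - x3 * y1 - x4 * y2) * x2).
    by rewrite -XX /s /t; ring.
  by rewrite XY oXY !mul0r !addr0.
exists s, t; split => //; clearbody s t; apply: (mulfI l0).
transitivity ((lam * y1) * (lam * y1) + (lam * y2) * (lam * y2) + (lam * y3) * (lam * y3) + (lam * y4) * (lam * y4)).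
  by rewrite -[lam * lam * kap]mulrA -YY; ring.
by rewrite h1 h2 h3 h4 -XX; ring.
Qed.

(** X, Y, J X, J Y is an orthogonal basis of C^2 when X, Y is an orthogonal basis of a
    Lagrangian plane. *)
Lemma frame_expansion X Y Z (lam kap : R) : gbar X X = lam -> gbar Y Y = lam * kap ->
  gbar X Y = 0 -> omega X Y = 0 -> lam != 0 ->
  (lam * kap) *: Z = kap *: (gbar Z X *: X - omega Z X *: Jstd X) +
    (gbar Z Y *: Y - omega Z Y *: Jstd Y).
Proof.
move=> XX YY XY oXY l0; move: XX YY XY oXY; rewrite !gbarE !omegaE => XX YY XY oXY.
have [s [t [h1 h2 h3 h4 K]]] := frame_coefficients XX YY XY oXY l0.
apply: C2_eq; rewrite !cE;
move: (c1 X) (c2 X) (c3 X) (c4 X) (c1 Y) (c2 Y) (c3 Y) (c4 Y) (c1 Z) (c2 Z) (c3 Z) (c4 Z) XX YY XY oXY h1 h2 h3 h4 K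
  => x1 x2 x3 x4 y1 y2 y3 y4 z1 z2 z3 z4 XX YY XY oXY h1 h2 h3 h4 K;
apply: (mulfI l0); apply: (mulfI l0).
- transitivity (lam * lam * kap * (lam * z1)); first by ring.
  transitivity (lam * lam * kap * ((z1 * x1 + z2 * x2 + z3 * x3 + z4 * x4) * x1 - (z1 * x3 + z2 * x4 - z3 * x1 - z4 * x2) * - x3) +
    ((z1 * (lam * y1) + z2 * (lam * y2) + z3 * (lam * y3) + z4 * (lam * y4)) * (lam * y1) - (z1 * (lam * y3) + z2 * (lam * y4) - z3 * (lam * y1) - z4 * (lam * y2)) * - (lam * y3))); last by ring.
  rewrite h1 h2 h3 h4 K -XX; ring.
- transitivity (lam * lam * kap * (lam * z2)); first by ring.
  transitivity (lam * lam * kap * ((z1 * x1 + z2 * x2 + z3 * x3 + z4 * x4) * x2 - (z1 * x3 + z2 * x4 - z3 * x1 - z4 * x2) * - x4) +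
    ((z1 * (lam * y1) + z2 * (lam * y2) + z3 * (lam * y3) + z4 * (lam * y4)) * (lam * y2) - (z1 * (lam * y3) + z2 * (lam * y4) - z3 * (lam * y1) - z4 * (lam * y2)) * - (lam * y4))); last by ring.
  rewrite h1 h2 h3 h4 K -XX; ring.
- transitivity (lam * lam * kap * (lam * z3)); first by ring.
  transitivity (lam * lam * kap * ((z1 * x1 + z2 * x2 + z3 * x3 + z4 * x4) * x3 - (z1 * x3 + z2 * x4 - z3 * x1 - z4 * x2) * x1) +
    ((z1 * (lam * y1) + z2 * (lam * y2) + z3 * (lam * y3) + z4 * (lam * y4)) * (lam * y3) - (z1 * (lam * y3) + z2 * (lam * y4) - z3 * (lam * y1) - z4 * (lam * y2)) * (lam * y1))); last by ring.
  rewrite h1 h2 h3 h4 K -XX; ring.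
- transitivity (lam * lam * kap * (lam * z4)); first by ring.
  transitivity (lam * lam * kap * ((z1 * x1 + z2 * x2 + z3 * x3 + z4 * x4) * x4 - (z1 * x3 + z2 * x4 - z3 * x1 - z4 * x2) * x2) +
    ((z1 * (lam * y1) + z2 * (lam * y2) + z3 * (lam * y3) + z4 * (lam * y4)) * (lam * y4) - (z1 * (lam * y3) + z2 * (lam * y4) - z3 * (lam * y1) - z4 * (lam * y2)) * (lam * y2))); last by ring.
  rewrite h1 h2 h3 h4 K -XX; ring.
Qed.

(** Bessel's inequality for the orthogonal vectors J X and J Y. *)
Lemma frame_bessel X Y H (lam kap : R) : gbar X X = lam -> gbar Y Y = lam * kap ->
  gbar X Y = 0 -> omega X Y = 0 -> 0 < lam -> 0 < kap ->
  kap * omega H X ^+ 2 + omega H Y ^+ 2 <= kap * lam * gbar H H.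
Proof.
move=> XX YY XY oXY l0 k0.
have : 0 <= gbar (lam * kap *: H + kap * omega H X *: Jstd X + omega H Y *: Jstd Y)
                 (lam * kap *: H + kap * omega H X *: Jstd X + omega H Y *: Jstd Y).
  by rewrite gbarE !addr_ge0// -expr2 sqr_ge0.
have -> : gbar (lam * kap *: H + kap * omega H X *: Jstd X + omega H Y *: Jstd Y)
                 (lam * kap *: H + kap * omega H X *: Jstd X + omega H Y *: Jstd Y) =
   (lam * kap) ^+ 2 * gbar H H - 2 * (lam * kap) * (kap * omega H X ^+ 2 + omega H Y ^+ 2) +
   kap ^+ 2 * omega H X ^+ 2 * gbar X X + omega H Y ^+ 2 * gbar Y Y + 2 * kap * omega H X * omega H Y * gbar X Y.
  rewrite gbarE !cE !gbarE !omegaE; ring.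
rewrite XX YY XY => h.
have lk : 0 < lam * kap by rewrite mulr_gt0.
rewrite -(ler_pM2l lk); nra.
Qed.

(** With F1, F2 the first derivatives of a map and F1l, F2l their derivatives in a
    direction l, the left-hand side is |det|^2 times the derivative of the
    Lagrangian angle, and the right-hand side is the trace of the second
    fundamental form paired with omega, up to the symmetry of the latter.  This
    is the relation between mean curvature and Lagrangian angle. *)
Lemma angle_identity F1 F2 F1l F2l (g11 g12 g22 : R) :
  gbar F1 F1 = g11 -> gbar F1 F2 = g12 -> gbar F2 F2 = g22 -> omega F1 F2 = 0 ->
  detre F1 F2 * (detim F1l F2 + detim F1 F2l) - detim F1 F2 * (detre F1l F2 + detre F1 F2l) =
  - (g22 * omega F1l F1 - g12 * omega F1l F2 + g11 * omega F2l F2 - g12 * omega F2l F1).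
Proof.
move=> <- <- <-; rewrite !gbarE !omegaE /detre /detim => o.
move: (c1 F1) (c2 F1) (c3 F1) (c4 F1) (c1 F2) (c2 F2) (c3 F2) (c4 F2) o => x1 x2 x3 x4 y1 y2 y3 y4 o.
move: (c1 F1l) (c2 F1l) (c3 F1l) (c4 F1l) (c1 F2l) (c2 F2l) (c3 F2l) (c4 F2l) => a1 a2 a3 a4 b1 b2 b3 b4.
apply/eqP; rewrite -subr_eq0; apply/eqP.
(* both sides differ by this multiple of omega F1 F2 *)
rewrite -[RHS](mulr0 (b1 * x1 + b2 * x2 + b3 * x3 + b4 * x4 - (a1 * y1 + a2 * y2 + a3 * y3 + a4 * y4))) -o.
ring.
Qed.

(** For a Lagrangian frame the Hermitian Gram matrix is real, so that |det|^2 is the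
    Gram determinant. *)
Lemma angle_norm F1 F2 (g11 g12 g22 : R) :
  gbar F1 F1 = g11 -> gbar F1 F2 = g12 -> gbar F2 F2 = g22 -> omega F1 F2 = 0 ->
  detre F1 F2 * detre F1 F2 + detim F1 F2 * detim F1 F2 = g11 * g22 - g12 * g12.
Proof.
move=> <- <- <-; rewrite !gbarE !omegaE /detre /detim => o.
move: (c1 F1) (c2 F1) (c3 F1) (c4 F1) (c1 F2) (c2 F2) (c3 F2) (c4 F2) o => x1 x2 x3 x4 y1 y2 y3 y4 o.
apply/eqP; rewrite -subr_eq0; apply/eqP.
transitivity (- ((x1 * y3 + x2 * y4 - x3 * y1 - x4 * y2) * (x1 * y3 + x2 * y4 - x3 * y1 - x4 * y2))); first by ring.
by rewrite o mulr0 oppr0.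
Qed.

End Coordinates.

(** * The mean curvature form in a model metric *)
Section Measurability.
Context {R : realType}.

Lemma measurable_inv : measurable_fun [set: measurableTypeR R] ((fun x : R => x^-1) : _ -> measurableTypeR R).
Proof.
have m0 : measurable ([set 0] : set (measurableTypeR R)) by exact: measurable_set1.
have -> : [set: measurableTypeR R] = [set x | x != 0] `|` [set 0].
  by apply/seteqP; split=> x _ //=; have [->|x0] := eqVneq x 0; [right|left].
apply/measurable_funU => //.
  by apply: measurable_realfun.open_measurable; exact: open_neq.
split.
  apply: open_continuous_measurable_fun; first exact: open_neq.
  by move=> x; rewrite inE => x0; exact: inv_continuous.
by move=> _ Y mY; have [h|h] := pselect (Y (0^-1));
  [rewrite (_ : _ `&` _ = [set 0])//|rewrite (_ : _ `&` _ = set0)//];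
  apply/seteqP; split=> x // [->].
Qed.

(** The integral of a nonnegative function is defined as a supremum over the simple
    functions below it, so it is monotone on arbitrary functions.  The Willmore
    density is compared in this way with a measurable one. *)
Lemma ge0_le_integral_lower d (T : measurableType d) (mu : {measure set T -> \bar R})
    (D : set T) (f g : T -> \bar R) :
  (forall x, D x -> 0 <= f x)%E -> (forall x, D x -> f x <= g x)%E ->
  (\int[mu]_(x in D) f x <= \int[mu]_(x in D) g x)%E.
Proof.
move=> f0 fg; have g0 x : D x -> (0 <= g x)%E by move=> Dx; exact: le_trans (f0 x Dx) (fg x Dx).
rewrite !ge0_integralE//; apply: le_ereal_sup => _ [h /= hf <-]; exists h => // x.
apply: le_trans (hf x) _; rewrite /patch; case: ifP => // xD.
by apply: fg; exact: set_mem.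
Qed.

End Measurability.

Section TwoByTwo.
Context {R : realType}.
Implicit Types (M N : 'M[R]_2).

Lemma mx2P M N : M ord0 ord0 = N ord0 ord0 -> M ord0 ord_max = N ord0 ord_max ->
  M ord_max ord0 = N ord_max ord0 -> M ord_max ord_max = N ord_max ord_max -> M = N.
Proof.
move=> a b c d; apply/matrixP => i j.
have E (k : 'I_2) : k = ord0 \/ k = ord_max.
  by case: (unliftP ord0 k) => [l ->|->]; [right; rewrite ord1 ord2_lift|left].
by case: (E i) => ->; case: (E j) => ->.
Qed.

Lemma invmx_right M N : M *m N = 1%:M -> invmx M = N.
Proof.
move=> MN; have [uM _] := mulmx1_unit MN.
by rewrite -[LHS]mulmx1 -MN mulmxA mulVmx// mul1mx.
Qed.

Definition model t1 t2 : 'M[R]_2 := (frame_mx t1 t2)^T *m frame_mx t1 t2.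

Lemma frame_mxE t1 t2 : [/\ frame_mx t1 t2 ord0 ord0 = 1 :> R, frame_mx t1 t2 ord0 ord_max = t1 :> R,
  frame_mx t1 t2 ord_max ord0 = 0 :> R & frame_mx t1 t2 ord_max ord_max = t2 :> R].
Proof.
have E (i j : 'I_2) (i' j' : 'I_(1 + 1)) : i = i' :> nat -> j = j' :> nat ->
    frame_mx t1 t2 i j = block_mx (1%:M : 'M[R]_1) (t1%:M : 'M[R]_1) 0 (t2%:M : 'M[R]_1) i' j'.
  by move=> ii jj; congr (fun_of_matrix _ _ _); exact: val_inj.
split.
- by rewrite (E _ _ (lshift 1 ord0) (lshift 1 ord0))// block_mxEul mxE eqxx.
- by rewrite (E _ _ (lshift 1 ord0) (rshift 1 ord0))// block_mxEur mxE eqxx.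
- by rewrite (E _ _ (rshift 1 ord0) (lshift 1 ord0))// block_mxEdl mxE.
- by rewrite (E _ _ (rshift 1 ord0) (rshift 1 ord0))// block_mxEdr mxE eqxx.
Qed.

Lemma modelE t1 t2 : [/\ model t1 t2 ord0 ord0 = 1, model t1 t2 ord0 ord_max = t1,
  model t1 t2 ord_max ord0 = t1 & model t1 t2 ord_max ord_max = t1 ^+ 2 + t2 ^+ 2].
Proof.
have [a b c d] := frame_mxE t1 t2.
by split; rewrite /model mxE sum2 ![_^T _ _]mxE ?(a, b, c, d); ring.
Qed.

Definition model_inv t1 t2 : 'M[R]_2 := \matrix_(i, j)
  (t2 ^- 2 * (if i == ord0 then (if j == ord0 then t1 ^+ 2 + t2 ^+ 2 else - t1)
             else (if j == ord0 then - t1 else 1))).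

Lemma model_invE t1 t2 : [/\ model_inv t1 t2 ord0 ord0 = t2 ^- 2 * (t1 ^+ 2 + t2 ^+ 2),
  model_inv t1 t2 ord0 ord_max = t2 ^- 2 * - t1, model_inv t1 t2 ord_max ord0 = t2 ^- 2 * - t1
  & model_inv t1 t2 ord_max ord_max = t2 ^- 2].
Proof. by rewrite /model_inv !mxE /= mulr1. Qed.

Lemma model_mulV t1 t2 : t2 != 0 -> model t1 t2 *m model_inv t1 t2 = 1%:M.
Proof.
move=> t20; have [a b c d] := modelE t1 t2; have [a' b' c' d'] := model_invE t1 t2.
by apply: mx2P; rewrite !mxE !sum2 ?(a, b, c, d, a', b', c', d') /=; field.
Qed.

Lemma invmx_scale_model t1 t2 (lam : R) : t2 != 0 ->
  invmx (lam *: model t1 t2) = lam^-1 *: model_inv t1 t2.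
Proof.
move=> t20; have [->|l0] := eqVneq lam 0.
  by rewrite scale0r invr0 scale0r /invmx unitmxE det0 unitr0.
apply: invmx_right; rewrite -scalemxAl -scalemxAr scalerA divff// scale1r.
exact: model_mulV.
Qed.

Lemma det_model t1 t2 : \det (model t1 t2) = t2 ^+ 2.
Proof.
rewrite /model det_mulmx det_tr -expr2; congr (_ ^+ 2).
rewrite /frame_mx (det_ublock (1%:M : 'M[R]_1) (t1%:M : 'M[R]_1) (t2%:M : 'M[R]_1)).
by rewrite det1 mul1r det_mx11 mxE eqxx.
Qed.

End TwoByTwo.

Section SmoothCoordinates.
Context {R : realType}.

Lemma partials_cc k s (F : R * R -> C2 R) : smooth F ->
  partials s (fun q => cc k (F q) : R) = (fun q => cc k (partials s F q)).
Proof.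
move=> sF; elim: s => //= i s ->; apply/funext => p.
by rewrite /partial; have [] := is_derive_cc k (smooth_is_derive i p (smooth_partials s sF)).
Qed.

Lemma smooth_cc k (F : R * R -> C2 R) : smooth F -> smooth (fun q => cc k (F q) : R).
Proof.
move=> sF s; rewrite partials_cc//; split=> [|i p].
  exact: continuous_cc (smooth_continuous (smooth_partials s sF)).
by have [] := is_derive_cc k (smooth_is_derive i p (smooth_partials s sF)).
Qed.

Lemma partialCV i j (F : R * R -> C2 R) : periodic F -> smooth F ->
  partial i (partial j F) = partial j (partial i F).
Proof.
move=> pF sF; apply/funext => p.
have E k : cc k (partial i (partial j F) p) = cc k (partial j (partial i F) p).
  have sk := smooth_cc k sF.
  have pk : periodic (fun q => cc k (F q) : R) by move=> q; have [-> ->] := pF q.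
  have := partialC i j pk sk => /(congr1 (fun f => f p)).
  have P l m : partial l (partial m (fun q => cc k (F q) : R)) = (fun q => cc k (partial l (partial m F) q)).
    exact: (partials_cc k [:: l; m] sF).
  by rewrite !P.
by apply: C2_eq; exact: E.
Qed.

End SmoothCoordinates.

Section MeanCurvatureAlgebra.
Context {R : realType}.
Implicit Types (M : 'M[R]_2) (X : 'I_2 -> C2 R) (Y : 'I_2 -> 'I_2 -> C2 R) (v : C2 R).

Definition npart M X v : C2 R := v - \sum_k \sum_l (M k l * gbar v (X k)) *: X l.

Definition mcurv M X Y : C2 R := \sum_i \sum_j M i j *: npart M X (Y i j).

(** t2 ^ 2 times the Laplacian of the model metric. *)
Definition conj_laplacian (t1 t2 : R) Y : C2 R :=
  (t1 ^+ 2 + t2 ^+ 2) *: Y ord0 ord0 - (2 * t1) *: Y ord0 ord_max + Y ord_max ord_max.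

Lemma gbarC (v w : C2 R) : gbar v w = gbar w v.
Proof. by rewrite !gbarE; ring. Qed.

Lemma omegaC (v w : C2 R) : omega v w = - omega w v.
Proof. by rewrite !omegaE; ring. Qed.

Lemma gbar_linl (a b : R) (X Y Z U : C2 R) : gbar (a *: X - b *: Y + Z) U = a * gbar X U - b * gbar Y U + gbar Z U.
Proof. by rewrite !gbarE !cE; ring. Qed.

Lemma omega_linl (a b : R) (X Y Z U : C2 R) : omega (a *: X - b *: Y + Z) U = a * omega X U - b * omega Y U + omega Z U.
Proof. by rewrite !omegaE !cE; ring. Qed.

Lemma mcurvE M X Y : mcurv M X Y =
  M ord0 ord0 *: npart M X (Y ord0 ord0) + M ord0 ord_max *: npart M X (Y ord0 ord_max) +
  (M ord_max ord0 *: npart M X (Y ord_max ord0) + M ord_max ord_max *: npart M X (Y ord_max ord_max)).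
Proof. by rewrite /mcurv !big_ord_recl !big_ord0 !addr0 ord2_lift. Qed.

Lemma npartE M X v : npart M X v = v -
  ((M ord0 ord0 * gbar v (X ord0)) *: X ord0 + (M ord0 ord_max * gbar v (X ord0)) *: X ord_max +
  ((M ord_max ord0 * gbar v (X ord_max)) *: X ord0 + (M ord_max ord_max * gbar v (X ord_max)) *: X ord_max)).
Proof. by rewrite /npart !big_ord_recl !big_ord0 !addr0 ord2_lift. Qed.

Lemma ord2P (i : 'I_2) : i = ord0 \/ i = ord_max.
Proof. by case: (unliftP ord0 i) => [l ->|->]; [right; rewrite ord1 ord2_lift|left]. Qed.

(** J maps tangent vectors of a Lagrangian plane to normal ones, so omega does not see
    the tangent part of v. *)
Lemma omega_npart M X v l : omega (X ord0) (X ord_max) = 0 -> omega (npart M X v) (X l) = omega v (X l).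
Proof.
move=> o; have z k : omega (X k) (X l) = 0.
  have z0 w : omega w w = 0 by rewrite omegaE; ring.
  by case: (ord2P k) => ->; case: (ord2P l) => ->; rewrite ?z0//; rewrite omegaC o oppr0.
rewrite npartE; move: (_ * gbar _ _) (_ * gbar _ _) (_ * gbar _ _) (_ * gbar _ _) => a b c d.
transitivity (omega v (X l) - (d + b) * omega (X ord0) (X l) - (c + a) * omega (X ord_max) (X l)).
  by rewrite !omegaE !cE; ring.
by rewrite !z !mulr0 !subr0.
Qed.

Lemma omega_mcurv (t1 t2 lam : R) X Y l : omega (X ord0) (X ord_max) = 0 ->
  Y ord_max ord0 = Y ord0 ord_max ->
  omega (mcurv (lam^-1 *: model_inv t1 t2) X Y) (X l) = omega (conj_laplacian t1 t2 Y) (X l) * lam^-1 * t2 ^- 2.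
Proof.
move=> o YC; have [e00 e01 e10 e11] := model_invE t1 t2.
set M := _ *: _; rewrite mcurvE.
have -> (a b c d : R) (U V W Z w : C2 R) : omega (a *: U + b *: V + (c *: W + d *: Z)) w =
    a * omega U w + b * omega V w + (c * omega W w + d * omega Z w).
  by rewrite !omegaE !cE; ring.
rewrite !omega_npart// /conj_laplacian omega_linl YC.
have EM i j : M i j = lam^-1 * model_inv t1 t2 i j by rewrite /M mxE.
by rewrite !EM e00 e01 e10 e11; ring.
Qed.

End MeanCurvatureAlgebra.

(** The complement of a finite set is dense. *)
Lemma vanish_off_finite {R : realType} (lam f : R * R -> R) : finite_set ([set p | lam p = 0] `&` square) ->
  periodic f -> continuous f -> (forall p, lam p != 0 -> f p = 0) -> forall p, f p = 0.
Proof.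
move=> finB pf cf f0; apply: periodic_vanish => // q q1 q2.
apply: contrapT => /eqP fq.
set S := (_ `&` _) in finB.
have finS : finite_set (S `\ q) by exact: finite_setD.
have cS : closed (S `\ q).
  by apply: (@accessible_finite_set_closed (R * R)%type).1 => //; apply: hausdorff_accessible; exact: norm_hausdorff.
have N1 : \forall p \near q, ~ (S `\ q) p.
  by apply: (open_nbhs_nbhs (conj (closed_openC cS) _)) => -[_ /=]; exact.
have N2 : \forall p \near q, f p != 0.
  apply: (@open_comp _ _ f [set x | x != 0] _ (@open_neq _ _)) => //.
have /nbhs_ballP[e /= e0 N3] : \forall p \near q, ~ (S `\ q) p /\ f p != 0 by exact: filterI.
pose d := Num.min (e / 2) ((1 - q.1) / 2).
have [d0 de dq] : [/\ 0 < d, d < e & d < 1 - q.1].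
  by split; rewrite /d ?lt_min ?gt_min; lra.
have [] : ~ (S `\ q) (q.1 + d, q.2) /\ f (q.1 + d, q.2) != 0.
  apply: N3; split; rewrite /ball /=.
    by rewrite opprD addNKr normrN gtr0_norm.
  by rewrite subrr normr0.
move=> nS fn; apply: nS; split; last by move=> /= E; have := congr1 fst E => /=; lra.
split; last by split; rewrite /= in_itv/=; lra.
by apply: contrapT => /eqP /f0 E; rewrite E eqxx in fn.
Qed.

Section ModelImmersion.
Context {R : realType}.
(* Fd, Fdd and Fddd are the first three derivatives of the map. *)
Variables (t1 t2 : R) (Fd : 'I_2 -> R * R -> C2 R) (Fdd : 'I_2 -> 'I_2 -> R * R -> C2 R)
  (Fddd : 'I_2 -> 'I_2 -> 'I_2 -> R * R -> C2 R).
Let lam p := gbar (Fd ord0 p) (Fd ord0 p).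
Let tt := t1 ^+ 2 + t2 ^+ 2.
Let Q p : C2 R := conj_laplacian t1 t2 (fun i j => Fdd i j p).

Hypotheses (t20 : 0 < t2)
  (pFd : forall i, periodic (Fd i)) (pFdd : forall i j, periodic (Fdd i j))
  (cFd : forall i, continuous (Fd i)) (cFdd : forall i j, continuous (Fdd i j))
  (cFddd : forall k i j, continuous (Fddd k i j))
  (dFd : forall j i p, is_derive p (stdbasis j) (Fd i) (Fdd j i p))
  (dFdd : forall k j i p, is_derive p (stdbasis k) (Fdd j i) (Fddd k j i p))
  (FddC : forall i j p, Fdd i j p = Fdd j i p)
  (FdddC : forall i j k p, Fddd i j k p = Fddd j i k p)
  (g01 : forall p, gbar (Fd ord0 p) (Fd ord_max p) = lam p * t1)
  (g11 : forall p, gbar (Fd ord_max p) (Fd ord_max p) = lam p * tt)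
  (lag01 : forall p, omega (Fd ord0 p) (Fd ord_max p) = 0)
  (finF : finite_set ([set p | lam p = 0] `&` square)).

Let t2n0 : t2 != 0. Proof. by rewrite gt_eqF. Qed.

Lemma is_derive_uniq (f : R * R -> R) (p v : R * R) a b : is_derive p v f a -> is_derive p v f b -> a = b.
Proof. by move=> [_ <-] [_ <-]. Qed.

Lemma is_derive_lam i p : is_derive p (stdbasis i) lam (2 * gbar (Fdd i ord0 p) (Fd ord0 p)).
Proof.
apply: (is_derive_val (is_derive_gbar (dFd i ord0 p) (dFd i ord0 p))).
by rewrite (gbarC (Fd ord0 p) (Fdd i ord0 p)); ring.
Qed.

Lemma derive_g01 i p : gbar (Fdd i ord0 p) (Fd ord_max p) + gbar (Fdd i ord_max p) (Fd ord0 p) =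
  2 * t1 * gbar (Fdd i ord0 p) (Fd ord0 p).
Proof.
have h := is_derive_gbar (dFd i ord0 p) (dFd i ord_max p).
have : is_derive p (stdbasis i) (fun q => gbar (Fd ord0 q) (Fd ord_max q)) (t1 * (2 * gbar (Fdd i ord0 p) (Fd ord0 p))).
  apply: (@is_derive_ext _ _ _ (fun q => t1 * lam q)); last exact: is_deriveZf (is_derive_lam i p).
  by move=> q; rewrite g01 mulrC.
by move=> /(is_derive_uniq h); rewrite (gbarC (Fd ord0 p) (Fdd i ord_max p)) => ->; ring.
Qed.

Lemma derive_g11 i p : gbar (Fdd i ord_max p) (Fd ord_max p) = tt * gbar (Fdd i ord0 p) (Fd ord0 p).
Proof.
have h := is_derive_gbar (dFd i ord_max p) (dFd i ord_max p).
have : is_derive p (stdbasis i) (fun q => gbar (Fd ord_max q) (Fd ord_max q)) (tt * (2 * gbar (Fdd i ord0 p) (Fd ord0 p))).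
  apply: (@is_derive_ext _ _ _ (fun q => tt * lam q)); last exact: is_deriveZf (is_derive_lam i p).
  by move=> q; rewrite g11 mulrC.
move=> /(is_derive_uniq h); rewrite (gbarC (Fd ord_max p) (Fdd i ord_max p)).
by move: (gbar _ _) (gbar _ _) => a b; lra.
Qed.

Lemma derive_lag01 i p : omega (Fdd i ord0 p) (Fd ord_max p) = omega (Fdd i ord_max p) (Fd ord0 p).
Proof.
have h := is_derive_omega (dFd i ord0 p) (dFd i ord_max p).
have : is_derive p (stdbasis i) (fun q => omega (Fd ord0 q) (Fd ord_max q)) 0.
  apply: (@is_derive_ext _ _ _ (fun q => 0)).
  by move=> q; rewrite lag01.
move=> /(is_derive_uniq h); rewrite (omegaC (Fd ord0 p) (Fdd i ord_max p)).
by move: (omega _ _) (omega _ _) => a b; lra.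
Qed.

(** The Laplacian of a conformal map is normal: differentiate the conformality
    relations. *)
Lemma Q_normal i p : gbar (Q p) (Fd i p) = 0.
Proof.
have a0 := derive_g01 ord0 p; have a1 := derive_g01 ord_max p.
have b0 := derive_g11 ord0 p; have b1 := derive_g11 ord_max p.
rewrite (FddC ord_max ord0) in a1 b1.
have := ord2P i; case => ->; rewrite /Q /conj_laplacian gbar_linl -/tt.
  move: a0 a1 b0 b1.
  move: (gbar (Fdd ord0 ord0 p) (Fd ord0 p)) (gbar (Fdd ord0 ord0 p) (Fd ord_max p)).
  move: (gbar (Fdd ord0 ord_max p) (Fd ord0 p)) (gbar (Fdd ord0 ord_max p) (Fd ord_max p)).
  move: (gbar (Fdd ord_max ord_max p) (Fd ord0 p)) (gbar (Fdd ord_max ord_max p) (Fd ord_max p)).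
  by move=> a b c d e f a0 a1 b0 b1; lra.
move: a0 a1 b0 b1.
move: (gbar (Fdd ord0 ord0 p) (Fd ord0 p)) (gbar (Fdd ord0 ord0 p) (Fd ord_max p)).
move: (gbar (Fdd ord0 ord_max p) (Fd ord0 p)) (gbar (Fdd ord0 ord_max p) (Fd ord_max p)).
move: (gbar (Fdd ord_max ord_max p) (Fd ord0 p)) (gbar (Fdd ord_max ord_max p) (Fd ord_max p)).
move=> a b c d e f a0 a1 b0 b1.
rewrite (_ : f = 2 * t1 * e - c); last by lra.
by rewrite b1 b0; ring.
Qed.

(** The mean curvature form.  At branch points it is 0, because the inverse of 0 is. *)
Definition alpha l p : R := omega (Q p) (Fd l p) * (lam p)^-1 * t2 ^- 2.

Let ur p := detre (Fd ord0 p) (Fd ord_max p).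
Let ui p := detim (Fd ord0 p) (Fd ord_max p).
Let urd i p := detre (Fdd i ord0 p) (Fd ord_max p) + detre (Fd ord0 p) (Fdd i ord_max p).
Let uid i p := detim (Fdd i ord0 p) (Fd ord_max p) + detim (Fd ord0 p) (Fdd i ord_max p).
Let urdd i j p := detre (Fddd i j ord0 p) (Fd ord_max p) + detre (Fdd j ord0 p) (Fdd i ord_max p) +
   (detre (Fdd i ord0 p) (Fdd j ord_max p) + detre (Fd ord0 p) (Fddd i j ord_max p)).
Let uidd i j p := detim (Fddd i j ord0 p) (Fd ord_max p) + detim (Fdd j ord0 p) (Fdd i ord_max p) +
   (detim (Fdd i ord0 p) (Fdd j ord_max p) + detim (Fd ord0 p) (Fddd i j ord_max p)).

Lemma is_derive_ur i p : is_derive p (stdbasis i) ur (urd i p).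
Proof. exact: is_derive_detre (dFd _ _ _) (dFd _ _ _). Qed.
Lemma is_derive_ui i p : is_derive p (stdbasis i) ui (uid i p).
Proof. exact: is_derive_detim (dFd _ _ _) (dFd _ _ _). Qed.
Lemma is_derive_urd i j p : is_derive p (stdbasis i) (urd j) (urdd i j p).
Proof. exact: is_deriveDf (is_derive_detre (dFdd _ _ _ _) (dFd _ _ _)) (is_derive_detre (dFd _ _ _) (dFdd _ _ _ _)). Qed.
Lemma is_derive_uid i j p : is_derive p (stdbasis i) (uid j) (uidd i j p).
Proof. exact: is_deriveDf (is_derive_detim (dFdd _ _ _ _) (dFd _ _ _)) (is_derive_detim (dFd _ _ _) (dFdd _ _ _ _)). Qed.

Lemma urddC i j p : urdd i j p = urdd j i p.
Proof. by rewrite /urdd (FdddC i j ord0) (FdddC i j ord_max); ring. Qed.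
Lemma uiddC i j p : uidd i j p = uidd j i p.
Proof. by rewrite /uidd (FdddC i j ord0) (FdddC i j ord_max); ring. Qed.

(** The mean curvature form is minus the differential of the argument of ur + i ui.  For this
    the derivatives of omega (F_0, F_1) = 0 are used to symmetrise the second
    fundamental form. *)
Lemma angle_formula l p : lam p * omega (Q p) (Fd l p) = - (ur p * uid l p - ui p * urd l p).
Proof.
rewrite /ur /uid /ui /urd (angle_identity _ _ (erefl (lam p)) (g01 p) (g11 p) (lag01 p)) opprK.
have d0 := derive_lag01 ord0 p; have d1 := derive_lag01 ord_max p.
rewrite (FddC ord_max ord0) in d1.
rewrite /Q /conj_laplacian omega_linl -/tt; have := ord2P l; case => ->.
  by rewrite d0 d1; ring.
by rewrite !(FddC ord_max ord0) d0 -d1; ring.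
Qed.

Lemma angle_square p : ur p * ur p + ui p * ui p = (lam p * t2) ^+ 2.
Proof.
rewrite /ur /ui (angle_norm (erefl (lam p)) (g01 p) (g11 p) (lag01 p)) /tt; ring.
Qed.

Let W l p := - (ur p * uid l p - ui p * urd l p) / (ur p * ur p + ui p * ui p).

Lemma alpha_angle l p : lam p != 0 -> alpha l p = W l p.
Proof.
move=> l0; rewrite /W -angle_formula angle_square /alpha.
by move: (omega _ _) => m; move: (lam p) l0 => a a0; field; rewrite a0 t2n0.
Qed.

Let dW i l p := (- (urd i p * uid l p + ur p * uidd i l p - (uid i p * urd l p + ui p * urdd i l p))
     * (ur p * ur p + ui p * ui p)
   + (ur p * uid l p - ui p * urd l p) * (2 * (ur p * urd i p + ui p * uid i p))) /
   (ur p * ur p + ui p * ui p) ^+ 2.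

Lemma is_derive_W i l p : ur p * ur p + ui p * ui p != 0 -> is_derive p (stdbasis i) (W l) (dW i l p).
Proof.
move=> N0.
have n1 := is_deriveBf (is_deriveMf (is_derive_ur i p) (is_derive_uid i l p)) (is_deriveMf (is_derive_ui i p) (is_derive_urd i l p)).
have n2 := is_deriveDf (is_deriveMf (is_derive_ur i p) (is_derive_ur i p)) (is_deriveMf (is_derive_ui i p) (is_derive_ui i p)).
have n3 := is_deriveVf (f := fun q => ur q * ur q + ui q * ui q) N0 n2.
have n4 := is_deriveZf (-1) (is_deriveMf n1 n3).
apply: (@is_derive_ext _ _ _ (fun q => (-1) * ((ur q * uid l q - ui q * urd l q) / (ur q * ur q + ui q * ui q)))).
  by move=> q; rewrite /W !mulNr mul1r.
apply: (is_derive_val n4); rewrite /dW; move: N0.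
move: (ur p) (ui p) (urd i p) (uid i p) (urd l p) (uid l p) (urdd i l p) (uidd i l p) => a b c d e f g h N0.
by field.
Qed.

(** W is the differential of an argument. *)
Lemma dW_sym p : ur p * ur p + ui p * ui p != 0 -> dW ord0 ord_max p = dW ord_max ord0 p.
Proof.
rewrite /dW (urddC ord_max) (uiddC ord_max).
move: (ur p) (ui p) (urd ord0 p) (uid ord0 p) (urd ord_max p) (uid ord_max p) (urdd _ _ p) (uidd _ _ p) => a b c d e f g h N0.
congr (_ / _); ring.
Qed.

Lemma lam_ur p : lam p != 0 -> ur p * ur p + ui p * ui p != 0.
Proof. by move=> l0; rewrite angle_square expf_neq0// mulf_neq0. Qed.

Lemma continuous_lam : continuous lam.
Proof. exact: continuous_gbar. Qed.

Lemma near_lam p : lam p != 0 -> \forall q \near p, lam q != 0.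
Proof.
move=> l0; apply: (@open_comp _ _ lam [set x | x != 0] _ (@open_neq _ _)) => //.
by move=> q _; exact: continuous_lam.
Qed.

Lemma is_derive_alpha i l p : lam p != 0 -> is_derive p (stdbasis i) (alpha l) (dW i l p).
Proof.
move=> l0; have N : \forall q \near p, W l q = alpha l q.
  by apply: filterS (near_lam l0) => q /alpha_angle ->.
by apply: (near_eq_is_derive N); apply: is_derive_W; exact: lam_ur.
Qed.

Lemma continuous_Q : continuous Q.
Proof.
by move=> p; apply: cvgD; [apply: cvgB; apply: cvgZr|]; exact: cFdd.
Qed.

Lemma continuous_alpha l p : lam p != 0 -> {for p, continuous (alpha l)}.
Proof.
move=> l0; apply: cvgM; last exact: cvg_cst.
apply: cvgM; last by apply: cvgV => //; exact: continuous_lam.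
by apply: continuous_omega => //; exact: continuous_Q.
Qed.

Lemma continuous_dW i l p : lam p != 0 -> {for p, continuous (dW i l)}.
Proof.
move=> /lam_ur N0.
have cur : continuous ur by exact: continuous_detre.
have cui : continuous ui by exact: continuous_detim.
have M (f g : R * R -> R) : continuous f -> continuous g -> continuous (fun q => f q * g q) by exact: continuous_mul.
have A (f g : R * R -> R) : continuous f -> continuous g -> continuous (fun q => f q + g q).
  by move=> cf cg q; apply: cvgD; [exact: cf|exact: cg].
have B (f g : R * R -> R) : continuous f -> continuous g -> continuous (fun q => f q - g q).
  by move=> cf cg q; apply: cvgB; [exact: cf|exact: cg].
have O (f : R * R -> R) : continuous f -> continuous (fun q => - f q).
  by move=> cf q; apply: cvgN; exact: cf.
have curd j : continuous (urd j) by apply: (A); exact: continuous_detre.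
have cuid j : continuous (uid j) by apply: (A); exact: continuous_detim.
have curdd j k : continuous (urdd j k) by apply: (A); apply: (A); exact: continuous_detre.
have cuidd j k : continuous (uidd j k) by apply: (A); apply: (A); exact: continuous_detim.
have c2 : continuous (fun _ : R * R => 2 : R) by move=> q; exact: cvg_cst.
have cN : continuous (fun q => ur q * ur q + ui q * ui q) by apply: (A); exact: (M).
have cnum : continuous (fun p => - (urd i p * uid l p + ur p * uidd i l p - (uid i p * urd l p + ui p * urdd i l p))
     * (ur p * ur p + ui p * ui p)
   + (ur p * uid l p - ui p * urd l p) * (2 * (ur p * urd i p + ui p * uid i p))).
  apply: (A); apply: (M) => //.
  - by apply: (O); apply: (B); apply: (A); exact: (M).
  - by apply: (B); exact: (M).
  - by apply: (M) => //; apply: (A); exact: (M).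
apply: cvgM; first exact: cnum.
apply: cvgV; first exact: expf_neq0.
by apply: (M _ _ cN cN).
Qed.

Lemma alpha_periodic l : periodic (alpha l).
Proof.
move=> p; rewrite /alpha /Q /lam.
have [a0 b0] := pFd ord0 p; have [a1 b1] := pFd l p.
have E i j : Fdd i j (p + (1, 0)) = Fdd i j p /\ Fdd i j (p + (0, 1)) = Fdd i j p by exact: pFdd.
rewrite a0 b0 a1 b1 /conj_laplacian.
by do ?[rewrite (E _ _).1]; do ?[rewrite (E _ _).2].
Qed.

Lemma lam_periodic : periodic lam.
Proof. by move=> p; rewrite /lam; have [-> ->] := pFd ord0 p. Qed.

Lemma alpha_measurable l : measurable_fun [set: plane R] (alpha l : _ -> measurableTypeR R).
Proof.
apply: measurable_funM; last exact: measurable_cst.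
apply: measurable_funM.
  by apply: continuous_plane_measurable; apply: continuous_omega => //; exact: continuous_Q.
apply: (@measurableT_comp _ _ _ _ _ _ (fun x : R => x^-1)); first exact: measurable_inv.
by apply: continuous_plane_measurable; exact: continuous_lam.
Qed.

Hypotheses (div_alpha : forall p, lam p != 0 ->
  tt * partial ord0 (alpha ord0 : _ -> R^o) p - t1 * (partial ord0 (alpha ord_max : _ -> R^o) p + partial ord_max (alpha ord0 : _ -> R^o) p)
   + partial ord_max (alpha ord_max : _ -> R^o) p = 0)
  (w : R * R -> \bar R) (E : R)
  (w_alpha : forall p, ((t2 * (alpha ord0 p * alpha ord0 p) +
      t2^-1 * ((alpha ord_max p - t1 * alpha ord0 p) * (alpha ord_max p - t1 * alpha ord0 p)))%:E <= w p)%E)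
  (w_int : (\int[(leb2 R)]_(p in square) w p <= E%:E)%E).

Lemma coclosed p : lam p != 0 ->
  tt * dW ord0 ord0 p - t1 * (dW ord0 ord_max p + dW ord_max ord0 p) + dW ord_max ord_max p = 0.
Proof.
move=> l0; have := div_alpha l0; rewrite /partial.
have E' i l : 'D_(stdbasis i) (alpha l : _ -> R^o) p = dW i l p by have [_ <-] := is_derive_alpha i l l0.
by rewrite !E'.
Qed.

Let energy p := t2 * (alpha ord0 p * alpha ord0 p) +
      t2^-1 * ((alpha ord_max p - t1 * alpha ord0 p) * (alpha ord_max p - t1 * alpha ord0 p)).

Lemma energy_ge0 p : 0 <= energy p.
Proof. by rewrite addr_ge0// mulr_ge0 ?invr_ge0 ?(ltW t20)// -expr2 sqr_ge0. Qed.

(** The squared L^2 norm of alpha is bounded by the Willmore energy. *)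
Lemma energy_summable : summable energy /\ mean energy <= E.
Proof.
have le : (\int[(leb2 R)]_(p in square) (energy p)%:E <= E%:E)%E.
  apply: le_trans w_int; apply: ge0_le_integral_lower => p _.
    by rewrite lee_fin energy_ge0.
  exact: w_alpha.
have me : measurable_fun (square : set (plane R)) (energy : _ -> measurableTypeR R).
  apply: measurable_funTS.
  have m0 := alpha_measurable ord0; have m1 := alpha_measurable ord_max.
  have mc (c : R) : measurable_fun [set: plane R] ((fun=> c) : _ -> measurableTypeR R).
    exact: measurable_cst.
  apply: measurable_funD; apply: measurable_funM => //; first exact: measurable_funM.
  by apply: measurable_funM; apply: measurable_funB => //; exact: measurable_funM.
split.
  apply/integrableP; split; first exact/measurable_EFinP.
  apply: le_lt_trans (ltry E); apply: le_trans le.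
  apply: ge0_le_integral_lower => p _; first exact: abse_ge0.
  by rewrite /= ger0_norm// energy_ge0.
rewrite /mean /Rintegral -[E]/(fine E%:E); apply: fine_le => //.
rewrite ge0_fin_numE; first exact: le_lt_trans (ltry E).
by apply: integral_ge0 => p _; rewrite lee_fin energy_ge0.
Qed.

Let B := [set p | lam p = 0].

Lemma alpha_square_bound l p : alpha l p * alpha l p <= (2 * t2 + (2 * t1 ^+ 2 + 1) * t2^-1) * energy p.
Proof.
have u0 : 0 < t2^-1 by rewrite invr_gt0.
have tu : t2 * t2^-1 = 1 by rewrite divff.
suff [h0 h1] : alpha ord0 p * alpha ord0 p <= (2 * t2 + (2 * t1 ^+ 2 + 1) * t2^-1) * energy p /\
    alpha ord_max p * alpha ord_max p <= (2 * t2 + (2 * t1 ^+ 2 + 1) * t2^-1) * energy p.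
  by case: (ord2P l) => ->.
move: tu u0; rewrite /energy; move: (t2^-1) (alpha ord0 p) (alpha ord_max p) => u a b tu u0.
set e := t2 * (a * a) + u * ((b - t1 * a) * (b - t1 * a)).
have e1 : a * a <= u * e.
  have -> : u * e = (t2 * u) * (a * a) + (u * u) * ((b - t1 * a) * (b - t1 * a)) by rewrite /e; ring.
  rewrite tu mul1r lerDl -!expr2; by rewrite mulr_ge0 ?sqr_ge0.
have e2 : (b - t1 * a) * (b - t1 * a) <= t2 * e.
  have -> : t2 * e = (t2 * u) * ((b - t1 * a) * (b - t1 * a)) + (t2 * t2) * (a * a) by rewrite /e; ring.
  rewrite tu mul1r lerDl -!expr2; by rewrite mulr_ge0 ?sqr_ge0.
have e0 : 0 <= e.
  by rewrite /e -!expr2 addr_ge0// mulr_ge0 ?sqr_ge0// ltW.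
have h1 : (2 * t2 + (2 * t1 ^+ 2 + 1) * u) * e = 2 * (t2 * e) + 2 * (t1 ^+ 2 * (u * e)) + u * e by ring.
rewrite h1; have q0 := sqr_ge0 t1.
have h2 : 0 <= u * e by rewrite mulr_ge0// ltW.
have h3 : 0 <= t2 * e by rewrite mulr_ge0// ltW.
have h4 : t1 ^+ 2 * (a * a) <= t1 ^+ 2 * (u * e) by rewrite ler_wpM2l.
split.
  have : 0 <= t1 ^+ 2 * (u * e) by rewrite mulr_ge0.
  move=> h5; lra.
have := sqr_ge0 (b - 2 * (t1 * a)).
have -> : b * b = 2 * ((b - t1 * a) * (b - t1 * a)) + 2 * (t1 ^+ 2 * (a * a)) - (b - 2 * (t1 * a)) ^+ 2 by ring.
move=> h5; lra.
Qed.

Lemma alpha_square_summable l : summable (fun p => alpha l p * alpha l p).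
Proof.
apply: (le_summable (g := fun p => (2 * t2 + (2 * t1 ^+ 2 + 1) * t2^-1) * energy p)).
- by apply: measurable_funTS; apply: measurable_funM; exact: alpha_measurable.
- move=> p _; rewrite ger0_norm; first exact: alpha_square_bound.
  by rewrite -expr2 sqr_ge0.
- by apply: summableZ; have [] := energy_summable.
Qed.

Lemma alpha_summable l : summable (alpha l).
Proof.
apply: (@summable_of_square R (fun=> alpha l)) => // _; last exact: alpha_square_summable.
by apply: measurable_funTS; exact: alpha_measurable.
Qed.

(** Two choices of the coefficients x, y matter: that of the divergence and that of
    the curl of alpha. *)
Lemma weak_combination (x y : 'I_2 -> R) k t :
  (forall p, lam p != 0 -> (x ord0 * dW ord0 ord0 p + y ord0 * dW ord0 ord_max p) +
     (x ord_max * dW ord_max ord0 p + y ord_max * dW ord_max ord_max p) = 0) ->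
  freq ord0 k * (x ord0 * mean (fun p => alpha ord0 p * wave k t p) + y ord0 * mean (fun p => alpha ord_max p * wave k t p)) +
  freq ord_max k * (x ord_max * mean (fun p => alpha ord0 p * wave k t p) + y ord_max * mean (fun p => alpha ord_max p * wave k t p)) = 0.
Proof.
move=> xy0.
pose a i p := x i * alpha ord0 p + y i * alpha ord_max p.
pose d i p := x i * dW i ord0 p + y i * dW i ord_max p.
have nB p : ~ B p -> lam p != 0 by move=> h; apply/eqP.
have P p : [set p | lam p = 0] p -> alpha ord0 p = 0 /\ alpha ord_max p = 0.
  by rewrite /= /alpha => ->; rewrite invr0 !mulr0 !mul0r.
have ma i : measurable_fun (square : set (plane R)) (a i : _ -> measurableTypeR R).
  apply: measurable_funTS; apply: measurable_funD; apply: measurable_funM => //; exact: alpha_measurable.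
have := @weak_divergence R B a d _ _ _ _ _ _ _ _ _ _ _ k (t - pi / 2).
rewrite subrK; move=> WD.
have {WD} : mean (fun p => a ord0 p * (2 * pi * freq ord0 k * wave k t p) +
    a ord_max p * (2 * pi * freq ord_max k * wave k t p)) = 0.
  apply: WD.
  - move=> m n p; rewrite /B/= => h.
    by rewrite -h; rewrite (periodic_int m n p lam_periodic).
  - by move=> m n p; rewrite /B/= => h; rewrite (periodic_int m n p lam_periodic).
  - exact: finF.
  - by move=> i p; rewrite /a; have [-> ->] := alpha_periodic ord0 p; have [-> ->] := alpha_periodic ord_max p.
  - exact: ma.
  - move=> i; apply: (le_summable (g := fun p => 2 * x i ^+ 2 * (alpha ord0 p * alpha ord0 p) + 2 * y i ^+ 2 * (alpha ord_max p * alpha ord_max p))).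
    + exact: (measurable_funM (ma i) (ma i)).
    + move=> p _; rewrite ger0_norm; last by rewrite -expr2 sqr_ge0.
      rewrite /a; have := sqr_ge0 (x i * alpha ord0 p - y i * alpha ord_max p).
      move: (alpha ord0 p) (alpha ord_max p) => u v; rewrite !expr2; lra.
    + by apply: summableD; apply: summableZ; exact: alpha_square_summable.
  - by move=> i p /P[e0 e1]; rewrite /a e0 e1 !mulr0 addr0.
  - move=> i p /nB l0; apply: cvgD; apply: cvgM; try exact: cvg_cst.
      exact: continuous_alpha.
    exact: continuous_alpha.
  - move=> i p /nB l0; apply: cvgD; apply: cvgM; try exact: cvg_cst.
      exact: continuous_dW.
    exact: continuous_dW.
  - move=> i p /nB l0; apply: is_deriveDf; apply: is_deriveZf; exact: is_derive_alpha.
  - by move=> p /nB /xy0.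
have sw l : summable (fun p => alpha l p * wave k t p).
  by apply: summableM; [exact: alpha_summable|exact: wave_continuous].
rewrite (_ : (fun p => _) = (fun p =>
  (2 * pi * (freq ord0 k * x ord0 + freq ord_max k * x ord_max)) * (alpha ord0 p * wave k t p) +
  (2 * pi * (freq ord0 k * y ord0 + freq ord_max k * y ord_max)) * (alpha ord_max p * wave k t p))); last first.
  by apply/funext => p; rewrite /a; ring.
rewrite meanD; [|exact: summableZ..].
rewrite !meanZ//; move: (mean _) (mean _) => u v h.
have p0 := pi_gt0 R.
have pn : 2 * pi != 0 :> R by rewrite mulf_neq0// gt_eqF.
apply: (mulfI pn); rewrite mulr0 -h; ring.
Qed.

(** At a frequency k <> 0 the Fourier coefficient of alpha is orthogonal to k, by
    coclosedness, and parallel to k, by closedness. *)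
Lemma alpha_modes l : modes_vanish (alpha l).
Proof.
move=> k t k0.
(* h1 is the divergence, h2 the curl *)
have h1 := @weak_combination (fun i => if i == ord0 then tt else - t1) (fun i => if i == ord0 then - t1 else 1) k t.
have h2 := @weak_combination (fun i => if i == ord0 then 0 else - 1) (fun i => if i == ord0 then 1 else 0) k t.
move: h1 h2; rewrite /=.
set a := mean _; set b := mean _ => h1 h2.
have {}h1 : freq ord0 k * (tt * a - t1 * b) + freq ord_max k * (- t1 * a + 1 * b) = 0.
  rewrite -mulNr; apply: h1 => p /coclosed; lra.
have {}h2 : freq ord0 k * (0 * a + 1 * b) + freq ord_max k * (- 1 * a + 0 * b) = 0.
  by apply: h2 => p /lam_ur/dW_sym; lra.
have kk : freq ord0 k * b = freq ord_max k * a by lra.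
have [x xE] : exists x, x = freq ord0 k :> R by exists (freq ord0 k).
have [y yE] : exists y, y = freq ord_max k :> R by exists (freq ord_max k).
rewrite -xE -yE in h1 h2 kk.
have D : tt * x ^+ 2 - 2 * t1 * x * y + y ^+ 2 != 0.
  have -> : tt * x ^+ 2 - 2 * t1 * x * y + y ^+ 2 = (t2 * x) ^+ 2 + (y - t1 * x) ^+ 2 by rewrite /tt; ring.
  rewrite paddr_eq0 ?sqr_ge0// !sqrf_eq0 mulf_eq0 (negbTE t2n0) /=.
  apply/negP => /andP[/eqP x0]; rewrite x0 mulr0 subr0 => /eqP y0.
  case/negP: k0; move: x0 y0; rewrite xE yE /freq /= => /eqP x0 /eqP y0.
  by case: (k) x0 y0 => k1 k2 /=; rewrite !intr_eq0 xpair_eqE => -> ->.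
have a0 : a = 0.
  apply: (mulIf D); rewrite mul0r.
  transitivity (x * (x * (tt * a - t1 * b) + y * (- t1 * a + 1 * b)) + (t1 * x - y) * (x * b - y * a)); first by ring.
  by rewrite h1 kk subrr !mulr0 addr0.
have b0 : b = 0.
  apply: (mulIf D); rewrite mul0r.
  transitivity (y * (x * (tt * a - t1 * b) + y * (- t1 * a + 1 * b)) + (tt * x - t1 * y) * (x * b - y * a)); first by ring.
  by rewrite h1 kk subrr !mulr0 addr0.
by case: (ord2P l) => ->.
Qed.

Definition calpha l := mean (alpha l).

(** Where lam does not vanish alpha is continuous, hence equal to its mean; where
    it vanishes both sides are 0. *)
Lemma alpha_const l p : omega (Q p) (Fd l p) = calpha l * (t2 ^+ 2 * lam p).
Proof.
apply/eqP; rewrite -subr_eq0; apply/eqP; move: p.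
apply: periodic_vanish.
- move=> p; have [a0 b0] := pFd l p; have [-> ->] := lam_periodic p.
  have E' i j : Fdd i j (p + (1, 0)) = Fdd i j p /\ Fdd i j (p + (0, 1)) = Fdd i j p by exact: pFdd.
  rewrite a0 b0 /Q /conj_laplacian.
  by do ?[rewrite (E' _ _).1]; do ?[rewrite (E' _ _).2].
- move=> p; apply: cvgB; first by apply: continuous_omega => //; exact: continuous_Q.
  by apply: cvgM; [exact: cvg_cst|apply: cvgM; [exact: cvg_cst|exact: continuous_lam]].
- move=> q q1 q2; have [l0|l0] := eqVneq (lam q) 0.
    have z k : Fd k q = 0.
      have : gbar (Fd k q) (Fd k q) = 0.
        by case: (ord2P k) => ->; [exact: l0|rewrite g11 l0 mul0r].
      rewrite gbarE -!expr2 => /eqP.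
      rewrite !paddr_eq0 ?addr_ge0 ?sqr_ge0// !sqrf_eq0 => /andP[/andP[/andP[/eqP e1 /eqP e2] /eqP e3] /eqP e4].
      have c0 i : cc i (0 : C2 R) = 0 by rewrite linear0.
      by apply: C2_eq; rewrite ?e1 ?e2 ?e3 ?e4; [rewrite /c1|rewrite /c2|rewrite /c3|rewrite /c4]; rewrite c0.
    rewrite l0 !mulr0 subr0 z omegaE.
    have c0 i : cc i (0 : C2 R) = 0 by rewrite linear0.
    by rewrite /c1 /c2 /c3 /c4 !c0 !mulr0 addr0 !subr0.
  have := mean_eval (alpha_summable l) (@alpha_modes l) (continuous_alpha l0) q1 q2.
  rewrite -/(calpha l) => <-; rewrite /alpha.
  by move: (omega _ _) => m; field; rewrite l0 t2n0.
Qed.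

(** Jensen's inequality. *)
Lemma calpha_energy : t2 * (calpha ord0 * calpha ord0) +
  t2^-1 * ((calpha ord_max - t1 * calpha ord0) * (calpha ord_max - t1 * calpha ord0)) <= E.
Proof.
have [se le] := energy_summable; apply: le_trans le.
have J (f : R * R -> R) : summable f -> summable (fun p => f p * f p) -> mean f * mean f <= mean (fun p => f p * f p).
  move=> sf sff.
  have sc (a : R) : summable (fun=> a) by apply: continuous_summable => p; exact: cvg_cst.
  have : 0 <= mean (fun p => f p * f p + (- 2 * mean f) * f p + mean f * mean f).
    apply: Rintegral_ge0 => p _; move: (mean f) (f p) => u v.
    have := sqr_ge0 (v - u); rewrite expr2; lra.
  rewrite meanD; [|by apply: summableD => //; exact: summableZ|exact: sc].
  rewrite meanD//; last exact: summableZ.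
  rewrite (meanZ (- 2 * mean f) sf) (mean_cst (mean f * mean f)); move: (mean _) (mean f) => u v; lra.
pose b p := alpha ord_max p - t1 * alpha ord0 p.
have s0 := alpha_summable ord0; have s1 := alpha_summable ord_max.
have sb : summable b by apply: summableB => //; exact: summableZ.
have sbb : summable (fun p => b p * b p).
  apply: (le_summable (g := fun p => t2 * energy p)).
  - have m0 := alpha_measurable ord0; have m1 := alpha_measurable ord_max.
    by apply: measurable_funTS; apply: measurable_funM; apply: measurable_funB => //; exact: measurable_funM.
  - move=> p _; rewrite ger0_norm; last by rewrite -expr2 sqr_ge0.
    have -> : t2 * energy p = t2 * (t2 * (alpha ord0 p * alpha ord0 p)) + b p * b p.
      by rewrite /energy mulrDr (mulVKf t2n0).
    rewrite lerDr.
    by rewrite mulr_ge0 ?(ltW t20)// mulr_ge0 ?(ltW t20)// -expr2 sqr_ge0.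
  - exact: summableZ.
have mb : mean b = calpha ord_max - t1 * calpha ord0 by rewrite meanB ?meanZ//; exact: summableZ.
have -> : mean energy = t2 * mean (fun p => alpha ord0 p * alpha ord0 p) + t2^-1 * mean (fun p => b p * b p).
  have saa := alpha_square_summable ord0.
  by rewrite -!meanZ// -meanD//; exact: summableZ.
rewrite -mb; apply: lerD.
  by rewrite ler_wpM2l ?(ltW t20)//; apply: J => //; exact: alpha_square_summable.
by rewrite ler_wpM2l ?invr_ge0 ?(ltW t20)//; exact: J.
Qed.

(** Off the branch set Q is normal, hence determined by its pairings with J F_0 and
    J F_1, which are the coefficients of alpha.  Both sides are continuous. *)
Lemma hsl_equation p : Q p =
  - Jstd ((tt * calpha ord0 - t1 * calpha ord_max) *: Fd ord0 p + (calpha ord_max - t1 * calpha ord0) *: Fd ord_max p).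
Proof.
set x := _ - _; set y := _ - _.
apply/eqP; rewrite -subr_eq0 opprK; apply/eqP.
have c0 i : cc i (0 : C2 R) = 0 by rewrite linear0.
suff z i : forall p, cc i (Q p + Jstd (x *: Fd ord0 p + y *: Fd ord_max p)) = 0.
  by apply: C2_eq; rewrite /c1 /c2 /c3 /c4 c0.
set f := fun r => cc i (Q r + Jstd (x *: Fd ord0 r + y *: Fd ord_max r)).
apply: (@vanish_off_finite R lam f); last first; rewrite /f.
- move=> q l0; rewrite (_ : _ + _ = 0) ?c0//; apply/eqP; rewrite addr_eq0; apply/eqP.
  set X := Fd ord0 q; set Y := Fd ord_max q - t1 *: Fd ord0 q.
  have k0 : lam q * t2 ^+ 2 != 0 by rewrite mulf_neq0// expf_neq0.
  apply: (scalerI k0).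
  have FE := @frame_expansion R X Y (Q q) (lam q) (t2 ^+ 2).
  have l1 := alpha_const ord0 q; have l2 := alpha_const ord_max q.
  have n1 := Q_normal ord0 q; have n2 := Q_normal ord_max q.
  have omY Z : omega Z Y = omega Z (Fd ord_max q) - t1 * omega Z (Fd ord0 q) by rewrite !omegaE !cE; ring.
  have gmY Z : gbar Z Y = gbar Z (Fd ord_max q) - t1 * gbar Z (Fd ord0 q) by rewrite !gbarE !cE; ring.
  have oXX : omega X X = 0 by rewrite omegaE; ring.
  have QX : gbar (Q q) X = 0 by rewrite /X n1.
  have QY : gbar (Q q) Y = 0 by rewrite gmY n1 n2 mulr0 subrr.
  have oQY : omega (Q q) Y = y * (t2 ^+ 2 * lam q) by rewrite omY l1 l2 /y; ring.
  have gXY : gbar X Y = 0 by rewrite gmY g01 /X -/(lam q); ring.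
  rewrite FE//.
  + rewrite QX QY oQY l1; apply: C2_eq; rewrite !cE /x /tt /y; ring.
  + rewrite gmY (gbarC Y (Fd ord_max q)) (gbarC Y (Fd ord0 q)) !gmY (gbarC _ (Fd ord0 q)) !g01 g11 /tt -/(lam q); ring.
  + by rewrite omY lag01 /X oXX mulr0 subr0.
- have cG : continuous (fun r => x *: Fd ord0 r + y *: Fd ord_max r).
    by move=> r; apply: cvgD; apply: cvgZr; exact: cFd.
  have -> : (fun r => cc i (Q r + Jstd (x *: Fd ord0 r + y *: Fd ord_max r))) =
     (fun r => cc i (Q r) + (if i.2 then 1 else -1) * cc (i.1, ~~ i.2) (x *: Fd ord0 r + y *: Fd ord_max r)).
    by apply/funext => r; rewrite linearD; congr (_ + _); case: (i) => i' [] /=; rewrite /cc /= ?mxE ?mul1r ?mulN1r.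
  move=> r; apply: cvgD; first exact: continuous_cc continuous_Q _.
  by apply: cvgM; [exact: cvg_cst|exact: continuous_cc].
- move=> r; have [a0 b0] := pFd ord0 r; have [a1 b1] := pFd ord_max r.
  have E' i' j : Fdd i' j (r + (1, 0)) = Fdd i' j r /\ Fdd i' j (r + (0, 1)) = Fdd i' j r by exact: pFdd.
  rewrite a0 a1 b0 b1 /Q /conj_laplacian.
  by do ?[rewrite (E' _ _).1]; do ?[rewrite (E' _ _).2].
- exact: finF.
Qed.

End ModelImmersion.

(** * Hamiltonian stationary immersions and their linear equation *)
#[local] Opaque derive gbar omega model stdbasis.

Section Geometry.
Context {R : realType}.
Implicit Types (F : R * R -> C2 R).

Definition grad F i p : C2 R := partial i F p.
Definition hess F i j p : C2 R := partial i (partial j F) p.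
Definition density F p : R := gbar (grad F ord0 p) (grad F ord0 p).

Definition conformal_to t1 t2 F := forall p,
  gbar (grad F ord0 p) (grad F ord_max p) = density F p * t1 /\
  gbar (grad F ord_max p) (grad F ord_max p) = density F p * (t1 ^+ 2 + t2 ^+ 2).

Definition finite_zeros F := finite_set ([set p | density F p = 0] `&` square).

Lemma density_ge0 F p : 0 <= density F p.
Proof. by rewrite /density gbarE -!expr2 !addr_ge0 ?sqr_ge0. Qed.

Lemma induced_metric_coef F p i j : induced_metric F p i j = gbar (grad F i p) (grad F j p).
Proof. by rewrite mxE. Qed.

Lemma induced_metricE t1 t2 F p : conformal_to t1 t2 F -> induced_metric F p = density F p *: model t1 t2.
Proof.
have [m00 m01 m10 m11] := modelE t1 t2.
have ZE (c : R) i j : (c *: model t1 t2) i j = c * model t1 t2 i j by rewrite mxE.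
move=> /(_ p)[e01 e11]; apply: mx2P; rewrite induced_metric_coef ZE.
- by rewrite m00 mulr1.
- by rewrite m01.
- by rewrite m10 gbarC.
- by rewrite m11.
Qed.

Lemma conformal_toP t1 t2 h F : (forall p, h p = model t1 t2) ->
  branched_conformal_immersion h F <-> conformal_to t1 t2 F /\ finite_zeros F.
Proof.
move=> hE; have [m00 m01 m10 m11] := modelE t1 t2.
split=> [[l [l0 gl fl]]|[cF fF]].
  have gE i j p : gbar (grad F i p) (grad F j p) = l p * model t1 t2 i j.
    by rewrite -induced_metric_coef gl hE mxE.
  have lE p : density F p = l p by rewrite /density gE m00 mulr1.
  split=> [p|]; first by split; rewrite gE lE ?m01 ?m11.
  by rewrite /finite_zeros (_ : density F = l)//; apply/funext.
exists (density F); split => // p; first exact: density_ge0.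
by rewrite hE; exact: induced_metricE.
Qed.

Lemma branch_setE t1 t2 F p : conformal_to t1 t2 F -> branch_set F p <-> density F p = 0.
Proof.
move=> cF; rewrite /branch_set /= (induced_metricE p cF); have [m00 _ _ _] := modelE t1 t2.
split=> [/(congr1 (fun M : 'M[R]_2 => M ord0 ord0))|->]; last by rewrite scale0r.
by rewrite mxE m00 mulr1 mxE.
Qed.

Lemma area_densityE t1 t2 F p : 0 < t2 -> conformal_to t1 t2 F -> area_density F p = density F p * t2.
Proof.
move=> t20 cF; rewrite /area_density (induced_metricE p cF) detZ det_model -exprMn sqrtr_sqr ger0_norm//.
by rewrite mulr_ge0 ?density_ge0// ltW.
Qed.

Lemma mean_curvature_formE t1 t2 F l p : 0 < t2 -> periodic F -> smooth F -> conformal_to t1 t2 F -> lagrangian F ->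
  mean_curvature_form F l p = alpha t1 t2 (grad F) (hess F) l p.
Proof.
move=> t20 pF sF cF lF.
rewrite /mean_curvature_form -[mean_curvature F p]/(mcurv (invmx (induced_metric F p)) (fun i => grad F i p) (fun i j => hess F i j p)).
rewrite (induced_metricE p cF) invmx_scale_model ?gt_eqF//.
apply: (@omega_mcurv R t1 t2 (density F p) (fun i => grad F i p) (fun i j => hess F i j p) l); first exact: lF.
by rewrite /hess (partialCV _ _ pF sF).
Qed.

(** In dimension two the density of the metric times its inverse is conformally
    invariant, so the operator d^* has constant coefficients up to a factor. *)
Lemma flux_alpha t1 t2 F i p : 0 < t2 -> periodic F -> smooth F -> conformal_to t1 t2 F -> lagrangian F ->
  \sum_j area_density F p * invmx (induced_metric F p) i j * mean_curvature_form F j p =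
  \sum_j t2 * model_inv t1 t2 i j * alpha t1 t2 (grad F) (hess F) j p.
Proof.
move=> t20 pF sF cF lF; apply: eq_bigr => j _.
rewrite (mean_curvature_formE j p t20 pF sF cF lF) (area_densityE _ t20 cF) (induced_metricE p cF) invmx_scale_model ?gt_eqF// mxE.
rewrite /alpha -/(density F p); have [->|d0] := eqVneq (density F p) 0; first by rewrite !(mul0r, mulr0, invr0).
have cancel (d t u x : R) : d != 0 -> d * t * (d^-1 * u) * x = t * u * x by move=> d1; field.
exact: cancel.
Qed.

Lemma alpha_branch t1 t2 F l p : density F p = 0 -> alpha t1 t2 (grad F) (hess F) l p = 0.
Proof. by rewrite /alpha -/(density F p) => ->; rewrite invr0 mulr0 mul0r. Qed.

(** Bessel's inequality for the normal frame J F_0, J (F_1 - t1 F_0). *)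
Lemma willmore_density_ge t1 t2 F p (a : 'I_2 -> R) : 0 < t2 -> periodic F -> smooth F -> conformal_to t1 t2 F -> lagrangian F ->
  (forall l, a l = alpha t1 t2 (grad F) (hess F) l p) ->
  t2 * (a ord0 * a ord0) + t2^-1 * ((a ord_max - t1 * a ord0) * (a ord_max - t1 * a ord0)) <= willmore_density F p.
Proof.
move=> t20 pF sF cF lF aA; have [d0|d0] := eqVneq (density F p) 0.
  rewrite !aA !alpha_branch// !(mulr0, subrr, addr0) /willmore_density (area_densityE p t20 cF) d0.
  by rewrite mul0r mulr0.
have aE l : a l = omega (mean_curvature F p) (grad F l p) by rewrite aA -(mean_curvature_formE l p t20 pF sF cF lF).
rewrite /willmore_density (area_densityE p t20 cF).
move: (mean_curvature F p) aE => H aE.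
have [e01 e11] := cF p; have o01 := lF p ord0 ord_max.
have lp : 0 < density F p by rewrite lt_neqAle eq_sym d0 density_ge0.
rewrite -/(grad F ord0 p) -/(grad F ord_max p) in o01.
have e00 : gbar (grad F ord0 p) (grad F ord0 p) = density F p by [].
rewrite !aE; move: lp e00 e01 e11 o01.
move: (density F p) (grad F ord0 p) (grad F ord_max p) => l X Z lp e00 e01 e11 o01.
have k0 : 0 < t2 ^+ 2 by rewrite exprn_gt0.
have XY : gbar X (Z - t1 *: X) = 0.
  by transitivity (gbar X Z - t1 * gbar X X); [rewrite !gbarE !cE; ring|rewrite e00 e01; ring].
have YY : gbar (Z - t1 *: X) (Z - t1 *: X) = l * t2 ^+ 2.
  by transitivity (gbar Z Z - 2 * t1 * gbar X Z + t1 ^+ 2 * gbar X X);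
    [rewrite !gbarE !cE; ring|rewrite e00 e01 e11; ring].
have oXY : omega X (Z - t1 *: X) = 0.
  by transitivity (omega X Z); [rewrite !omegaE !cE; ring|].
have := frame_bessel H e00 YY XY oXY lp k0.
have -> : omega H (Z - t1 *: X) = omega H Z - t1 * omega H X by rewrite !omegaE !cE; ring.
move: (omega H X) (omega H Z) (gbar H H) => x z g le.
have t2n : t2 != 0 by rewrite gt_eqF.
rewrite -(ler_pM2l t20); apply: le_trans (_ : t2 ^+ 2 * l * g <= _); last by rewrite le_eqVlt; apply/orP; left; apply/eqP; ring.
apply: le_trans le; rewrite le_eqVlt; apply/orP; left; apply/eqP.
by field.
Qed.

Lemma flux_partial t1 t2 F p (D : 'I_2 -> 'I_2 -> R) : 0 < t2 -> periodic F -> smooth F -> conformal_to t1 t2 F -> lagrangian F ->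
  (forall i l, is_derive p (stdbasis i) (alpha t1 t2 (grad F) (hess F) l : _ -> R^o) (D i l)) ->
  codifferential F (mean_curvature_form F) p = - ((density F p * t2)^-1 *
    (t2^-1 * ((t1 ^+ 2 + t2 ^+ 2) * D ord0 ord0 - t1 * (D ord0 ord_max + D ord_max ord0) + D ord_max ord_max))).
Proof.
move=> t20 pF sF cF lF dD; rewrite /codifferential (area_densityE p t20 cF); congr (- (_ * _)).
have [n00 n01 n10 n11] := model_invE t1 t2.
pose A l q := alpha t1 t2 (grad F) (hess F) l q.
have P i : partial i (fun q => \sum_j area_density F q * invmx (induced_metric F q) i j * mean_curvature_form F j q : R^o) p =
   t2 * model_inv t1 t2 i ord0 * D i ord0 + t2 * model_inv t1 t2 i ord_max * D i ord_max.
  have -> : (fun q => \sum_j area_density F q * invmx (induced_metric F q) i j * mean_curvature_form F j q) =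
     (fun q => (t2 * model_inv t1 t2 i ord0) * A ord0 q + (t2 * model_inv t1 t2 i ord_max) * A ord_max q).
    by apply/funext => q; rewrite (flux_alpha i q t20 pF sF cF lF) sum2.
  by rewrite /partial; have [_ ->] := is_deriveDf (is_deriveZf (t2 * model_inv t1 t2 i ord0) (dD i ord0)) (is_deriveZf (t2 * model_inv t1 t2 i ord_max) (dD i ord_max)).
rewrite sum2 !P n00 n01 n10 n11; field.
by rewrite gt_eqF.
Qed.

Lemma frame_solve0 (l t1 t2 a b g0 g1 : R) : l != 0 -> t2 != 0 -> g0 = l -> g1 = l * t1 ->
  (((t1 ^+ 2 + t2 ^+ 2) * a - t1 * b) * g0 + (b - t1 * a) * g1) / l / t2 ^+ 2 = a.
Proof. by move=> l0 t20 -> ->; field; rewrite l0 t20. Qed.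

Lemma frame_solve1 (l t1 t2 a b g0 g1 : R) : l != 0 -> t2 != 0 -> g0 = l * t1 -> g1 = l * (t1 ^+ 2 + t2 ^+ 2) ->
  (((t1 ^+ 2 + t2 ^+ 2) * a - t1 * b) * g0 + (b - t1 * a) * g1) / l / t2 ^+ 2 = b.
Proof. by move=> l0 t20 -> ->; field; rewrite l0 t20. Qed.

Section Hessian.
Variables (t1 t2 : R) (F : R * R -> C2 R).
Hypotheses (t20 : 0 < t2) (pF : periodic F) (sF : smooth F) (cF : conformal_to t1 t2 F) (lF : lagrangian F)
  (fF : finite_zeros F).

Definition hess3 F i j k p : C2 R := partial i (partial j (partial k F)) p.

Let pFd i : periodic (grad F i).
Proof. exact: (periodic_partials [:: i] pF). Qed.
Let pFdd i j : periodic (hess F i j).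
Proof. exact: (periodic_partials [:: i; j] pF). Qed.
Let cFd i : continuous (grad F i).
Proof. exact: smooth_continuous (smooth_partials [:: i] sF). Qed.
Let cFdd i j : continuous (hess F i j).
Proof. exact: smooth_continuous (smooth_partials [:: i; j] sF). Qed.
Let cFddd i j k : continuous (hess3 F i j k).
Proof. exact: smooth_continuous (smooth_partials [:: i; j; k] sF). Qed.
Let dFd j i p : is_derive p (stdbasis j) (grad F i) (hess F j i p).
Proof. exact: smooth_is_derive (smooth_partials [:: i] sF). Qed.
Let dFdd k j i p : is_derive p (stdbasis k) (hess F j i) (hess3 F k j i p).
Proof. exact: smooth_is_derive (smooth_partials [:: j; i] sF). Qed.
Let FddC i j p : hess F i j p = hess F j i p.
Proof. by rewrite /hess (partialCV i j pF sF). Qed.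
Let FdddC i j k p : hess3 F i j k p = hess3 F j i k p.
Proof. by rewrite /hess3 (partialCV i j (pFd k) (smooth_partials [:: k] sF)). Qed.
Let g01 p : gbar (grad F ord0 p) (grad F ord_max p) = density F p * t1.
Proof. by have [] := cF p. Qed.
Let g11 p : gbar (grad F ord_max p) (grad F ord_max p) = density F p * (t1 ^+ 2 + t2 ^+ 2).
Proof. by have [] := cF p. Qed.
Let lag01 p : omega (grad F ord0 p) (grad F ord_max p) = 0.
Proof. exact: lF. Qed.

(** The equation Delta F = - J (c^# F) for a 1-form c with constant coefficients,
    multiplied by t2 ^ 2. *)
Definition hsl_pde t1 t2 (c : R * R) F := forall p, conj_laplacian t1 t2 (fun i j => hess F i j p) =
  - Jstd (((t1 ^+ 2 + t2 ^+ 2) * c.1 - t1 * c.2) *: grad F ord0 p + (c.2 - t1 * c.1) *: grad F ord_max p).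

Lemma hsl_of_stationary W : hamiltonian_stationary F -> (willmore F <= W%:E)%E ->
  exists2 c : R * R, hsl_pde t1 t2 c F & t2 * (c.1 * c.1) + t2^-1 * ((c.2 - t1 * c.1) * (c.2 - t1 * c.1)) <= 4 * W.
Proof.
move=> hs wW.
have int : (\int[(leb2 R)]_(p in square) (willmore_density F p)%:E <= (4 * W)%:E)%E.
  move: wW; rewrite /willmore /torus_integral -/square; move: (integral _ _ _) => x; case: x => [x| |] //=.
    rewrite -EFinM !lee_fin; lra.
    by rewrite mulr_infty gtr0_sg ?invr_gt0// mul1e leye_eq.
  by rewrite leNye.
have wa p : ((t2 * (alpha t1 t2 (grad F) (hess F) ord0 p * alpha t1 t2 (grad F) (hess F) ord0 p) +
   t2^-1 * ((alpha t1 t2 (grad F) (hess F) ord_max p - t1 * alpha t1 t2 (grad F) (hess F) ord0 p) * (alpha t1 t2 (grad F) (hess F) ord_max p - t1 * alpha t1 t2 (grad F) (hess F) ord0 p)))%:E <=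
   (willmore_density F p)%:E)%E.
  by rewrite lee_fin; apply: (willmore_density_ge (a := fun l => alpha t1 t2 (grad F) (hess F) l p)).
exists (calpha t1 t2 (grad F) (hess F) ord0, calpha t1 t2 (grad F) (hess F) ord_max); last first.
  exact: (calpha_energy t20 cFd cFdd wa int).
move=> p /=; apply: (hsl_equation t20 pFd pFdd cFd cFdd cFddd dFd dFdd FddC FdddC g01 g11 lag01 fF _ wa int).
move=> q d0; have nB : ~ branch_set F q by move=> /(branch_setE q cF) E; rewrite -/(density F q) E eqxx in d0.
have D i l : is_derive q (stdbasis i) (alpha t1 t2 (grad F) (hess F) l : _ -> R^o) (partial i (alpha t1 t2 (grad F) (hess F) l : _ -> R^o) q).
  have H := is_derive_alpha t20 cFd dFd dFdd FddC g01 g11 lag01 i l d0.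
  by rewrite /partial; split; [case: H|].
have := hs q nB; rewrite (flux_partial t20 pF sF cF lF D) => /eqP; rewrite oppr_eq0 !mulf_eq0 invr_eq0 invr_eq0 mulf_eq0.
by rewrite -/(density F q) in d0; rewrite (negbTE d0) gt_eqF//= => /eqP.
Qed.

(** Pairing the equation with the tangent vectors shows that the mean curvature form
    is c near any regular point, hence coclosed. *)
Lemma stationary_of_hsl c : hsl_pde t1 t2 c F -> hamiltonian_stationary F.
Proof.
move=> H p nB.
have d0 : density F p != 0 by apply/eqP => /(branch_setE p cF).
have lC c' : forall q, density F q != 0 -> alpha t1 t2 (grad F) (hess F) c' q = if c' == ord0 then c.1 else c.2.
  move=> q q0; rewrite /alpha (H q) -/(density F q).
  have -> (a b : R) (X Y Z : C2 R) : omega (- Jstd (a *: X + b *: Y)) Z = a * gbar X Z + b * gbar Y Z.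
    by rewrite omegaE gbarE (gbarE Y) !cE; ring.
  have e00 : gbar (grad F ord0 q) (grad F ord0 q) = density F q := erefl.
  have e10 : gbar (grad F ord_max q) (grad F ord0 q) = density F q * t1 by rewrite gbarC g01.
  case: (ord2P c') => ->.
    exact: (@frame_solve0 _ t1 _ c.1 c.2 _ _ q0 (lt0r_neq0 t20) e00 e10).
  exact: (@frame_solve1 _ t1 _ c.1 c.2 _ _ q0 (lt0r_neq0 t20) (g01 q) (g11 q)).
have D i l : is_derive p (stdbasis i) (alpha t1 t2 (grad F) (hess F) l : _ -> R^o) 0.
  have N : \forall q \near p, (if l == ord0 then c.1 else c.2) = alpha t1 t2 (grad F) (hess F) l q.
    by apply: filterS (near_lam cFd d0) => q /lC ->.
  by apply: (near_eq_is_derive N).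
rewrite (flux_partial (D := fun _ _ => 0) t20 pF sF cF lF D).
by rewrite !(mulr0, addr0, subrr, oppr0).
Qed.

End Hessian.

End Geometry.

(** * Bounds on the frequencies and coefficients of an immersion *)
Section ModeAlgebra.
Context {R : realType}.

Lemma wave_pi k (t : R) p : wave k (t + pi) p = - wave k t p :> R.
Proof. by rewrite /wave addrA cosDpi. Qed.

Lemma mean_wave_comb (f g : R * R -> R) (a b : R) k t : continuous f -> continuous g ->
  mean (fun p => (a * f p + b * g p) * wave k t p) =
  a * mean (fun p => f p * wave k t p) + b * mean (fun p => g p * wave k t p).
Proof.
move=> cf cg; have cw m u : continuous (wave m u : R * R -> R) by exact: wave_continuous.
have E : (fun p => (a * f p + b * g p) * wave k t p) = (fun p => a * (f p * wave k t p) + b * (g p * wave k t p)).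
  by apply/funext => p; ring.
rewrite E meanD; [|by apply: summableZ; apply: continuous_summable; exact: continuous_mul..].
by rewrite !meanZ//; apply: continuous_summable; exact: continuous_mul.
Qed.

Definition moment (f : R * R -> R) k t := mean (fun p => f p * wave k t p).

Lemma moment_pi f k t : continuous f -> moment f k (t + pi) = - moment f k t.
Proof.
move=> cf; rewrite /moment -[RHS]mulN1r -meanZ; last first.
  by apply: continuous_summable; apply: continuous_mul => //; exact: wave_continuous.
by congr mean; apply/funext => p; rewrite wave_pi; ring.
Qed.

Section TwoJet.
Variables (f : R * R -> R) (fd : 'I_2 -> R * R -> R) (fdd : 'I_2 -> 'I_2 -> R * R -> R).
Hypotheses (pf : periodic f) (pfd : forall i, periodic (fd i)) (cf : continuous f) (cfd : forall i, continuous (fd i))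
  (cfdd : forall i j, continuous (fdd i j))
  (df : forall i p, is_derive p (stdbasis i) f (fd i p))
  (dfd : forall i j p, is_derive p (stdbasis i) (fd j) (fdd i j p)).

Lemma moment_grad i k t : moment (fd i) k t = - (2 * pi * freq i k) * moment f k (t + pi / 2).
Proof. exact: mean_by_parts. Qed.

Lemma moment_hess i j k t : moment (fdd i j) k t = - (4 * pi ^+ 2 * freq i k * freq j k) * moment f k t.
Proof.
transitivity (- (2 * pi * freq i k) * moment (fd j) k (t + pi / 2)); first exact: mean_by_parts.
rewrite moment_grad -addrA -splitr moment_pi//; ring.
Qed.

Lemma moment_lap (a b c : R) k t :
  moment (fun p => (a * fdd ord0 ord0 p - b * fdd ord0 ord_max p) + fdd ord_max ord_max p) k t =
  - (4 * pi ^+ 2 * (a * freq ord0 k ^+ 2 - b * freq ord0 k * freq ord_max k + freq ord_max k ^+ 2)) * moment f k t.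
Proof.
have c1 : continuous (fun p => a * fdd ord0 ord0 p + (- b) * fdd ord0 ord_max p).
  by move=> p; apply: cvgD; apply: cvgM; try exact: cvg_cst; exact: cfdd.
transitivity (1 * moment (fun p => a * fdd ord0 ord0 p + (- b) * fdd ord0 ord_max p) k t + 1 * moment (fdd ord_max ord_max) k t).
  rewrite -mean_wave_comb//; congr mean; apply/funext => p; ring.
rewrite {1}/moment mean_wave_comb// -!/(moment _ k t) !moment_hess; ring.
Qed.

Lemma moment_lin (x y : R) k t : moment (fun p => x * fd ord0 p + y * fd ord_max p) k t =
  - (2 * pi * (x * freq ord0 k + y * freq ord_max k)) * moment f k (t + pi / 2).
Proof. rewrite {1}/moment mean_wave_comb// -!/(moment _ k t) !moment_grad; ring. Qed.

End TwoJet.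

(** J exchanges the two coordinates of a complex coordinate of C^2.  Eliminating one
    of the two moments gives (q ^+ 2 - a ^+ 2) * mu t = 0. *)
Lemma paired_moments (q a : R) (mu mv : R -> R) :
  (forall t, mu (t + pi) = - mu t) -> (forall t, mv (t + pi) = - mv t) ->
  (forall t, q * mu t = a * mv (t + pi / 2)) -> (forall t, q * mv t = - (a * mu (t + pi / 2))) ->
  q ^+ 2 != a ^+ 2 -> forall t, mu t = 0 /\ mv t = 0.
Proof.
move=> pu pv e1 e2 qa t.
have h s : s + pi / 2 + pi / 2 = s + pi :> R by rewrite -addrA -splitr.
have qa0 : q ^+ 2 - a ^+ 2 != 0 by rewrite subr_eq0.
split; apply: (mulfI qa0); rewrite mulr0.
  have := e2 (t + pi / 2); rewrite h pu.
  move=> e; transitivity (q * (q * mu t) - a ^+ 2 * mu t); first by ring.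
  by rewrite e1; transitivity (a * (q * mv (t + pi / 2)) - a ^+ 2 * mu t); [ring|rewrite e; ring].
have := e1 (t + pi / 2); rewrite h pv.
move=> e; transitivity (q * (q * mv t) - a ^+ 2 * mv t); first by ring.
by rewrite e2; transitivity (- (a * (q * mu (t + pi / 2))) - a ^+ 2 * mv t); [ring|rewrite e; ring].
Qed.

(** Up to the factor t2 ^+ 2, q is 4 pi^2 |k|^2 and a is 2 pi <c, k> for the model metric,
    so that q = +/- a and the Cauchy-Schwarz inequality bound |k| by |c|. *)
Lemma resonance_bound (t1 t2 c0 c1 k0 k1 E : R) : 0 < t2 ->
  t2 * (c0 * c0) + t2^-1 * ((c1 - t1 * c0) * (c1 - t1 * c0)) <= E ->
  let q := 4 * pi ^+ 2 * ((t1 ^+ 2 + t2 ^+ 2) * k0 ^+ 2 - 2 * t1 * k0 * k1 + k1 ^+ 2) in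
  let a := 2 * pi * (((t1 ^+ 2 + t2 ^+ 2) * c0 - t1 * c1) * k0 + (c1 - t1 * c0) * k1) in
  q ^+ 2 = a ^+ 2 -> t2 * k0 ^+ 2 <= E /\ (k1 - t1 * k0) ^+ 2 <= t2 * E.
Proof.
move=> t20 cE q a; rewrite /q /a {q a}.
have [v vE] : exists v, v = k1 - t1 * k0 by eexists.
have [b bE] : exists b, b = c1 - t1 * c0 by eexists.
rewrite -bE in cE; rewrite -vE.
have -> : (t1 ^+ 2 + t2 ^+ 2) * k0 ^+ 2 - 2 * t1 * k0 * k1 + k1 ^+ 2 = (t2 * k0) ^+ 2 + v ^+ 2 by rewrite vE; ring.
have -> : ((t1 ^+ 2 + t2 ^+ 2) * c0 - t1 * c1) * k0 + (c1 - t1 * c0) * k1 = (t2 * c0) * (t2 * k0) + b * v by rewrite vE bE; ring.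
have [u uE] : exists u, u = t2 * k0 by eexists.
have [s sE] : exists s, s = t2 * c0 by eexists.
have c2 : s ^+ 2 + b ^+ 2 <= t2 * E.
  apply: le_trans (_ : t2 * (t2 * (c0 * c0) + t2^-1 * (b * b)) <= _); last by rewrite ler_pM2l.
  by rewrite mulrDr mulVKf ?gt_eqF// sE le_eqVlt; apply/orP; left; apply/eqP; ring.
rewrite -uE -sE => qa.
(* the crude bound 1 <= 4 pi^2 keeps pi out of the conclusion *)
have P1 : 1 <= 4 * pi ^+ 2 :> R.
  by have := pi_ge2 R; rewrite expr2 => h; nra.
have n0 : 0 <= u ^+ 2 + v ^+ 2 by rewrite addr_ge0 ?sqr_ge0.
have le : u ^+ 2 + v ^+ 2 <= t2 * E.
  have [n1|n1] := eqVneq (u ^+ 2 + v ^+ 2) 0; first by rewrite n1; apply: le_trans c2; rewrite addr_ge0 ?sqr_ge0.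
  have np : 0 < u ^+ 2 + v ^+ 2 by rewrite lt_neqAle eq_sym n1.
  apply: le_trans c2.
  have CS : (s * u + b * v) ^+ 2 <= (s ^+ 2 + b ^+ 2) * (u ^+ 2 + v ^+ 2).
    have := sqr_ge0 (s * v - b * u); rewrite -subr_ge0 => h; rewrite -subr_ge0.
    by apply: le_trans h _; rewrite le_eqVlt; apply/orP; left; apply/eqP; ring.
  have e : 4 * pi ^+ 2 * (u ^+ 2 + v ^+ 2) ^+ 2 = (s * u + b * v) ^+ 2.
    have p0 : 4 * pi ^+ 2 != 0 :> R by apply/eqP; lra.
    apply: (mulfI p0); transitivity ((4 * pi ^+ 2 * (u ^+ 2 + v ^+ 2)) ^+ 2); first by ring.
    by rewrite qa; ring.
  rewrite -(ler_pM2r np); apply: le_trans CS; rewrite -e.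
  have : 0 <= (u ^+ 2 + v ^+ 2) * (u ^+ 2 + v ^+ 2) by rewrite mulr_ge0.
  by rewrite -expr2 => z0; rewrite -[leLHS]mul1r ler_wpM2r.
split.
  rewrite -(ler_pM2l t20); apply: le_trans le.
  by have := sqr_ge0 v; rewrite uE => h; have -> : t2 * (t2 * k0 ^+ 2) = (t2 * k0) ^+ 2 by [ring]; lra.
by apply: le_trans le; rewrite lerDr sqr_ge0.
Qed.

End ModeAlgebra.

Lemma normr_int_le_sqr {R : realType} (m : int) : `|m%:~R| <= m%:~R ^+ 2 :> R.
Proof.
rewrite -intr_norm -rmorphXn /= ler_int expr2.
have [->|m0] := eqVneq m 0; first by rewrite normr0 mulr0.
have h : (1 <= `|m|)%R by lia.
have <- : `|m| * `|m| = m * m by rewrite -normrM ger0_norm// -expr2 sqr_ge0.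
by rewrite ler_peMr.
Qed.

Lemma sqr_int_ge1 {R : realType} (m : int) : m != 0 -> 1 <= m%:~R ^+ 2 :> R.
Proof.
move=> m0; apply: le_trans (normr_int_le_sqr m).
by rewrite -intr_norm -[1]/(1%:~R) ler_int; lia.
Qed.

Lemma cc_comb {R : realType} i (a b : R) (X Y Z : C2 R) :
  cc i (a *: X - b *: Y + Z) = a * cc i X - b * cc i Y + cc i Z.
Proof. by rewrite linearD linearB !linearZ. Qed.

Lemma cc_NJ {R : realType} l b (x y : R) (X Y : C2 R) :
  cc (l, b) (- Jstd (x *: X + y *: Y)) =
  (if b then - x else x) * cc (l, ~~ b) X + (if b then - y else y) * cc (l, ~~ b) Y.
Proof.
have -> Z : cc (l, b) (- Jstd Z) = (if b then -1 else 1) * cc (l, ~~ b) Z :> R.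
  by rewrite linearN /=; case: b; rewrite /cc /= ?mxE ?mulN1r ?mul1r ?opprK.
have Z (a : R) i U : cc i (a *: U) = a * cc i U by exact: linearZ.
by rewrite linearD /= !Z; case: b => /=; ring.
Qed.

Section ModeBounds.
Context {R : realType}.
Variables (t1 t2 E A : R) (c : R * R) (F : R * R -> C2 R).
Hypotheses (t20 : 0 < t2) (t1_half : - (1 / 2) <= t1 <= 1 / 2) (tt1 : 1 <= t1 ^+ 2 + t2 ^+ 2)
  (pF : periodic F) (sF : smooth F) (cF : conformal_to t1 t2 F) (fF : finite_zeros F)
  (pde : hsl_pde t1 t2 c F)
  (cE : t2 * (c.1 * c.1) + t2^-1 * ((c.2 - t1 * c.1) * (c.2 - t1 * c.1)) <= E)
  (areaF : (area F <= A%:E)%E).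

Let f i p : R := cc i (F p).
Let fd i j p : R := cc i (grad F j p).
Let fdd i j l p : R := cc i (hess F j l p).

Let pf i : periodic (f i).
Proof. by move=> p; rewrite /f; have [-> ->] := pF p. Qed.
Let pfd i j : periodic (fd i j).
Proof. move=> p; have [h1 h2] := periodic_partials [:: j] pF p.
exact: (conj (congr1 (cc i) h1) (congr1 (cc i) h2)). Qed.
Let cf i : continuous (f i).
Proof. exact: continuous_cc (smooth_continuous sF). Qed.
Let cfd i j : continuous (fd i j).
Proof. exact: continuous_cc (smooth_continuous (smooth_partials [:: j] sF)). Qed.
Let cfdd i j l : continuous (fdd i j l).
Proof. exact: continuous_cc (smooth_continuous (smooth_partials [:: j; l] sF)). Qed.
Let df i j p : is_derive p (stdbasis j) (f i) (fd i j p).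
Proof. exact: is_derive_cc (smooth_is_derive j p sF). Qed.
Let dfd i j l p : is_derive p (stdbasis j) (fd i l) (fdd i j l p).
Proof. exact: is_derive_cc (smooth_is_derive j p (smooth_partials [:: l] sF)). Qed.

Let x := (t1 ^+ 2 + t2 ^+ 2) * c.1 - t1 * c.2.
Let y := c.2 - t1 * c.1.

Lemma pde_cc (l : 'I_2) b p :
  ((t1 ^+ 2 + t2 ^+ 2) * fdd (l, b) ord0 ord0 p - (2 * t1) * fdd (l, b) ord0 ord_max p) + fdd (l, b) ord_max ord_max p =
  (if b then - x else x) * fd (l, ~~ b) ord0 p + (if b then - y else y) * fd (l, ~~ b) ord_max p.
Proof.
have := pde p; rewrite /conj_laplacian -/x -/y => /(congr1 (cc (l, b))) e.
exact: etrans (esym (cc_comb _ _ _ _ _ _)) (etrans e (cc_NJ _ _ _ _ _ _)).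
Qed.

(** The equation couples the coordinates (l, false) and (l, true). *)
Lemma moment_cc_vanish k : ~ (t2 * freq ord0 k ^+ 2 <= E /\ (freq ord_max k - t1 * freq ord0 k) ^+ 2 <= t2 * E) ->
  forall i t, moment (f i) k t = 0.
Proof.
move=> nk i t.
pose q := 4 * pi ^+ 2 * ((t1 ^+ 2 + t2 ^+ 2) * freq ord0 k ^+ 2 - 2 * t1 * freq ord0 k * freq ord_max k + freq ord_max k ^+ 2).
pose a := 2 * pi * (x * freq ord0 k + y * freq ord_max k).
have qa : q ^+ 2 != a ^+ 2.
  by apply/eqP => qa; apply: nk; exact: (resonance_bound t20 cE qa).
have L l b s : q * moment (f (l, b)) k s = (if b then -1 else 1) * (a * moment (f (l, ~~ b)) k (s + pi / 2)).
  have h1 := @moment_lap _ (f (l, b)) (fd (l, b)) (fdd (l, b)) (@pf _) (@pfd _) (@cf _) (@cfd _) (@cfdd _) (@df _) (@dfd _) (t1 ^+ 2 + t2 ^+ 2) (2 * t1) 0 k s.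
  have h2 := @moment_lin _ (f (l, ~~ b)) (fd (l, ~~ b)) (@pf _) (@cf _) (@cfd _) (@df _) (if b then - x else x) (if b then - y else y) k s.
  have h3 : moment (fun p => ((t1 ^+ 2 + t2 ^+ 2) * fdd (l, b) ord0 ord0 p - (2 * t1) * fdd (l, b) ord0 ord_max p) + fdd (l, b) ord_max ord_max p) k s =
     moment (fun p => (if b then - x else x) * fd (l, ~~ b) ord0 p + (if b then - y else y) * fd (l, ~~ b) ord_max p) k s.
    by congr moment; apply/funext => p; exact: pde_cc.
  move: h1; rewrite h3 h2 /q /a; move: (moment _ _ _) (moment _ _ _) => m m'.
  by clear h2 h3; case: b => /=; lra.
have [] := @paired_moments R q a (moment (f (i.1, false)) k) (moment (f (i.1, true)) k) _ _ _ _ qa t.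
- by move=> s; exact: moment_pi.
- by move=> s; exact: moment_pi.
- by move=> s; rewrite L mul1r.
- by move=> s; rewrite L mulN1r.
by case: i => l [] /=.
Qed.

Lemma energy_bound_ge0 : 0 <= E.
Proof. by apply: le_trans cE; rewrite -!expr2 addr_ge0// mulr_ge0 ?sqr_ge0 ?invr_ge0 ?(ltW t20). Qed.

(** If E < t2 then the moments of frequency k vanish unless k.1 = 0.  Then F does not
    depend on the first variable, and its induced metric vanishes identically. *)
Lemma t2_le : t2 <= E.
Proof.
rewrite leNgt; apply/negP => Et.
have K k i t : freq ord0 k != 0 :> R -> moment (f i) k t = 0.
  move=> k0; apply: moment_cc_vanish => -[h _].
  have k1 : 1 <= (freq ord0 k : R) ^+ 2.
    by move: k0; rewrite /freq /= intr_eq0 => k0; exact: sqr_int_ge1.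
  have : t2 * 1 <= t2 * freq ord0 k ^+ 2 by rewrite ler_pM2l.
  by rewrite mulr1 => h'; have := le_trans h' h; rewrite leNgt Et.
have z i p : fd i ord0 p = 0.
  move: p; apply: (fourier_unique (@pfd i ord0) (@cfd i ord0)) => k t.
  have := @moment_grad _ (f i) (fd i) (@pf _) (@cf _) (@cfd _) (@df _) ord0 k t.
  rewrite /moment => ->; have [->|k0] := eqVneq (freq ord0 k : R) 0; first by rewrite mulr0 oppr0 mul0r.
  by rewrite -/(moment _ _ _) K// mulr0.
have g0 p : grad F ord0 p = 0.
  by apply: C2_eq; rewrite /c1 /c2 /c3 /c4 [RHS]linear0; exact: z.
have d0 p : density F p = 0.
  by rewrite /density g0 gbarE /c1 /c2 /c3 /c4 !linear0 !mulr0 !addr0.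
have : (1 : R) = 0.
  apply: (@vanish_off_finite R (density F) (fun=> 1) fF _ _ _ (0, 0)) => //.
    by move=> p; exact: cvg_cst.
  by move=> p; rewrite d0 eqxx.
by move/eqP; rewrite oner_eq0.
Qed.

(** The parameters lie in the standard fundamental domain of the modular group. *)
Lemma t2_ge : 1 / 2 <= t2.
Proof.
move: tt1 t1_half => h /andP[h1 h2]; rewrite leNgt; apply/negP => h3.
have : 0 <= (1 / 2 - t1) * (t1 + 1 / 2) by rewrite mulr_ge0; lra.
have : 0 <= (1 / 2 - t2) * (t2 + 1 / 2) by have h4 := t20; apply: mulr_ge0; lra.
lra.
Qed.

Lemma high_modes M : 2 * E <= M%:R -> forall k, ~~ low_mode M k -> forall i t, moment (f i) k t = 0.
Proof.
move=> EM k nk; apply: moment_cc_vanish; apply: contraNnot nk => -[h0 h1].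
have tE := t2_le; have tg := t2_ge; have e0 := energy_bound_ge0.
have k0 : `|freq ord0 k| <= 2 * E :> R.
  apply: le_trans (normr_int_le_sqr k.1) _.
  move: h0; rewrite /freq /=; move: (k.1%:~R ^+ 2) (sqr_ge0 (k.1%:~R : R)) => z z0 h0; nra.
have k1 : `|freq ord_max k| <= 2 * E :> R.
  have v : `|freq ord_max k - t1 * freq ord0 k| <= E :> R.
    rewrite -(@ler_pXn2r _ 2) ?nnegrE// real_normK ?num_real//; apply: le_trans h1 _.
    by rewrite expr2 ler_wpM2r.
  have w : `|t1 * freq ord0 k| <= 1 / 2 * (2 * E).
    rewrite normrM ler_pM// ler_norml; by case/andP: t1_half => *; apply/andP; split; lra.
  have -> : freq ord_max k = (freq ord_max k - t1 * freq ord0 k) + t1 * freq ord0 k :> R by ring.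
  apply: le_trans (ler_normD _ _) _; lra.
move: k0 k1; rewrite /freq /= -!intr_norm => k0 k1.
have C (m : int) : (`|m|%:~R : R) <= 2 * E -> `|m| <= M%:Z.
  by move=> h; rewrite -(@ler_int R); apply: le_trans h _; exact: EM.
by rewrite /low_mode !C.
Qed.

Lemma continuous_density : continuous (density F).
Proof. by apply: continuous_gbar; exact: smooth_continuous (smooth_partials [:: ord0] sF). Qed.

Lemma mean_density : mean (density F) <= 2 * A.
Proof.
have sd := continuous_summable continuous_density.
have aE : area F = (t2 * mean (density F))%:E.
  rewrite -meanZ//; move: (summableZ t2 sd) => sz.
  rewrite /mean /Rintegral fineK; last exact: (integrable_fin_num square_measurable sz).
  rewrite /area /torus_integral -/square; apply: eq_integral => p _.
  by rewrite (area_densityE p t20 cF) mulrC.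
move: areaF; rewrite aE lee_fin => h; have tg := t2_ge.
have m0 : 0 <= mean (density F).
  by rewrite -(mean_cst 0); apply: le_mean => //; [exact: continuous_summable (@cst_continuous _ _ _)|move=> p _; exact: density_ge0].
by move: (mean _) h m0 => m h m0; nra.
Qed.

Lemma cc_sqr_le i X : cc i X ^+ 2 <= gbar X X :> R.
Proof.
rewrite gbarE -!expr2; have h1 := sqr_ge0 (c1 X); have h2 := sqr_ge0 (c2 X); have h3 := sqr_ge0 (c3 X); have h4 := sqr_ge0 (c4 X).
case: i => l b; case: (ord2P l) => ->; case: b; rewrite -1?/(c1 X) -1?/(c2 X) -1?/(c3 X) -1?/(c4 X); lra.
Qed.

(** One of the components of k has absolute value at least 1, so by an integration by
    parts the moment is bounded by the mean of a first derivative, and thus by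
    the area. *)
Lemma moment_bound k i t : k != (0, 0) -> `|moment (f i) k t| <= 1 + (5 / 4 + E ^+ 2) * (2 * A).
Proof.
move=> k0.
have [j kj] : exists j, 1 <= `|freq j k| :> R.
  have S (m : int) : m != 0 -> 1 <= `|m%:~R| :> R by move=> m0; rewrite -intr_norm -[1]/(1%:~R) ler_int; lia.
  have [e|n] := eqVneq k.1 0; last by exists ord0; exact: S.
  exists ord_max; apply: S; apply: contraNneq k0 => e2; by case: (k) e e2 => a b /= -> ->.
have D s : `|moment (fd i j) k s| <= 1 + (5 / 4 + E ^+ 2) * (2 * A).
  have cw : continuous (wave k s : R * R -> R) by exact: wave_continuous.
  have sm : summable (fun p => fd i j p * wave k s p).
    by apply: continuous_summable; apply: continuous_mul => //; exact: cfd.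
  have sd := continuous_summable continuous_density.
  apply: le_trans (le_normr_mean sm) _.
  have K1 : t1 ^+ 2 + t2 ^+ 2 <= 1 / 4 + E ^+ 2.
    have := t2_le; have := t20; have : t1 ^+ 2 <= 1 / 4.
      have [h1 h2] := andP t1_half; have : 0 <= (1 / 2 - t1) * (t1 + 1 / 2) by apply: mulr_ge0; lra.
      lra.
    by have := energy_bound_ge0; move: (t1 ^+ 2) => z e0 z0 tp tE; have : t2 ^+ 2 <= E ^+ 2 by [rewrite ler_pXn2r ?nnegrE// ltW]; lra.
  have P p : `|fd i j p * wave k s p| <= 1 + (5 / 4 + E ^+ 2) * density F p.
    have h1 : fd i j p ^+ 2 <= (5 / 4 + E ^+ 2) * density F p.
      apply: le_trans (cc_sqr_le i (grad F j p)) _.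
      have d0 := density_ge0 F p; have [_ e11] := cF p; have E2 := sqr_ge0 E.
      case: (ord2P j) => ->; last by rewrite e11 mulrC ler_wpM2r//; lra.
      by rewrite -/(density F p) -[leLHS]mul1r ler_wpM2r//; lra.
    rewrite normrM; apply: le_trans (_ : `|fd i j p| <= _).
      by rewrite ler_piMr// wave_norm.
    apply: le_trans (lerD (lexx 1) h1); rewrite -real_normK ?num_real//.
    by have := sqr_ge0 (`|fd i j p| - 1); move: (normr_ge0 (fd i j p)) => /[swap]; rewrite sqrrB1; move: `|_| => z; lra.
  apply: le_trans (_ : mean (fun p => 1 + (5 / 4 + E ^+ 2) * density F p) <= _).
    apply: le_mean; [exact: summable_norm| |by move=> p _; exact: P].
    by apply: summableD; [exact: continuous_summable (@cst_continuous _ _ _)|exact: summableZ].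
  rewrite meanD; [|exact: continuous_summable (@cst_continuous _ _ _)|exact: summableZ].
  rewrite mean_cst meanZ// lerD2l ler_wpM2l ?mean_density//; have := sqr_ge0 E; lra.
have := @moment_grad _ (f i) (fd i) (@pf _) (@cf _) (@cfd _) (@df _) j k (t - pi / 2).
rewrite subrK => e; apply: le_trans (D (t - pi / 2)); rewrite e normrM ler_peMl// normrN !normrM.
have p2 : 1 <= `|2 * pi| :> R by rewrite ger0_norm; have := pi_ge2 R; lra.
by rewrite -normrM; apply: le_trans p2 _; rewrite ler_peMr.
Qed.

End ModeBounds.

(** * Unique continuation from an accumulation of critical points *)
Section IteratedRolle.
Context {R : realType}.
Variables (g : nat -> R -> R).
Hypotheses (dg : forall k (t : R), is_derive t 1 (g k) (g k.+1 t)).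

Lemma derive_continuous k : continuous (g k).
Proof. by move=> t; apply: differentiable_continuous; apply/derivable1_diffP; have [] := dg k t. Qed.

Lemma rolle_iter m : (forall k, (k < m)%N -> g k 0 = 0) -> g 0 1 = 0 -> exists2 t, 0 < t <= 1 & g m t = 0.
Proof.
move=> g0 g1; elim: m g0 => [|m IH] g0; first by exists 1 => //; rewrite ltr01 lexx.
have [|t /andP[t0 t1] gt] := IH; first by move=> k km; apply: g0; exact: ltnW.
have [|||x] := @Rolle R (g m) 0 t t0.
- by move=> x _; have [] := dg m x.
- by apply: continuous_subspaceT; exact: derive_continuous.
- by rewrite g0// gt.
rewrite in_itv /= => /andP[x0 xt] [_ dx]; exists x; first by rewrite x0 (le_trans (ltW xt) t1).
by have [_ <-] := dg m x.
Qed.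

End IteratedRolle.

Section Tower.
Context {R : realType} {I : Type}.
(* D i s p stands for the derivative at p of the i-th component in the directions s.
   By harm the components are harmonic for the orthonormal frame v1, v2, modulo
   derivatives of lower order. *)
Variables (D : I -> seq (R * R) -> R * R -> R) (C L : R) (sz : R * R -> R) (v1 v2 : R * R).
Hypotheses (dD : forall i s v p, is_derive p v (D i s) (D i (v :: s) p))
  (DC : forall i s s' p, perm_eq s s' -> D i s p = D i s' p)
  (Dlin : forall i a b v w s p, D i ((a *: v + b *: w) :: s) p = a * D i (v :: s) p + b * D i (w :: s) p)
  (C0 : 0 <= C) (L0 : 0 <= L) (sz0 : forall v, 0 <= sz v) (szZ : forall a v, sz (a *: v) = `|a| * sz v)
  (Dbound : forall i s p, `|D i s p| <= C * \prod_(v <- s) sz v)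
  (harm : forall m p, (forall i s, size s = m.+1 -> D i s p = 0) ->
     forall i s, size s = m -> D i (v1 :: v1 :: s) p + D i (v2 :: v2 :: s) p = 0)
  (span : forall v, exists a b, v = a *: v1 + b *: v2 /\ sz v ^+ 2 <= L * (a ^+ 2 + b ^+ 2)).

Definition stationary p := forall i v, D i [:: v] p = 0.
Definition flat p := forall i s, s != [::] -> D i s p = 0.

(** Restriction to a line turns D into a sequence of functions of one variable, each
    the derivative of the preceding one. *)
Lemma is_derive_segment i s p w (t : R) : is_derive t 1 (fun t => D i s (p + t *: w)) (D i (w :: s) (p + t *: w)).
Proof.
have /is_derive_lineP h := dD i s w (p + t *: w).
apply/is_derive_lineP; apply: is_derive_ext h => h.
by congr (D i s _); rewrite addrC -addrA -scalerDl; congr (_ + _ *: _); rewrite addrC [h *: 1]mulr1.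
Qed.

Lemma mvt_segment i s p w : exists2 t, 0 <= t <= 1 & D i s (p + w) - D i s p = D i (w :: s) (p + t *: w).
Proof.
have [||t] := @MVT_segment R (fun t => D i s (p + t *: w)) (fun t => D i (w :: s) (p + t *: w)) 0 1 ler01.
- by move=> t _; exact: is_derive_segment.
- apply: continuous_subspaceT => t; apply: differentiable_continuous; apply/derivable1_diffP.
  by have [] := is_derive_segment i s p w t.
by rewrite in_itv /= scale1r scale0r addr0 subr0 mulr1 => t01 e; exists t.
Qed.

Lemma Dscale i a v s p : D i (a *: v :: s) p = a * D i (v :: s) p.
Proof. by have := Dlin i a 0 v v s p; rewrite scale0r addr0 mul0r addr0. Qed.

(** Each use of the mean value theorem from p, where D vanishes, gains a factor sz w,
    and the bound on D grows with order only through the directions. *)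
Lemma flat_small p w : flat p -> sz w <= 1 / 2 -> flat (p + w).
Proof.
move=> fp w2.
suff K k i s t : s != [::] -> 0 <= t <= 1 -> `|D i s (p + t *: w)| <= C * (\prod_(v <- s) sz v) * (sz w) ^+ k.
  move=> i s s0; have B k : `|D i s (p + w)| <= C * (\prod_(v <- s) sz v) * (1 / 2) ^+ k.
    rewrite -[w in p + w]scale1r; apply: le_trans (K k i s 1 s0 _) _; first by rewrite ler01 lexx.
    apply: ler_wpM2l; last by rewrite lerXn2r ?nnegrE//; lra.
    by rewrite mulr_ge0// prodr_ge0.
  apply/eqP; rewrite -normr_eq0; apply/eqP/le_anti; rewrite normr_ge0 andbT.
  have cv : (fun k => C * (\prod_(v <- s) sz v) * (1 / 2) ^+ k) @ \oo --> (0 : R).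
    rewrite -[X in _ --> X](mulr0 (C * (\prod_(v <- s) sz v))); apply: cvgM; first exact: cvg_cst.
    by apply: cvg_expr; rewrite ger0_norm; lra.
  by apply: (cvgr_to_ge cv); apply: nearW => k; exact: B.
elim: k i s t => [|k IH] i s t s0 t01; first by rewrite expr0 mulr1.
have [u /andP[u0 u1]] := mvt_segment i s p (t *: w).
rewrite (fp i s s0) subr0 => ->; rewrite Dscale normrM scalerA.
have t1 : `|t| <= 1 by case/andP: t01 => t0 t1; rewrite ger0_norm.
apply: le_trans (_ : `|D i (w :: s) (p + (u * t) *: w)| <= _); first by rewrite ler_piMl.
apply: le_trans (IH i (w :: s) (u * t) _ _) _ => //.
  by case/andP: t01 => t0 t2; rewrite mulr_ge0// mulr_ile1.
by rewrite big_cons exprS le_eqVlt; apply/orP; left; apply/eqP; ring.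
Qed.

Lemma flat_everywhere p q : flat p -> flat q.
Proof.
move=> fp; have [N N0] : exists N : nat, sz (q - p) <= N.+1%:R / 2.
  have := archi_boundP (mulr_ge0 (ler0n R 2) (sz0 (q - p))); set N := Num.bound _ => h.
  by exists N; rewrite -natr1; lra.
have K n : flat (p + n%:R *: (N.+1%:R^-1 *: (q - p))).
  elim: n => [|n IH]; first by rewrite scale0r addr0.
  rewrite -natr1 scalerDl scale1r addrA; apply: flat_small => //.
  by rewrite szZ ger0_norm ?invr_ge0// ler_pdivrMl// mulrC; lra.
have := K N.+1; rewrite scalerA divff ?pnatr_eq0// scale1r addrC subrK.
exact.
Qed.

(** At p0 a derivative along w = a *: v1 + b *: v2 of the pair of derivatives along v1
    and v2 is a rotation composed with a homothety, as for the complex derivative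
    of a holomorphic function: the components are harmonic there modulo
    derivatives that vanish. *)
Lemma rotation_identity m p0 (a b : R) i : (forall i s, size s = m -> s != [::] -> D i s p0 = 0) ->
  let w := a *: v1 + b *: v2 in
  D i (nseq m w ++ [:: v1]) p0 ^+ 2 + D i (nseq m w ++ [:: v2]) p0 ^+ 2 =
  (a ^+ 2 + b ^+ 2) ^+ m * (D i (nseq m v1 ++ [:: v1]) p0 ^+ 2 + D i (nseq m v1 ++ [:: v2]) p0 ^+ 2).
Proof.
move=> low w.
pose U n := D i (nseq n w ++ nseq (m - n) v1 ++ [:: v1]) p0.
pose W n := D i (nseq n w ++ nseq (m - n) v1 ++ [:: v2]) p0.
have step n : (n < m)%N -> U n.+1 = a * U n + b * W n /\ W n.+1 = a * W n - b * U n.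
  move=> nm; have mE : (m - n = (m - n.+1).+1)%N by lia.
  set s := nseq n w ++ nseq (m - n.+1) v1.
  have ss : size s = m.-1 by rewrite size_cat !size_nseq; lia.
  have H : D i (v1 :: v1 :: s) p0 + D i (v2 :: v2 :: s) p0 = 0.
    have m0 : m.-1.+1 = m by rewrite prednK//; exact: leq_ltn_trans (leq0n n) nm.
    by apply: (@harm m.-1 p0 _ i s ss) => j s'; rewrite m0 => s'm; apply: low => //; case: s' s'm m0 => // <-.
  have P (A : seq (R * R)) u : perm_eq (nseq n w ++ nseq (m - n) v1 ++ [:: u]) (u :: v1 :: s).
    apply/permP => f; rewrite !count_cat mE /= !count_cat /=; lia.
  have P' u : perm_eq (nseq n.+1 w ++ nseq (m - n.+1) v1 ++ [:: u]) (w :: u :: s).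
    apply/permP => f; rewrite !count_cat /= !count_cat /=; lia.
  have P2 : perm_eq (v2 :: v1 :: s) (v1 :: v2 :: s) by apply/permP => f /=; lia.
  rewrite /U /W !(DC _ _ (P [::] _)) !(DC _ _ (P' _)) /w !Dlin (DC _ _ P2); split; first by [].
  by rewrite (_ : D i (v2 :: v2 :: s) p0 = - D i (v1 :: v1 :: s) p0); [ring|lra].
have K n : (n <= m)%N -> U n ^+ 2 + W n ^+ 2 = (a ^+ 2 + b ^+ 2) ^+ n * (U 0 ^+ 2 + W 0 ^+ 2).
  elim: n => [|n IH] nm; first by rewrite expr0 mul1r.
  have [-> ->] := step n nm; transitivity ((a ^+ 2 + b ^+ 2) * (U n ^+ 2 + W n ^+ 2)); first by ring.
  by rewrite IH ?(ltnW nm)// [in RHS]exprS mulrA.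
by have := K m (leqnn m); rewrite /U /W subnn subn0.
Qed.

(** By induction on the order.  If all derivatives of order at most m vanish at p0 and
    p0 + w is stationary, Rolle's theorem on the segment between them gives a
    zero of the derivatives of order m + 1 along w, so that at p0 these are
    of size sz w ^+ m.+1 at most.  By rotation_identity they are of size sz w ^+ m
    times a quantity independent of w, which must then be 0. *)
Lemma accumulation_flat p0 :
  (forall e, 0 < e -> exists w, [/\ w != 0, sz w < e & stationary (p0 + w)]) -> flat p0.
Proof.
move=> acc.
suff K m i s : size s = m.+1 -> D i s p0 = 0 by move=> i s; case: s => // v s _; exact: (K (size s)).
elim/ltn_ind: m i s => m IH.
have low i s : size s = m -> s != [::] -> D i s p0 = 0.
  by case: m IH => [|m] IH sm s0; [case: s sm s0|exact: (IH m)].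
have X0 i : D i (nseq m v1 ++ [:: v1]) p0 = 0 /\ D i (nseq m v1 ++ [:: v2]) p0 = 0.
  set x := D _ _ _; set y := D _ _ _.
  suff: x ^+ 2 + y ^+ 2 <= 0.
    by have := sqr_ge0 x; have := sqr_ge0 y => hy hx h; split; apply/eqP; rewrite -sqrf_eq0; apply/eqP; lra.
  pose K := C ^+ 2 * (sz v1 ^+ 2 + sz v2 ^+ 2) * L ^+ m.
  have K0 : 0 <= K by rewrite !mulr_ge0 ?exprn_ge0// addr_ge0 ?sqr_ge0.
  have bound e : 0 < e -> x ^+ 2 + y ^+ 2 <= K * e ^+ 2.
    move=> /acc[w [w0 we st]].
    have [a [b [wE wL]]] := span w.
    have r0 : 0 < a ^+ 2 + b ^+ 2.
      rewrite lt_neqAle addr_ge0 ?sqr_ge0// andbT eq_sym; apply: contraNneq w0 => /eqP.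
      rewrite paddr_eq0 ?sqr_ge0// !sqrf_eq0 => /andP[/eqP a0 /eqP b0].
      by rewrite wE a0 b0 !scale0r addr0.
    have B u : `|D i (nseq m w ++ [:: u]) p0| <= C * (sz w ^+ m.+1 * sz u).
      have [|||t /andP[t0 t1] gt] := @rolle_iter R (fun k t => D i (nseq k w ++ [:: u]) (p0 + t *: w)) _ m.
      - by move=> k t; exact: is_derive_segment.
      - move=> k km; rewrite scale0r addr0; apply: (IH k km); rewrite size_cat size_nseq /=; lia.
      - by rewrite scale1r; exact: st.
      have [z _] := mvt_segment i (nseq m w ++ [:: u]) p0 (t *: w).
      rewrite gt sub0r => /(congr1 (fun z => `|z|)); rewrite normrN => ->.
      rewrite Dscale normrM gtr0_norm//.
      apply: le_trans (_ : `|D i (w :: nseq m w ++ [:: u]) (p0 + z *: (t *: w))| <= _); first by rewrite ler_piMl.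
      apply: le_trans (Dbound _ _ _) _; apply: ler_wpM2l => //.
      by rewrite big_cons big_cat big_seq1 big_nseq iter_mulr_1 /= mulrA exprS lexx.
    have sq u : D i (nseq m w ++ [:: u]) p0 ^+ 2 <= C ^+ 2 * (sz u ^+ 2 * (sz w ^+ 2) ^+ m.+1).
      rewrite -real_normK ?num_real//.
      apply: le_trans (_ : (C * (sz w ^+ m.+1 * sz u)) ^+ 2 <= _).
        by rewrite lerXn2r ?nnegrE ?mulr_ge0 ?exprn_ge0.
      by rewrite (exprAC (sz w)); move: (sz w ^+ m.+1) => z; rewrite le_eqVlt; apply/orP; left; apply/eqP; ring.
    have rot := @rotation_identity m p0 a b i low; rewrite /= -wE -/x -/y in rot.
    rewrite -(ler_pM2l (exprn_gt0 m r0)) -rot.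
    apply: le_trans (lerD (sq v1) (sq v2)) _.
    have -> : C ^+ 2 * (sz v1 ^+ 2 * (sz w ^+ 2) ^+ m.+1) + C ^+ 2 * (sz v2 ^+ 2 * (sz w ^+ 2) ^+ m.+1) =
       (C ^+ 2 * (sz v1 ^+ 2 + sz v2 ^+ 2)) * (sz w ^+ 2 * (sz w ^+ 2) ^+ m) by rewrite -exprS; ring.
    have -> : (a ^+ 2 + b ^+ 2) ^+ m * (K * e ^+ 2) = (C ^+ 2 * (sz v1 ^+ 2 + sz v2 ^+ 2)) * (e ^+ 2 * (L * (a ^+ 2 + b ^+ 2)) ^+ m).
      by rewrite exprMn /K; ring.
    apply: ler_wpM2l; first by rewrite mulr_ge0 ?sqr_ge0// addr_ge0 ?sqr_ge0.
    apply: ler_pM; rewrite ?sqr_ge0 ?exprn_ge0 ?sqr_ge0//.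
      by rewrite lerXn2r ?nnegrE// ?ltW// (le_lt_trans (sz0 w) we).
    by rewrite lerXn2r ?nnegrE ?sqr_ge0// mulr_ge0// ltW.
  rewrite leNgt; apply/negP => X0.
  pose e := Num.min 1 ((x ^+ 2 + y ^+ 2) / (2 * (K + 1))).
  have e0 : 0 < e by rewrite /e lt_min ltr01 divr_gt0//; lra.
  have e1 : e <= 1 by rewrite /e ge_min lexx.
  have e2 : (K + 1) * e <= (x ^+ 2 + y ^+ 2) / 2.
    apply: le_trans (_ : (K + 1) * ((x ^+ 2 + y ^+ 2) / (2 * (K + 1))) <= _).
      by rewrite ler_wpM2l ?ge_min ?lexx ?orbT//; lra.
    by rewrite le_eqVlt; apply/orP; left; apply/eqP; field; apply/eqP; lra.
  have := bound e e0; have : K * e ^+ 2 <= K * e by rewrite ler_wpM2l// expr2 ler_piMr// ltW.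
  clearbody e; lra.
(* any direction may be replaced by v1 and v2, and two v2 by two v1 up to sign *)
have word n i s : (n <= m)%N -> size s = n -> D i (s ++ nseq (m - n) v1 ++ [:: v1]) p0 = 0 /\ D i (s ++ nseq (m - n) v1 ++ [:: v2]) p0 = 0.
  elim: n s => [|n IHn] s nm.
    by move/eqP; rewrite size_eq0 => /eqP ->; rewrite subn0; exact: X0.
  case: s => // v s [sn]; have [a [b [-> _]]] := span v.
  have [h1 h2] := IHn s (ltnW nm) sn.
  have mE : (m - n = (m - n.+1).+1)%N by lia.
  have P u : perm_eq (v1 :: s ++ nseq (m - n.+1) v1 ++ [:: u]) (s ++ nseq (m - n) v1 ++ [:: u]).
    by apply/permP => f; rewrite mE /= !count_cat /= !count_cat /=; lia.
  have P' : perm_eq (v2 :: s ++ nseq (m - n.+1) v1 ++ [:: v1]) (s ++ nseq (m - n) v1 ++ [:: v2]).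
    by apply/permP => f; rewrite mE /= !count_cat /= !count_cat /=; lia.
  have P1 : perm_eq (v1 :: v1 :: s ++ nseq (m - n.+1) v1) (s ++ nseq (m - n) v1 ++ [:: v1]).
    by apply/permP => f; rewrite mE /= !count_cat /= !count_cat /=; lia.
  have P2 : perm_eq (v2 :: s ++ nseq (m - n.+1) v1 ++ [:: v2]) (v2 :: v2 :: s ++ nseq (m - n.+1) v1).
    by apply/permP => f; rewrite /= !count_cat /=; lia.
  have H : D i (v1 :: v1 :: s ++ nseq (m - n.+1) v1) p0 + D i (v2 :: v2 :: s ++ nseq (m - n.+1) v1) p0 = 0.
    apply: (harm (m := m.-1)); last by rewrite size_cat size_nseq; lia.
    have m0 : m.-1.+1 = m by rewrite prednK//; exact: leq_ltn_trans (leq0n n) nm.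
    by move=> j s'; rewrite m0 => s'm; apply: low => //; case: s' s'm m0 => // <-.
  rewrite /= !Dlin !(DC _ _ (P _)) (DC _ _ P') h1 h2 (DC _ _ P2).
  by move: H; rewrite (DC _ _ P1) h1 add0r => ->; rewrite !mulr0 addr0.
move=> i [//|v s] [sm]; have [a [b [-> _]]] := span v.
have [h1 h2] := word m i s (leqnn m) sm; rewrite subnn /= in h1 h2.
have P u : perm_eq (u :: s) (s ++ [:: u]) by rewrite perm_sym perm_catC.
by rewrite Dlin !(DC _ _ (P _)) h1 h2 !mulr0 addr0.
Qed.

End Tower.

(** * Trigonometric maps *)
Section Assemble.
Context {R : realType}.
Implicit Types (f : 'I_2 * bool -> R) (X : C2 R).

Definition cvec (i : 'I_2 * bool) : C2 R :=
  (\row_j ((i == (j, false))%:R : R), \row_j ((i == (j, true))%:R : R)).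

Lemma cc_cvec i j : cc j (cvec i) = (i == j)%:R.
Proof. by case: j => j []; rewrite /cc /= mxE. Qed.

Definition assemble f : C2 R := \sum_i f i *: cvec i.

Lemma cc_assemble f j : cc j (assemble f) = f j.
Proof.
rewrite /assemble linear_sum /= (bigD1 j)//= big1 ?addr0.
  by rewrite linearZ /= cc_cvec eqxx /GRing.scale /= mulr1.
by move=> i ij; rewrite linearZ /= cc_cvec (negbTE ij) /GRing.scale /= mulr0.
Qed.

Lemma C2_ext X Y : (forall i, cc i X = cc i Y) -> X = Y.
Proof. by move=> h; apply: C2_eq; exact: h. Qed.

Lemma assembleK X : assemble (fun i => cc i X) = X.
Proof. by apply: C2_ext => i; rewrite cc_assemble. Qed.

Lemma is_derive_sumf (I : Type) (r : seq I) (W : normedModType R) (f : I -> R * R -> W) (g : I -> W) (p v : R * R) :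
  (forall i, is_derive p v (f i) (g i)) ->
  is_derive p v (fun q => \sum_(i <- r) f i q) (\sum_(i <- r) g i).
Proof.
move=> h; elim: r => [|i r IH].
  rewrite big_nil; apply: (@is_derive_ext _ _ _ (fun=> 0)) => q.
  by rewrite big_nil.
rewrite big_cons; apply: (@is_derive_ext _ _ _ (f i + (fun q => \sum_(i <- r) f i q))).
by move=> q; rewrite big_cons.
Qed.

Definition along X (a : R) : C2 R := a *: X.

Lemma along_is_linear X : linear (along X).
Proof. by move=> a b c; rewrite /along scalerDl scalerA. Qed.

HB.instance Definition _ X := GRing.isLinear.Build R R (C2 R) _ (along X) (along_is_linear X).

Lemma along_continuous X : continuous (along X).
Proof. exact: scalel_continuous. Qed.

Lemma cvg_sumf (I : Type) (r : seq I) (T : Type) (F : set_system T) (W : normedModType R) (f : I -> T -> W) (g : I -> W) :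
  Filter F -> (forall i, f i x @[x --> F] --> g i) ->
  \sum_(i <- r) f i x @[x --> F] --> \sum_(i <- r) g i.
Proof.
move=> FF h; elim: r => [|i r IH].
  by rewrite big_nil; under eq_fun do rewrite big_nil; exact: cvg_cst.
by rewrite big_cons; under eq_fun do rewrite big_cons; apply: cvgD.
Qed.

Lemma cvg_sum0 (I : finType) (f : nat -> I -> R) : (forall i, f n i @[n --> \oo] --> 0) ->
  \sum_i f n i @[n --> \oo] --> 0.
Proof.
move=> h; have := @cvg_sumf I (index_enum I) nat \oo R (fun i n => f n i) (fun=> 0) _ h.
by rewrite big1_eq; apply.
Qed.

Lemma is_derive_assemble (f : R * R -> 'I_2 * bool -> R) (g : 'I_2 * bool -> R) (p v : R * R) :
  (forall i, is_derive p v (fun q => f q i) (g i)) ->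
  is_derive p v (fun q => assemble (f q)) (assemble g).
Proof.
move=> h; apply: is_derive_sumf => i.
by apply: (is_derive_linear (l := along (cvec i))); exact: along_continuous.
Qed.

Lemma continuous_assemble (f : R * R -> 'I_2 * bool -> R) :
  (forall i, continuous (fun q => f q i)) -> continuous (fun q => assemble (f q)).
Proof.
move=> h p; apply: cvg_sumf => i.
by apply: (@continuous_comp _ _ _ (fun q => f q i) (along (cvec i))); [exact: h|exact: along_continuous].
Qed.

Lemma norm_C2 : exists2 K : R, 0 <= K & forall X, `|X| <= K * \sum_i `|cc i X|.
Proof.
exists (\sum_i `|cvec i|); first by apply: sumr_ge0 => i _.
move=> X; rewrite -{1}[X]assembleK; apply: le_trans (ler_norm_sum _ _ _) _.
rewrite mulr_sumr; apply: ler_sum => i _; rewrite normrZ mulrC ler_wpM2r//.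
by rewrite (bigD1 i)//= lerDl sumr_ge0.
Qed.

End Assemble.

Section TrigonometricMaps.
Context {R : realType} (M : nat).

(** The frequency mode a, with a cosine for (a, false) and a sine for (a, true). *)
Definition tindex := (('I_(2 * M).+1 * 'I_(2 * M).+1) * bool)%type.
Implicit Types (X : tindex -> 'I_2 * bool -> R) (v w p q : R * R) (s : seq (R * R)).

Definition phase (b : bool) : R := if b then - (pi / 2) else 0.

Definition slope v (k : int * int) : R := 2 * pi * (k.1%:~R * v.1 + k.2%:~R * v.2).

Definition dterm (u : tindex) s p : R :=
  \prod_(v <- s) slope v (mode u.1) * wave (mode u.1) (phase u.2 + (size s)%:R * (pi / 2)) p.

(** The i-th coordinate of the trigonometric map of coefficients X, differentiated in
    the directions s. *)
Definition dtrig X i s p : R := \sum_u dterm u s p * X u i.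

Lemma is_derive_wave_dir k t v p : is_derive p v (wave k t) (slope v k * wave k (t + pi / 2) p).
Proof.
pose ph (q : R * R) := 2 * pi * (k.1%:~R * q.1 + k.2%:~R * q.2) + t.
have dph : is_derive p v ph (slope v k).
  apply/is_derive_lineP.
  apply: (@is_derive_ext _ _ _ (fun s : R => s * slope v k + ph p)).
    move=> s; rewrite /ph /slope /= /GRing.scale/=; ring.
  apply: is_derive_eq.
  by rewrite addr0 /GRing.scale/= mulr1 mulr0 ?add0r.
have := is_derive_compR dph (is_derive_cos (ph p)).
by rewrite /wave [_ + (t + pi / 2)]addrA -/(ph p) cosDpihalf mulrC.
Qed.

Lemma is_derive_dterm u s v p : is_derive p v (dterm u s) (dterm u (v :: s) p).
Proof.
apply: (is_derive_val (is_deriveZf (\prod_(v <- s) slope v (mode u.1)) (is_derive_wave_dir (mode u.1) (phase u.2 + (size s)%:R * (pi / 2)) v p))).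
rewrite /dterm big_cons mulrA -[size (v :: s)]/((size s).+1) -natr1; congr (_ * wave _ _ _); ring.
Qed.

Lemma is_derive_dtrig X i s v p : is_derive p v (dtrig X i s) (dtrig X i (v :: s) p).
Proof.
apply: is_derive_sumf => u.
apply: (@is_derive_ext _ _ _ (fun q => X u i * dterm u s q)); first by move=> q; rewrite mulrC.
by apply: (is_derive_val (is_deriveZf (X u i) (is_derive_dterm u s v p))); rewrite mulrC.
Qed.

Lemma dtrig_perm X i s s' p : perm_eq s s' -> dtrig X i s p = dtrig X i s' p.
Proof. by move=> ss; apply: eq_bigr => u _; rewrite /dterm (perm_big _ ss) (perm_size ss). Qed.

Lemma slope_linear a b v w k : slope (a *: v + b *: w) k = a * slope v k + b * slope w k.
Proof. by rewrite /slope /= /GRing.scale /=; ring. Qed.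

Lemma dtrig_linear X i a b v w s p :
  dtrig X i (a *: v + b *: w :: s) p = a * dtrig X i (v :: s) p + b * dtrig X i (w :: s) p.
Proof.
rewrite /dtrig !mulr_sumr -big_split /=; apply: eq_bigr => u _.
by rewrite /dterm !big_cons slope_linear /=; ring.
Qed.

Definition speed v : R := 2 * pi * M%:R * (`|v.1| + `|v.2|).

Lemma mode_le (a : 'I_(2 * M).+1 * 'I_(2 * M).+1) : `|(mode a).1%:~R| <= M%:R :> R /\ `|(mode a).2%:~R| <= M%:R :> R.
Proof.
have h (m : 'I_(2 * M).+1) : `|(m%:Z - M%:Z)%:~R| <= M%:R :> R.
  by rewrite -intr_norm -[M%:R]/(M%:Z%:~R) ler_int; have := ltn_ord m; lia.
by split; exact: h.
Qed.

Lemma slope_le v (a : 'I_(2 * M).+1 * 'I_(2 * M).+1) : `|slope v (mode a)| <= speed v.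
Proof.
have [h1 h2] := mode_le a; have p0 := pi_gt0 R.
rewrite /slope /speed normrM ger0_norm; last by lra.
rewrite -[in leRHS]mulrA ler_pM2l; last by lra.
by apply: le_trans (ler_normD _ _) _; rewrite !normrM mulrDr lerD// ler_wpM2r.
Qed.

Definition coef_bound X : R := \sum_u \sum_i `|X u i|.

Lemma dterm_bound u s p : `|dterm u s p| <= \prod_(v <- s) speed v.
Proof.
rewrite /dterm normrM; apply: le_trans (_ : `|\prod_(v <- s) slope v (mode u.1)| * 1 <= _).
  by rewrite ler_wpM2l// wave_norm.
rewrite mulr1; elim: s => [|v s IH]; first by rewrite !big_nil normr1.
by rewrite !big_cons normrM ler_pM// slope_le.
Qed.

Lemma dtrig_bound X i s p : `|dtrig X i s p| <= coef_bound X * \prod_(v <- s) speed v.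
Proof.
apply: le_trans (ler_norm_sum _ _ _) _; rewrite /coef_bound mulr_suml; apply: ler_sum => u _.
rewrite normrM mulrC; apply: ler_pM => //; last exact: dterm_bound.
by rewrite (bigD1 i)//= lerDl sumr_ge0.
Qed.

Definition trig X p : C2 R := assemble (fun i => dtrig X i [::] p).

Lemma cc_trig X i p : cc i (trig X p) = \sum_u wave (mode u.1) (phase u.2) p * X u i.
Proof.
rewrite cc_assemble; apply: eq_bigr => u _.
by rewrite /dterm big_nil mul1r mul0r addr0.
Qed.

Lemma partials_trig X (s : seq 'I_2) : partials s (trig X) = fun p => assemble (fun i => dtrig X i (map stdbasis s) p).
Proof.
elim: s => [//|j s IH]; apply/funext => p; rewrite /= IH /partial.
by have [] := is_derive_assemble (fun i => is_derive_dtrig X i (map stdbasis s) (stdbasis j) p).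
Qed.

Lemma continuous_dtrig X i s : continuous (dtrig X i s).
Proof.
apply: continuous_sum => u p; apply: cvgM; last exact: cvg_cst.
by apply: cvgM; [exact: cvg_cst|exact: wave_continuous].
Qed.

Lemma smooth_trig X : smooth (trig X).
Proof.
move=> s; rewrite partials_trig; split=> [|j p].
  by apply: continuous_assemble => i; exact: continuous_dtrig.
by have [] := is_derive_assemble (fun i => is_derive_dtrig X i (map stdbasis s) (stdbasis j) p).
Qed.

Lemma periodic_trig X : periodic (trig X).
Proof.
move=> p; split; apply: C2_ext => i; rewrite !cc_trig; apply: eq_bigr => u _; congr (_ * _).
  by have [] := wave_periodic (mode u.1) (phase u.2) p.
by have [] := wave_periodic (mode u.1) (phase u.2) p.
Qed.

Lemma cc_partials_trig X i (s : seq 'I_2) p : cc i (partials s (trig X) p) = dtrig X i (map stdbasis s) p.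
Proof. by rewrite partials_trig cc_assemble. Qed.

Lemma dtrig_cvg (Xn : nat -> tindex -> 'I_2 * bool -> R) X i s p :
  (forall u, Xn n u i @[n --> \oo] --> X u i) -> dtrig (Xn n) i s p @[n --> \oo] --> dtrig X i s p.
Proof. by move=> h; apply: cvg_sumf => u; apply: cvgM; [exact: cvg_cst|exact: h]. Qed.

Lemma trig_smooth_cvg (Xn : nat -> tindex -> 'I_2 * bool -> R) X :
  (forall u i, Xn n u i @[n --> \oo] --> X u i) -> smooth_cvg (fun n => trig (Xn n)) (trig X).
Proof.
move=> h k s _ e e0.
pose P := \prod_(v <- map stdbasis s) speed v.
have [K K0 KX] := @norm_C2 R.
have c0 : (fun n => K * \sum_(i : 'I_2 * bool) \sum_u P * `|Xn n u i - X u i|) @ \oo --> (0 : R).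
  rewrite -[X in _ --> X](mulr0 K); apply: cvgM; first exact: cvg_cst.
  apply: cvg_sum0 => i; apply: cvg_sum0 => u.
  rewrite -[X in _ --> X](mulr0 P); apply: cvgM; first exact: cvg_cst.
  rewrite -(@normr0 _ R) -(subrr (X u i)); apply: cvg_norm; apply: cvgB; [exact: h|exact: cvg_cst].
have : \forall n \near \oo, K * \sum_(i : 'I_2 * bool) \sum_u P * `|Xn n u i - X u i| < e.
  exact: (cvgr_lt _ c0).
apply: filterS => n ne p; apply: le_lt_trans ne.
apply: le_trans (KX _) _; apply: ler_wpM2l => //; apply: ler_sum => i _.
rewrite linearB /= !cc_partials_trig /dtrig -sumrB.
apply: le_trans (ler_norm_sum _ _ _) _; apply: ler_sum => u _.
by rewrite -mulrBr normrM ler_wpM2r// dterm_bound.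
Qed.

Section Tower.
Variables (t1 t2 : R) (c : R * R) (X : tindex -> 'I_2 * bool -> R).
Hypotheses (t20 : 0 < t2) (pde : hsl_pde t1 t2 c (trig X)).
Let e0 : R * R := stdbasis ord0.
Let e1 : R * R := stdbasis ord_max.
Let T := t1 ^+ 2 + t2 ^+ 2.

Lemma grad_trig j p i : cc i (grad (trig X) j p) = dtrig X i [:: stdbasis j] p.
Proof. exact: (cc_partials_trig X i [:: j] p). Qed.

Lemma hess_trig j k p i : cc i (hess (trig X) j k p) = dtrig X i [:: stdbasis j; stdbasis k] p.
Proof. exact: (cc_partials_trig X i [:: j; k] p). Qed.

(** The equation has constant coefficients, so the derivatives of a solution solve it
    too. *)
Lemma pde_dtrig l b s p :
  T * dtrig X (l, b) (e0 :: e0 :: s) p - 2 * t1 * dtrig X (l, b) (e0 :: e1 :: s) p + dtrig X (l, b) (e1 :: e1 :: s) p =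
  (if b then - (T * c.1 - t1 * c.2) else T * c.1 - t1 * c.2) * dtrig X (l, ~~ b) (e0 :: s) p +
  (if b then - (c.2 - t1 * c.1) else c.2 - t1 * c.1) * dtrig X (l, ~~ b) (e1 :: s) p.
Proof.
elim: s p => [|v s IH] p.
  have := pde p; rewrite /conj_laplacian => /(congr1 (cc (l, b))) e.
  have := etrans (esym (cc_comb (l, b) _ _ _ _ _)) (etrans e (cc_NJ _ _ _ _ _ _)).
  move: (hess_trig ord0 ord0 p (l, b)) (hess_trig ord0 ord_max p (l, b)) (hess_trig ord_max ord_max p (l, b)).
  move: (grad_trig ord0 p (l, ~~ b)) (grad_trig ord_max p (l, ~~ b)).
  by rewrite -/e0 -/e1 => <- <- <- <- <-.
move: (if b then - (T * c.1 - t1 * c.2) else _) (if b then - (c.2 - t1 * c.1) else _) IH => x y IH.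
have dl := is_deriveDf (is_deriveBf (is_deriveZf T (is_derive_dtrig X (l, b) (e0 :: e0 :: s) v p))
  (is_deriveZf (2 * t1) (is_derive_dtrig X (l, b) (e0 :: e1 :: s) v p))) (is_derive_dtrig X (l, b) (e1 :: e1 :: s) v p).
have dr := is_deriveDf (is_deriveZf x (is_derive_dtrig X (l, ~~ b) (e0 :: s) v p))
  (is_deriveZf y (is_derive_dtrig X (l, ~~ b) (e1 :: s) v p)).
have rot3 a a' : perm_eq (a :: a' :: v :: s) (v :: a :: a' :: s) by apply/permP => f /=; lia.
have rot2 a : perm_eq (a :: v :: s) (v :: a :: s) by apply/permP => f /=; lia.
rewrite !(dtrig_perm _ _ _ (rot3 _ _)) !(dtrig_perm _ _ _ (rot2 _)).
apply: is_derive_uniq dl _.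
apply: (@is_derive_ext _ _ _ (fun q => x * dtrig X (l, ~~ b) (e0 :: s) q + y * dtrig X (l, ~~ b) (e1 :: s) q)).
by move=> q; rewrite IH.
Qed.

Let v1 : R * R := e0.
Let v2 : R * R := (- (t1 / t2)) *: e0 + t2^-1 *: e1.

(** The equation equates the Laplacian with derivatives of lower order. *)
Lemma dtrig_harmonic m p : (forall i s, size s = m.+1 -> dtrig X i s p = 0) ->
  forall i s, size s = m -> dtrig X i (v1 :: v1 :: s) p + dtrig X i (v2 :: v2 :: s) p = 0.
Proof.
move=> low [l b] s sm; rewrite /v1 /v2 !dtrig_linear.
have E w u (v : seq (R * R)) : perm_eq (u :: w :: v) (w :: u :: v) by apply/permP => f /=; lia.
rewrite !(dtrig_perm _ _ _ (E ((- (t1 / t2)) *: e0 + t2^-1 *: e1) _ s)) !dtrig_linear.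
rewrite (dtrig_perm _ _ _ (E e0 e1 s)).
have := pde_dtrig l b s p; rewrite !(low (l, ~~ b)) /= ?sm// !mulr0 addr0 /T.
move: (dtrig _ _ _ _) (dtrig _ _ _ _) (dtrig _ _ _ _) => x y z h.
have t2n : t2 != 0 by rewrite gt_eqF.
have -> : x = 2 * t1 * y - (t1 ^+ 2 + t2 ^+ 2) * z by lra.
by field.
Qed.

Lemma stdbasisE : e0 = (1, 0) /\ e1 = (0, 1).
Proof. by []. Qed.

Lemma speed_span v : exists a b, v = a *: v1 + b *: v2 /\
  speed v ^+ 2 <= 2 * (2 * pi * M%:R) ^+ 2 * (2 + 2 * (t1 / t2) ^+ 2 + t2^-1 ^+ 2) * (a ^+ 2 + b ^+ 2).
Proof.
have [E0 E1] := stdbasisE; have t2n : t2 != 0 by rewrite gt_eqF.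
exists (v.1 + t1 * v.2), (t2 * v.2); split.
  rewrite /v1 /v2 E0 E1; case: v => x y; congr pair; rewrite /= /GRing.scale /=; field; exact: t2n.
set a := v.1 + _; set b := t2 * _.
have xE : v.1 = a - (t1 / t2) * b by rewrite /a /b; field.
have yE : v.2 = t2^-1 * b by rewrite /b mulKf.
rewrite /speed exprMn; set Om := (2 * pi * M%:R) ^+ 2.
have -> : 2 * Om * (2 + 2 * (t1 / t2) ^+ 2 + t2^-1 ^+ 2) * (a ^+ 2 + b ^+ 2) =
  Om * (2 * ((2 + 2 * (t1 / t2) ^+ 2 + t2^-1 ^+ 2) * (a ^+ 2 + b ^+ 2))) by ring.
apply: ler_wpM2l; first by rewrite /Om sqr_ge0.
have : (`|v.1| + `|v.2|) ^+ 2 <= 2 * (v.1 ^+ 2 + v.2 ^+ 2).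
  rewrite -[v.1 ^+ 2]real_normK ?num_real// -[v.2 ^+ 2]real_normK ?num_real//.
  by have := sqr_ge0 (`|v.1| - `|v.2|); move: `|v.1| `|v.2| => x y; rewrite !expr2; lra.
move=> h; apply: le_trans h _; rewrite ler_pM2l ?ltr0n//.
rewrite xE yE; move: (t1 / t2) (t2^-1) => r s.
have := sqr_ge0 (a + r * b); have := sqr_ge0 (s * a); have := sqr_ge0 (r * a); have := sqr_ge0 b; have := sqr_ge0 (s * b).
by rewrite !expr2; nra.
Qed.

Lemma speed_ge0 v : 0 <= speed v.
Proof. by have p0 := ltW (pi_gt0 R); rewrite /speed mulr_ge0 ?addr_ge0// !mulr_ge0. Qed.

Lemma speedZ a v : speed (a *: v) = `|a| * speed v.
Proof. by rewrite /speed /= /GRing.scale /= !normrM; ring. Qed.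

(** The derivatives of a trigonometric map grow geometrically at most, which is the
    analyticity used in the unique continuation argument. *)
Lemma accumulation_const p0 :
  (forall e, 0 < e -> exists w, [/\ w != 0, speed w < e & stationary (dtrig X) (p0 + w)]) ->
  forall p i v, dtrig X i [:: v] p = 0.
Proof.
move=> acc.
have C0 : 0 <= coef_bound X by apply: sumr_ge0 => u _; apply: sumr_ge0.
have L0 : 0 <= 2 * (2 * pi * M%:R) ^+ 2 * (2 + 2 * (t1 / t2) ^+ 2 + t2^-1 ^+ 2) :> R.
  have := sqr_ge0 (t1 / t2); have := sqr_ge0 (t2^-1) => h1 h2.
  by apply: mulr_ge0; [apply: mulr_ge0; rewrite ?sqr_ge0//|lra].
have fl := @accumulation_flat R _ (dtrig X) _ _ speed v1 v2 (is_derive_dtrig X) (dtrig_perm X)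
   (dtrig_linear X) C0 L0 speed_ge0 (dtrig_bound X) dtrig_harmonic speed_span p0 acc.
move=> p i v.
have fp := @flat_everywhere R _ (dtrig X) _ speed (is_derive_dtrig X) (dtrig_linear X) C0 speed_ge0 speedZ (dtrig_bound X) p0 p fl.
exact: fp.
Qed.

End Tower.

End TrigonometricMaps.

(** * Compactness *)
Section Representation.
Context {R : realType}.

Definition fourier_coef M (F : R * R -> C2 R) : tindex M -> 'I_2 * bool -> R :=
  fun u i => moment (fun p => cc i (F p)) (mode u.1) (phase u.2).

Lemma trig_representation M (F : R * R -> C2 R) : periodic F -> smooth F ->
  (forall k, ~~ low_mode M k -> forall i t, moment (fun p => cc i (F p)) k t = 0) ->
  F = trig (fourier_coef (M := M) F).
Proof.
move=> pF sF hF; apply/funext => p; apply: C2_ext => i.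
have pf : periodic (fun p => cc i (F p)) by move=> q; have [-> ->] := pF q.
rewrite cc_trig (@fourier_representation R M _ pf (continuous_cc (smooth_continuous sF))); last first.
  by move=> k nk; split; exact: (hF k nk i).
rewrite /fourier_sum -(pair_bigA _ (fun a b => wave (mode a) (phase b) p * fourier_coef F (a, b) i)) /=.
apply: eq_bigr => a _; rewrite big_bool /= /fourier_coef /= /phase addrC.
by rewrite ![wave _ _ _ * _]mulrC.
Qed.

(** Evaluated at a zero of F, the representation expresses the constant coefficient
    by the other ones. *)
Lemma fourier_coef_bound M (F : R * R -> C2 R) (B : R) p : 0 <= B ->
  F = trig (fourier_coef (M := M) F) -> F p = 0 ->
  (forall k i t, k != (0, 0) -> `|moment (fun p => cc i (F p)) k t| <= B) ->
  forall u i, `|fourier_coef (M := M) F u i| <= #|{: tindex M}|%:R * B + B.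
Proof.
move=> B0 FE Fp hB u i.
have K0 : 0 <= #|{: tindex M}|%:R * B by rewrite mulr_ge0.
have sin0 (v : tindex M) : mode v.1 = (0, 0) -> v.2 -> fourier_coef (M := M) F v i = 0.
  move=> v0 vb; rewrite /fourier_coef v0 /phase vb /moment.
  rewrite (_ : (fun _ => _) = (fun=> 0)) ?mean_cst//; apply/funext => q.
  by rewrite wave0 cosN cos_pihalf mulr0.
have [u0|u0] := eqVneq (mode u.1) (0, 0); last first.
  by apply: le_trans (hB _ _ _ u0) _; rewrite lerDr.
case ub : u.2; first by rewrite sin0// normr0 addr_ge0.
have z0 : cc i (F p) = 0 by rewrite Fp linear0.
move: z0; rewrite FE cc_trig (bigD1 u)//= u0 wave0 /phase ub cos0 mul1r -FE => /eqP.
rewrite addr_eq0 => /eqP ->; rewrite normrN.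
apply: le_trans (_ : \sum_(v : tindex M) B <= _); last first.
  by rewrite -[leLHS]addr0 lerD// sumr_const mulr_natl.
apply: le_trans (ler_norm_sum _ _ _) _; rewrite [leRHS](bigD1 u)//=.
apply: le_trans (_ : \sum_(v | v != u) B <= _); last by rewrite lerDr.
apply: ler_sum => v vu.
have [v0|v0] := eqVneq (mode v.1) (0, 0); last first.
  apply: le_trans (_ : `|fourier_coef (M := M) F v i| <= _); last exact: hB.
  by rewrite normrM ler_piMl// wave_norm.
rewrite sin0// ?mulr0 ?normr0//.
apply/negPn/negP => vb; case/negP: vu; apply/eqP.
case: u v u0 v0 ub vb => [[u1 u2] ub] [[v1 v2] vb]; rewrite /mode /= => -[e1 e2] [e3 e4] -> /negbTE ->.
by congr pair; congr pair; apply: val_inj; rewrite /=; lia.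
Qed.

End Representation.

Section Subsequences.
Context {R : realType}.

Lemma subsequence_of_often (Q : nat -> Prop) : (forall N, exists2 n, (N <= n)%N & Q n) ->
  exists2 f : nat -> nat, (forall m n, (m < n)%N -> (f m < f n)%N) & forall n, Q (f n).
Proof.
move=> often; have [g gP] := @choice _ _ (fun N n => (N <= n)%N /\ Q n) (fun N => let: ex_intro2 n Nn Qn := often N in ex_intro _ n (conj Nn Qn)).
pose f := fix f n := if n is m.+1 then g (f m).+1 else g 0.
have fS n : (f n < f n.+1)%N by have [] := gP (f n).+1.
exists f; last by case=> [|n]; [have [] := gP 0|have [] := gP (f n).+1].
move=> m n; elim: n => // n IH; rewrite ltnS leq_eqVlt => /orP[/eqP ->//|/IH h].
exact: ltn_trans h (fS n).
Qed.

Lemma subsequence_ge (f : nat -> nat) : (forall m n, (m < n)%N -> (f m < f n)%N) -> forall n, (n <= f n)%N.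
Proof. by move=> h; elim=> // n IH; exact: leq_ltn_trans IH (h n n.+1 (ltnSn n)). Qed.

Lemma cvg_subsequence (T : topologicalType) (u : nat -> T) (f : nat -> nat) (l : T) :
  (forall m n, (m < n)%N -> (f m < f n)%N) -> u n @[n --> \oo] --> l -> u (f n) @[n --> \oo] --> l.
Proof.
move=> fm ul A /ul [N _ hN]; exists N => // n /= Nn; apply: hN => /=.
exact: leq_trans Nn (subsequence_ge fm n).
Qed.

Lemma bolzano_weierstrass_fin (I : finType) (u : nat -> I -> R) (B : R) :
  (forall n i, `|u n i| <= B) ->
  exists2 f : nat -> nat, (forall m n, (m < n)%N -> (f m < f n)%N) &
    exists l : I -> R, forall i, u (f n) i @[n --> \oo] --> l i.
Proof.
move=> uB.
suff : exists2 f : nat -> nat, (forall m n, (m < n)%N -> (f m < f n)%N) &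
    exists l : I -> R, forall i, i \in enum I -> u (f n) i @[n --> \oo] --> l i.
  by move=> [f fm [l h]]; exists f => //; exists l => i; apply: h; rewrite mem_enum.
elim: (enum I) => [|j s [f fm [l h]]]; first by exists id => //; exists (fun=> 0).
have [|g gm /cvg_ex[b gb]] := @bolzano_weierstrass R (fun n => u (f n) j).
  exists B; split; first exact: num_real.
  by move=> x Bx n _; apply: le_trans (ltW Bx); exact: uB.
have gm' m n : (m < n)%N -> (g m < g n)%N.
  by rewrite ltnNge -(gm n m) leEnat -ltnNge.
exists (fun n => f (g n)); first by move=> m n /gm'/fm.
exists (fun i => if i == j then b else l i) => i.
rewrite inE; have [-> _|ij /= si] := eqVneq i j; first exact: gb.
exact: (@cvg_subsequence _ (fun n => u (f n) i) g (l i) gm' (h i si)).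
Qed.

End Subsequences.

Section Limits.
Context {R : realType}.

Lemma lim_eq (u v : nat -> R) (a b : R) : (forall n, u n = v n) ->
  u n @[n --> \oo] --> a -> v n @[n --> \oo] --> b -> a = b.
Proof.
move=> uv ua vb; have E : u = v by apply/funext.
by rewrite E in ua; exact: (cvg_unique _ ua vb).
Qed.

Definition cvg_coordinates (U : nat -> C2 R) (A : C2 R) := forall i, cc i (U n) @[n --> \oo] --> cc i A.

Lemma cvg_gbar U V A B : cvg_coordinates U A -> cvg_coordinates V B ->
  gbar (U n) (V n) @[n --> \oo] --> gbar A B.
Proof.
move=> hU hV; have E : (fun n => gbar (U n) (V n)) =
    (fun n => c1 (U n) * c1 (V n) + c2 (U n) * c2 (V n) + c3 (U n) * c3 (V n) + c4 (U n) * c4 (V n)).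
  by apply/funext => n; rewrite gbarE.
rewrite E gbarE; apply: cvgD; [apply: cvgD; [apply: cvgD|]|]; apply: cvgM; first [exact: hU|exact: hV].
Qed.

Lemma cvg_omega U V A B : cvg_coordinates U A -> cvg_coordinates V B ->
  omega (U n) (V n) @[n --> \oo] --> omega A B.
Proof.
move=> hU hV; have E : (fun n => omega (U n) (V n)) =
    (fun n => c1 (U n) * c3 (V n) + c2 (U n) * c4 (V n) - c3 (U n) * c1 (V n) - c4 (U n) * c2 (V n)).
  by apply/funext => n; rewrite omegaE.
rewrite E omegaE; apply: cvgB; [apply: cvgB; [apply: cvgD|]|]; apply: cvgM; first [exact: hU|exact: hV].
Qed.

Lemma cvg_coordinates_comb U V W A B C (a b : nat -> R) (a' b' : R) : a n @[n --> \oo] --> a' -> b n @[n --> \oo] --> b' ->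
  cvg_coordinates U A -> cvg_coordinates V B -> cvg_coordinates W C ->
  cvg_coordinates (fun n => a n *: U n - b n *: V n + W n) (a' *: A - b' *: B + C).
Proof.
move=> ha hb hU hV hW i; have E : (fun n => cc i (a n *: U n - b n *: V n + W n)) =
    (fun n => a n * cc i (U n) - b n * cc i (V n) + cc i (W n)) by apply/funext => n; exact: cc_comb.
rewrite E cc_comb; apply: cvgD; last exact: hW.
by apply: cvgB; apply: cvgM; [exact: ha|exact: hU|exact: hb|exact: hV].
Qed.

Lemma cvg_coordinates_NJ U V A B (a b : nat -> R) (a' b' : R) : a n @[n --> \oo] --> a' -> b n @[n --> \oo] --> b' ->
  cvg_coordinates U A -> cvg_coordinates V B ->
  cvg_coordinates (fun n => - Jstd (a n *: U n + b n *: V n)) (- Jstd (a' *: A + b' *: B)).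
Proof.
move=> ha hb hU hV [l s]; have E : (fun n => cc (l, s) (- Jstd (a n *: U n + b n *: V n))) =
    (fun n => (if s then - a n else a n) * cc (l, ~~ s) (U n) + (if s then - b n else b n) * cc (l, ~~ s) (V n)).
  by apply/funext => n; exact: cc_NJ.
rewrite E cc_NJ; apply: cvgD; apply: cvgM; [|exact: hU| |exact: hV]; case: s {E} => //; exact: cvgN.
Qed.

Section TrigLimit.
Variables (M : nat) (Xn : nat -> tindex M -> 'I_2 * bool -> R) (X : tindex M -> 'I_2 * bool -> R)
  (sn rn : nat -> R) (t1 t2 : R) (an bn : nat -> R) (c : R * R).
Hypotheses (XX : forall u i, Xn n u i @[n --> \oo] --> X u i) (st : sn n @[n --> \oo] --> t1)
  (rt : rn n @[n --> \oo] --> t2) (a1 : an n @[n --> \oo] --> c.1) (b1 : bn n @[n --> \oo] --> c.2).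

Lemma grad_cvg j p : cvg_coordinates (fun n => grad (trig (Xn n)) j p) (grad (trig X) j p).
Proof.
move=> i; have E : (fun n => cc i (grad (trig (Xn n)) j p)) = (fun n => dtrig (Xn n) i [:: stdbasis j] p).
  by apply/funext => n; exact: grad_trig.
by rewrite E grad_trig; apply: dtrig_cvg => u; exact: XX.
Qed.

Lemma hess_cvg j k p : cvg_coordinates (fun n => hess (trig (Xn n)) j k p) (hess (trig X) j k p).
Proof.
move=> i; have E : (fun n => cc i (hess (trig (Xn n)) j k p)) = (fun n => dtrig (Xn n) i [:: stdbasis j; stdbasis k] p).
  by apply/funext => n; exact: hess_trig.
by rewrite E hess_trig; apply: dtrig_cvg => u; exact: XX.
Qed.

Let Tt : (sn n ^+ 2 + rn n ^+ 2) @[n --> \oo] --> t1 ^+ 2 + t2 ^+ 2.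
Proof. by rewrite !expr2; apply: cvgD; apply: cvgM. Qed.

Lemma limit_conformal : (forall n, conformal_to (sn n) (rn n) (trig (Xn n))) -> conformal_to t1 t2 (trig X).
Proof.
move=> h p; have d : density (trig (Xn n)) p @[n --> \oo] --> density (trig X) p.
  by apply: cvg_gbar; exact: grad_cvg.
split.
  apply: (lim_eq (fun n => (h n p).1)); first by apply: cvg_gbar; exact: grad_cvg.
  by apply: cvgM; [exact: d|exact: st].
apply: (lim_eq (fun n => (h n p).2)); first by apply: cvg_gbar; exact: grad_cvg.
by apply: cvgM; [exact: d|exact: Tt].
Qed.

Lemma limit_lagrangian : (forall n, lagrangian (trig (Xn n))) -> lagrangian (trig X).
Proof.
move=> h p i j; apply: (lim_eq (fun n => h n p i j)); last exact: cvg_cst.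
by apply: cvg_omega; exact: grad_cvg.
Qed.

Lemma limit_pde : (forall n, hsl_pde (sn n) (rn n) (an n, bn n) (trig (Xn n))) -> hsl_pde t1 t2 c (trig X).
Proof.
move=> h p; apply: C2_ext => i.
apply: (lim_eq (fun n => congr1 (cc i) (h n p))).
  have st2 : 2 * sn n @[n --> \oo] --> 2 * t1 by apply: cvgM; [exact: cvg_cst|exact: st].
  rewrite /conj_laplacian.
  exact: (cvg_coordinates_comb Tt st2 (@hess_cvg ord0 ord0 p) (@hess_cvg ord0 ord_max p) (@hess_cvg ord_max ord_max p)).
apply: (cvg_coordinates_NJ _ _ (@grad_cvg ord0 p) (@grad_cvg ord_max p)) => /=.
  by apply: cvgB; apply: cvgM => //; exact: Tt.
by apply: cvgB => //; apply: cvgM.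
Qed.

(** A constant limit would be uniformly close to the n-th map, which vanishes somewhere and
    exceeds e elsewhere. *)
Lemma limit_nonconstant (e : R) : 0 < e ->
  (forall n, exists i p, e < `|cc i (trig (Xn n) p)|) -> (forall n, exists p, trig (Xn n) p = 0) ->
  ~ (forall p q, trig X p = trig X q).
Proof.
move=> e0 large vanish const.
have c0 i : \sum_u `|Xn n u i - X u i| @[n --> \oo] --> 0.
  apply: cvg_sum0 => u; rewrite -(@normr0 _ R) -(subrr (X u i)).
  by apply: cvg_norm; apply: cvgB; [exact: XX|exact: cvg_cst].
have e20 : 0 < e / 2 by lra.
have near i : \forall n \near \oo, \sum_u `|Xn n u i - X u i| < e / 2 by exact: (cvgr_lt _ (c0 i)).
have : \forall n \near \oo, forall i, \sum_u `|Xn n u i - X u i| < e / 2.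
  by apply: filter_forall => i; exact: near.
move=> [N _ /(_ N (leqnn N)) small].
have [i [p ep]] := large N; have [q q0] := vanish N.
have D r : `|cc i (trig (Xn N) r) - cc i (trig X r)| <= \sum_u `|Xn N u i - X u i|.
  rewrite !cc_trig -sumrB; apply: le_trans (ler_norm_sum _ _ _) _; apply: ler_sum => u _.
  by rewrite -mulrBr normrM ler_piMl// wave_norm.
have := D p; have := D q; rewrite q0 linear0 sub0r normrN (const q p) => h1 h2.
have h3 := ler_normD (cc i (trig (Xn N) p) - cc i (trig X p)) (cc i (trig X p)).
rewrite subrK in h3; have := small i; lra.
Qed.

End TrigLimit.
End Limits.

Section ConstantMetrics.
Context {R : realType}.

Lemma partial_cst (V : normedModType R) i (a : V) : partial i (fun=> a) = fun=> 0.
Proof. by apply/funext => p; rewrite /partial; exact: derive_cst. Qed.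

Lemma partials_cst (V : normedModType R) s (a : V) :
  partials s (fun=> a) = fun=> (if s is [::] then a else 0).
Proof. by elim: s => //= i s ->; exact: partial_cst. Qed.

Lemma smooth_cst (V : normedModType R) (a : V) : smooth (fun=> a).
Proof.
move=> s; rewrite partials_cst; split=> [|i p]; first exact: cst_continuous.
exact: derivable_cst.
Qed.

Lemma flat_cst (A : 'M[R]_2) : A^T = A -> (forall v : 'rV[R]_2, v != 0 -> 0 < (v *m A *m v^T) ord0 ord0) ->
  flat_metric (fun=> A).
Proof.
move=> sA pA; split; first by split => //; exact: smooth_cst.
have ch k i j : christoffel (fun=> A) k i j = fun=> 0.
  apply/funext => p; rewrite /christoffel big1 ?mulr0// => l _.
  by rewrite !(@partial_cst R^o) addr0 subr0 mulr0.
move=> l k i j p; rewrite /riemann_curvature !ch !(@partial_cst R^o) subr0 add0r.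
by rewrite big1// => m _; rewrite !ch mulr0 subr0.
Qed.

Lemma model_pos t1 t2 (v : 'rV[R]_2) : t2 != 0 -> v != 0 -> 0 < (v *m model t1 t2 *m v^T) ord0 ord0.
Proof.
move=> t20 v0; have [m00 m01 m10 m11] := modelE t1 t2.
have -> : (v *m model t1 t2 *m v^T) ord0 ord0 =
   (v ord0 ord0 + t1 * v ord0 ord_max) ^+ 2 + (t2 * v ord0 ord_max) ^+ 2.
  rewrite mxE sum2 ![v^T _ _]mxE ![(v *m _) _ _]mxE !sum2 m00 m01 m10 m11; ring.
rewrite lt_neqAle addr_ge0 ?sqr_ge0// andbT eq_sym; apply: contraNneq v0 => /eqP.
rewrite paddr_eq0 ?sqr_ge0// !sqrf_eq0 mulf_eq0 (negbTE t20) /= => /andP[/eqP + /eqP v1].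
rewrite v1 mulr0 addr0 => v00; apply/eqP/rowP => i.
by case: (ord2P i) => ->; rewrite mxE.
Qed.

Lemma model_sym t1 t2 : (model t1 t2)^T = model t1 t2 :> 'M[R]_2.
Proof.
have [m00 m01 m10 m11] := modelE t1 t2.
by apply: mx2P; rewrite mxE ?m01 ?m10.
Qed.

Lemma model_cvg (s r : nat -> R) (t1 t2 : R) : s n @[n --> \oo] --> t1 -> r n @[n --> \oo] --> t2 ->
  model (s n) (r n) @[n --> \oo] --> model t1 t2.
Proof.
move=> st rt; have E : (fun n => model (s n) (r n)) = (fun n => \sum_i \sum_j model (s n) (r n) i j *: delta_mx i j).
  by apply/funext => n; exact: matrix_sum_delta.
rewrite E [X in _ --> X]matrix_sum_delta; apply: cvg_sumf => i; apply: cvg_sumf => j.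
apply: (@cvgZl _ _ _ _ _ (fun n => model (s n) (r n) i j)).
have [m00 m01 m10 m11] := modelE t1 t2.
case: (ord2P i) => ->; case: (ord2P j) => ->.
- have -> : (fun n => model (s n) (r n) ord0 ord0) = fun=> 1 by apply/funext => n; have [] := modelE (s n) (r n).
  by rewrite m00; exact: cvg_cst.
- have -> : (fun n => model (s n) (r n) ord0 ord_max) = s by apply/funext => n; have [] := modelE (s n) (r n).
  by rewrite m01.
- have -> : (fun n => model (s n) (r n) ord_max ord0) = s by apply/funext => n; have [] := modelE (s n) (r n).
  by rewrite m10.
- have -> : (fun n => model (s n) (r n) ord_max ord_max) = (fun n => s n ^+ 2 + r n ^+ 2) by apply/funext => n; have [] := modelE (s n) (r n).
  by rewrite m11 !expr2; apply: cvgD; apply: cvgM.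
Qed.

Lemma conformal_structure_cvg_cst (A : nat -> 'M[R]_2) (B : 'M[R]_2) (h : nat -> R * R -> 'M[R]_2) :
  (forall n p, h n p = A n) -> A n @[n --> \oo] --> B -> conformal_structure_cvg h (fun=> B).
Proof.
move=> hA AB; exists (fun _ _ => 1); split.
  by move=> n; split=> //; exact: (@smooth_cst R^o).
have -> : (fun n p => 1 *: h n p) = (fun n => fun=> A n).
  by apply/funext => n; apply/funext => p; rewrite scale1r.
move=> k s _ e e0; have /cvgr_dist_lt/(_ e e0) := AB; apply: filterS => n h' p.
by rewrite !partials_cst; case: s => [|i s]; [rewrite distrC|rewrite subrr normr0].
Qed.

End ConstantMetrics.

Section PointConvergence.
Context {R : realType}.

Lemma edist_le (X : C2 R) (e : R) : 0 <= e -> (forall i, `|cc i X| <= e) -> edist X 0 <= 2 * e.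
Proof.
move=> e0 h; rewrite /edist subr0 -[2 * e]ger0_norm ?mulr_ge0// -sqrtr_sqr ler_wsqrtr//.
rewrite gbarE -!expr2; have H i : cc i X ^+ 2 <= e ^+ 2 by rewrite -real_normK ?num_real// lerXn2r ?nnegrE.
have := H (ord0, false); have := H (ord_max, false); have := H (ord0, true); have := H (ord_max, true).
rewrite -/(c1 X) -/(c2 X) -/(c3 X) -/(c4 X) exprMn; lra.
Qed.

Lemma converges_to_zero (F : nat -> R * R -> C2 R) : (forall n, range (F n) 0) ->
  (forall e, 0 < e -> exists N, forall n p i, (N <= n)%N -> `|cc i (F n p)| <= e) -> converges_to_point F.
Proof.
move=> F0 small; exists 0.
have bound n e : 0 <= e -> (forall p i, `|cc i (F n p)| <= e) ->
    (0%R%:E <= hausdorff_dist (range (F n)) [set 0%R])%E /\ (hausdorff_dist (range (F n)) [set 0%R] <= (2 * e)%:E)%E.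
  move=> e0 h; rewrite /hausdorff_dist; split.
    rewrite le_max; apply/orP; left; apply: le_trans (ereal_sup_ubound _); last by exists 0; [exact: F0|reflexivity].
    by apply: le_ereal_inf_tmp => _ [b _ <-]; rewrite lee_fin sqrtr_ge0.
  rewrite ge_max; apply/andP; split.
    apply: ub_ereal_sup => _ [a [p _ <-] <-]; apply: le_trans (ereal_inf_lbound _) _.
      by exists 0; [reflexivity|reflexivity].
    by rewrite lee_fin; apply: edist_le.
  apply: ub_ereal_sup => _ [_ -> <-]; apply: le_trans (ereal_inf_lbound _) _.
    by exists 0; [exact: F0|reflexivity].
  by rewrite lee_fin; apply: edist_le => // i; rewrite linear0 normr0.
apply/fine_cvgP; split.
  have [N hN] := small 1 ltr01; exists N => // n /= Nn.
  have [h1 h2] := bound n 1 ler01 (fun p i => hN n p i Nn).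
  by rewrite ge0_fin_numE//; exact: le_lt_trans h2 (ltry _).
apply/cvgrPdist_lt => e e0; have e3 : 0 < e / 3 by lra.
have [N hN] := small _ e3; exists N => // n /= Nn.
have [] := bound n (e / 3) (ltW e3) (fun p i => hN n p i Nn).
case: (hausdorff_dist _ _) => [x| |]//=; rewrite !lee_fin => x0 xe.
by rewrite sub0r normrN ger0_norm//; lra.
Qed.

End PointConvergence.

Section FiniteZeros.
Context {R : realType}.

(** The points z n are distinct, so of two consecutive terms of a convergent
    subsequence one is different from the limit. *)
Lemma infinite_accumulation (S : set (R * R)) : S `<=` square -> infinite_set S ->
  exists p0 : R * R, forall e, 0 < e -> exists w, [/\ w != 0, `|w.1| < e, `|w.2| < e & S (p0 + w)].
Proof.
move=> Ssq /infiniteP/pcard_leP[z].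
have Sz n : S (z n) by exact: funS.
have zI m n : z m = z n -> m = n by apply: inj; rewrite inE.
have [n b|f fm [l hl]] := @bolzano_weierstrass_fin R bool (fun n b => if b then (z n).1 else (z n).2) 1.
  have [] := Ssq _ (Sz n); rewrite /= !in_itv /= => /andP[h1 h2] /andP[h3 h4].
  by case: b; rewrite ger0_norm// ltW.
exists (l true, l false) => e e0.
have N1 : \forall n \near \oo, `|l true - (z (f n)).1| < e by have /cvgr_dist_lt/(_ e e0) := hl true.
have N2 : \forall n \near \oo, `|l false - (z (f n)).2| < e by have /cvgr_dist_lt/(_ e e0) := hl false.
have [N _ hN] : \forall n \near \oo, `|l true - (z (f n)).1| < e /\ `|l false - (z (f n)).2| < e by exact: filterI.
have [n [Nn zn]] : exists n, (N <= n)%N /\ z (f n) != (l true, l false).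
  have [e1|n1] := eqVneq (z (f N)) (l true, l false); last by exists N.
  exists N.+1; split=> //; rewrite -e1; apply/negP => /eqP/zI h.
  by have := fm N N.+1 (ltnSn N); rewrite h ltnn.
have [h1 h2] := hN n Nn.
exists (z (f n) - (l true, l false)); split.
- by rewrite subr_eq0.
- by rewrite distrC.
- by rewrite distrC.
- by rewrite addrC subrK.
Qed.

Lemma density_eq0 (F : R * R -> C2 R) t1 t2 p : conformal_to t1 t2 F -> density F p = 0 ->
  forall j, grad F j p = 0.
Proof.
move=> cF d0 j; have [_ e11] := cF p.
have g0 : gbar (grad F j p) (grad F j p) = 0.
  by case: (ord2P j) => ->; [exact: d0|rewrite e11 d0 mul0r].
apply: C2_ext => i; rewrite linear0; apply/eqP; rewrite -sqrf_eq0 -[_ == 0]andbT.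
apply/andP; split=> //; rewrite eq_le sqr_ge0 andbT -g0.
exact: cc_sqr_le.
Qed.

(** Infinitely many branch points would accumulate, and the map would be constant. *)
Lemma finite_zeros_trig M (t1 t2 : R) c (X : tindex M -> 'I_2 * bool -> R) : 0 < t2 ->
  conformal_to t1 t2 (trig X) -> hsl_pde t1 t2 c (trig X) ->
  ~ (forall p q, trig X p = trig X q) -> finite_zeros (trig X).
Proof.
move=> t20 cF pde nc; apply: contrapT => inf; apply: nc.
have [|p0 acc] := infinite_accumulation _ inf; first by move=> p [].
have D0 := @accumulation_const R M t1 t2 c X t20 pde p0.
have {}D0 : forall p i v, dtrig X i [:: v] p = 0.
  apply: D0 => e e0.
  pose K : R := 2 * pi * M%:R + 1.
  have K0 : 0 < K by rewrite ltr_wpDl// !mulr_ge0// pi_ge0.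
  have e4 : 0 < e / (4 * K) by rewrite divr_gt0// mulr_gt0.
  have [w [w0 w1 w2 [d0 _]]] := acc _ e4.
  exists w; split=> //.
    rewrite /speed; apply: le_lt_trans (_ : K * (`|w.1| + `|w.2|) < _).
      by rewrite ler_wpM2r ?addr_ge0// lerDl.
    apply: lt_trans (_ : K * (e / (4 * K) + e / (4 * K)) < _); first by rewrite ltr_pM2l// ltrD.
    have -> : K * (e / (4 * K) + e / (4 * K)) = e / 2 by field; rewrite gt_eqF.
    lra.
  move=> i v; have g0 j : dtrig X i [:: stdbasis j] (p0 + w) = 0.
    by rewrite -grad_trig (density_eq0 cF d0) linear0.
  have [E0 E1] := @stdbasisE R.
  have -> : v = v.1 *: stdbasis ord0 + v.2 *: stdbasis ord_max.
    by rewrite E0 E1; case: v => x y; congr pair; rewrite /= /GRing.scale /=; ring.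
  by rewrite dtrig_linear !g0 !mulr0 addr0.
move=> p q; apply: C2_ext => i; rewrite !cc_assemble.
have [t _] := @mvt_segment R _ (dtrig X) (is_derive_dtrig X) i [::] q (p - q).
by rewrite D0 (addrC q) subrK => /eqP; rewrite subr_eq0 => /eqP.
Qed.

End FiniteZeros.

Section UniformBounds.
Context {R : realType}.

(** All bounds depend on the bounds A and W only, not on the immersion. *)
Lemma hsl_data (A W : R) (h : R * R -> 'M[R]_2) (F : R * R -> C2 R) (M : nat) :
  8 * W <= M%:R -> model_metric h -> branched_conformal_HSL h F ->
  (area F <= A%:E)%E -> (willmore F <= W%:E)%E -> range F 0 ->
  exists t : R * R, exists c : R * R, [/\ 1 / 2 <= t.2, forall p, h p = model t.1 t.2,
    conformal_to t.1 t.2 F /\ hsl_pde t.1 t.2 c F,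
    F = trig (fourier_coef (M := M) F) &
    let E := 4 * W in let B := 1 + (5 / 4 + E ^+ 2) * (2 * A) in
    [/\ `|t.1| <= 1, `|t.2| <= E, `|c.1| <= 1 + 2 * E, `|c.2| <= 1 + 2 * E + E &
    forall u i, `|fourier_coef (M := M) F u i| <= #|{: tindex M}|%:R * B + B]].
Proof.
move=> MW [t1 [t2 [t1h t20 tt1 _ hE]]] [pF sF bF lF hs] aF wF [p _ Fp].
have hE' q : h q = model t1 t2 by exact: hE.
have [cF fF] := (conformal_toP F hE').1 bF.
have [c pde cE] := hsl_of_stationary t20 pF sF cF lF fF hs wF.
exists (t1, t2), c => /=.
have tg := t2_ge t20 t1h tt1; have tE := t2_le t20 pF sF fF pde cE.
have E0 := energy_bound_ge0 t20 cE.
have high := high_modes t20 t1h tt1 pF sF fF pde cE.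
have FE : F = trig (fourier_coef (M := M) F).
  by apply: trig_representation => // k nk i s; apply: (high M _ k nk i s); lra.
split=> //.
have mb k i s : k != (0, 0) -> `|moment (fun p => cc i (F p)) k s| <= 1 + (5 / 4 + (4 * W) ^+ 2) * (2 * A).
  by move=> k0; exact: (moment_bound t20 t1h tt1 pF sF cF fF pde cE aF i s k0).
have z0 : c.1 * c.1 <= 2 * (4 * W).
  have h1 : t2 * (c.1 * c.1) <= 4 * W.
    by apply: le_trans cE; rewrite lerDl mulr_ge0 ?invr_ge0 ?(ltW t20)// -expr2 sqr_ge0.
  have : 1 / 2 * (c.1 * c.1) <= t2 * (c.1 * c.1) by rewrite ler_wpM2r// -expr2 sqr_ge0.
  by move: h1; lra.
have z1 : `|c.2 - t1 * c.1| <= 4 * W.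
  rewrite -(@ler_pXn2r _ 2) ?nnegrE// real_normK ?num_real//.
  apply: le_trans (_ : t2 * (4 * W) <= _); last by rewrite expr2 ler_wpM2r.
  rewrite -ler_pdivrMl//; apply: le_trans cE; rewrite expr2 lerDr mulr_ge0 ?(ltW t20)//.
  by rewrite -expr2 sqr_ge0.
have z2 : `|c.1| <= 1 + 2 * (4 * W).
  apply: le_trans (lerD (lexx 1) z0); rewrite -expr2 -real_normK ?num_real//.
  by have := sqr_ge0 (`|c.1| - 1); move: (normr_ge0 c.1) => /[swap]; rewrite sqrrB1; move: `|_| => z; lra.
have B0 : 0 <= 1 + (5 / 4 + (4 * W) ^+ 2) * (2 * A).
  by apply: le_trans (mb (1, 0) (ord0, false) 0 _).
split.
- by case/andP: t1h => *; rewrite ler_norml; apply/andP; split; lra.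
- by rewrite ger0_norm// ltW.
- exact: z2.
- rewrite -[c.2](subrK (t1 * c.1)) addrC; apply: le_trans (ler_normD _ _) _; apply: lerD => //.
  rewrite normrM; apply: le_trans z2; rewrite ler_piMl//.
  by case/andP: t1h => *; rewrite ler_norml; apply/andP; split; lra.
- exact: (fourier_coef_bound B0 FE Fp mb).
Qed.

End UniformBounds.

Theorem theorem1p2 (R : realType)
    (h : nat -> R * R -> 'M[R]_2) (F : nat -> R * R -> C2 R)
    (h_model : forall n, model_metric (h n))
    (F_HSL : forall n, branched_conformal_HSL (h n) (F n))
    (area_bounded : exists A : R, forall n, (area (F n) <= A%:E)%E)
    (willmore_bounded : exists W : R, forall n, (willmore (F n) <= W%:E)%E)
    (zero_in_image : forall n, range (F n) 0) :
  converges_to_point F \/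
  exists (phi : nat -> nat) (hoo : R * R -> 'M[R]_2) (Foo : R * R -> C2 R),
    [/\ forall m n, (m < n)%N -> (phi m < phi n)%N,
        flat_metric hoo,
        branched_conformal_HSL hoo Foo,
        smooth_cvg (fun n => F (phi n)) Foo &
        conformal_structure_cvg (fun n => h (phi n)) hoo].
Proof.
have [A aA] := area_bounded; have [W wW] := willmore_bounded.
have [small|] := pselect (forall e : R, 0 < e -> exists N, forall n p i, (N <= n)%N -> `|cc i (F n p)| <= e).
  by left; exact: converges_to_zero.
move=> /existsNP[e /not_implyP[e0 /forallNP large]]; right.
pose M := Num.bound `|8 * W|.
have MW : 8 * W <= M%:R.
  by apply: le_trans (ler_norm _) _; apply: ltW; exact: archi_boundP.
have data n := hsl_data (M := M) MW (h_model n) (F_HSL n) (aA n) (wW n) (zero_in_image n).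
have [t {}data] := choice data; have [c {}data] := choice data.
have often N : exists2 n, (N <= n)%N & exists i p, e < `|cc i (F n p)|.
  have /existsNP[n /existsNP[p /existsNP[i /not_implyP[Nn /negP]]]] := large N.
  by rewrite -ltNge => ep; exists n => //; exists i, p.
have [f fm fl] := subsequence_of_often often.
pose X n := fourier_coef (M := M) (F n).
(* the coefficients of the maps, then the parameters of the metrics and the forms c *)
pose u n (i : (tindex M * ('I_2 * bool)) + (bool * bool)) : R :=
  match i with
  | inl a => X (f n) a.1 a.2
  | inr a => if a.1 then (if a.2 then (t (f n)).1 else (t (f n)).2) else (if a.2 then (c (f n)).1 else (c (f n)).2)
  end.
pose E := 4 * W; pose B := 1 + (5 / 4 + E ^+ 2) * (2 * A).
pose K := #|{: tindex M}|%:R * B + B.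
have uB n i : `|u n i| <= `|K| + (2 + 4 * E).
  have [_ _ _ _ [b1 b2 b3 b4 b5]] := data (f n).
  have E0 : 0 <= E by apply: le_trans b2.
  case: i => [[a i]|[[] []]] /=.
  - apply: le_trans (b5 a i) _; apply: le_trans (ler_norm _) _; rewrite -/E -/B -/K lerDl; lra.
  - by apply: le_trans b1 _; have := normr_ge0 K; lra.
  - by apply: le_trans b2 _; rewrite /E in E0 *; have := normr_ge0 K; lra.
  - by apply: le_trans b3 _; rewrite /E in E0 *; have := normr_ge0 K; lra.
  - by apply: le_trans b4 _; rewrite /E in E0 *; have := normr_ge0 K; lra.
have [g gm [l hl]] := bolzano_weierstrass_fin uB.
pose phi n := f (g n); pose Xoo a i := l (inl (a, i)).
pose t1 := l (inr (true, true)); pose t2 := l (inr (true, false)).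
pose coo := (l (inr (false, true)), l (inr (false, false))).
have Xcvg a i : X (phi n) a i @[n --> \oo] --> Xoo a i := hl (inl (a, i)).
have tcvg1 : (t (phi n)).1 @[n --> \oo] --> t1 := hl (inr (true, true)).
have tcvg2 : (t (phi n)).2 @[n --> \oo] --> t2 := hl (inr (true, false)).
have ccvg1 : (c (phi n)).1 @[n --> \oo] --> coo.1 := hl (inr (false, true)).
have ccvg2 : (c (phi n)).2 @[n --> \oo] --> coo.2 := hl (inr (false, false)).
have FX n : F n = trig (X n) by have [] := data n.
have t20 : 0 < t2.
  have : 1 / 2 <= t2.
    by apply: (cvgr_to_ge tcvg2); apply: nearW => n; have [] := data (phi n).
  lra.
have cF : conformal_to t1 t2 (trig Xoo).
  apply: (limit_conformal Xcvg tcvg1 tcvg2) => n; rewrite -FX.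
  by have [_ _ []] := data (phi n).
have lF : lagrangian (trig Xoo).
  by apply: (limit_lagrangian Xcvg) => n; rewrite -FX; have [] := F_HSL (phi n).
have pF : hsl_pde t1 t2 coo (trig Xoo).
  apply: (limit_pde Xcvg tcvg1 tcvg2 ccvg1 ccvg2) => n; rewrite -FX -surjective_pairing.
  by have [_ _ []] := data (phi n).
have ncF : ~ (forall p q, trig Xoo p = trig Xoo q).
  apply: (limit_nonconstant Xcvg e0) => n; first by rewrite -FX; exact: fl.
  by rewrite -FX; have [p _ Fp] := zero_in_image (phi n); exists p.
have fF : finite_zeros (trig Xoo) by exact: finite_zeros_trig t20 cF pF ncF.
exists phi, (fun=> model t1 t2), (trig Xoo); split.
- by move=> m n mn; apply: fm; exact: gm.
- apply: flat_cst; first exact: model_sym.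
  by move=> v; apply: model_pos; rewrite gt_eqF.
- split; [exact: periodic_trig|exact: smooth_trig| |exact: lF|].
    by apply/(conformal_toP (t1 := t1) (t2 := t2)).
  exact: (stationary_of_hsl t20 (@periodic_trig _ _ _) (@smooth_trig _ _ _) cF lF pF).
- have -> : (fun n => F (phi n)) = (fun n => trig (X (phi n))) by apply/funext => n; exact: FX.
  by apply: trig_smooth_cvg => a i; exact: Xcvg.
- apply: (conformal_structure_cvg_cst (A := fun n => model (t (phi n)).1 (t (phi n)).2)).
    by move=> n p; have [] := data (phi n).
  exact: model_cvg.
Qed.
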